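(* Let $h_0$ be a Riemannian metric on the $3$-dimensional conformal infinity $\partial_\infty M$ and let $\Psi$ be a symmetric $(0,2)$-tensor on $\partial_\infty M$ with $\operatorname{tr}_{h_0}\Psi=0$ and $\operatorname{div}_{h_0}\Psi=0$. A formal power series for an asymptotically hyperbolic $4$-metric in normal form $g=\frac{1}{x^2}(dx^2\oplus h_x)$ with $h(0)=h_0$, $h'(0)=0$, $h''(0)=-2P_{h_0}$, $h'''(0)=\Psi$, and $\frac{1}{3!}\operatorname{tr}_{h_0}\left(h^{(4)}(0)\right)=|P_{h_0}|^2_{h_0}$ is a formal solution of the system $B_g=0$, $Q_g=6$ if and only if it is a formal solution of the Einstein equations $\operatorname{Ric}_g+3g=0$.
   Context: Here $n=\dim M=4$. The Bach tensor of $g$ is $B_{ac}=\frac{1}{n-3}\nabla^b\nabla^dW_{abcd}+\frac{1}{n-2}W_{abcd}R^{bd}$, where $W$ is the Weyl tensor and $R_{ab}$ the Ricci tensor ($R_{bd}=R^a{}_{bad}$). The Branson $Q$-curvature of a $4$-metric $g$ is $Q_g=\frac16\left[-\Delta_gR_g+R_g^2-3|\operatorname{Ric}_g|_g^2\right]$, with $R_g$ the scalar curvature and $\Delta_g=g^{ab}\nabla_a\nabla_b$. A metric is in (Graham--Lee) normal form on a collar of conformal infinity if $g=\frac{1}{x^2}(dx^2\oplus h_x)$, $x>0$, where $x$ is a special defining function ($|dx|_{x^2g}=1$) and $h_x\equiv h(x)$ is a family of Riemannian metrics on the level sets of $x$ extending differentiably to $x=0$; conformal infinity is $\{x=0\}$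 with the conformal class $[h_0]$, $h_0=h(0)$. Such metrics are called asymptotically hyperbolic. Primes and superscripts $(i)$ denote $x$-derivatives. The Schouten tensor of a metric $g$ in dimension $m\geq 3$ is $P=\frac{1}{m-2}\left(\operatorname{Ric}-\frac{R}{2(m-1)}g\right)$; thus for the $3$-metric $h_0$, $P_{h_0}=\operatorname{Ric}_{h_0}-\frac14R_{h_0}h_0$. A formal power series for such a metric is a formal series $h_x=\sum_{i\ge0}\frac{x^i}{i!}h^{(i)}(0)$, and it is a formal solution of an equation if all coefficients in the expansion of that equation in powers of $x$ vanish (using components with respect to $\partial_x$ and coordinates on the level sets). *)

(* Defs.v *)
From HB Require Import structures.
From mathcomp Require Import all_boot all_order all_algebra.
From mathcomp Require Import all_classical all_reals all_analysis.
From mathcomp Require Import zify.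

Set Implicit Arguments.
Unset Strict Implicit.
Unset Printing Implicit Defensive.

Import Order.TTheory GRing.Theory Num.Theory.
Import numFieldNormedType.Exports.

Local Open Scope classical_set_scope.
Local Open Scope ring_scope.

(* The field F((x)) of formal Laurent series: [k |-> f k] is the coefficient  *)
(* function, so that equality means equality of all coefficients.             *)

Section LaurentDef.
Variable F : fieldType.

Definition bounded_below (f : int -> F) : bool :=
  `[< exists N : int, forall k, k < N -> f k = 0 >].

Record laurent := Laurent {
  lcoef :> int -> F;
  _ : bounded_below lcoef }.

HB.instance Definition _ := [isSub for lcoef].
HB.instance Definition _ := [Choice of laurent by <:].

Lemma bounded_belowP (f : laurent) : exists N, forall k, k < N -> f k = 0.
Proof. by have /asboolP := valP f. Qed.

Lemma laurentP (f g : laurent) : (forall k, f k = g k) -> f = g.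
Proof. by move=> fg; apply/val_inj/funext. Qed.

Lemma bounded_below_zmod : zmod_closed bounded_below.
Proof.
split; first by apply/asboolP; exists 0.
move=> f g /asboolP[N fN] /asboolP[M gM]; apply/asboolP.
exists (Num.min N M) => k; rewrite lt_min => /andP[kN kM].
by rewrite /GRing.add/= /GRing.opp/= fN// gM// subr0.
Qed.

HB.instance Definition _ :=
  GRing.isZmodClosed.Build _ bounded_below bounded_below_zmod.
HB.instance Definition _ := [SubChoice_isSubZmodule of laurent by <:].

End LaurentDef.

Section LaurentField.
Variable F : fieldType.
Implicit Types f g h : laurent F.

(* Junk value 0 when the coefficients are not bounded below. *)
Definition laurent_of (c : int -> F) : laurent F := insubd 0 c.

Lemma laurent_ofE (c : int -> F) (N : int) :
  (forall k, k < N -> c k = 0) -> laurent_of c = c :> (int -> F).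
Proof. by move=> cN; apply: insubdK; apply/asboolP; exists N. Qed.

Definition lmul f g : laurent F :=
  laurent_of (fun k => \sum_(i \in [set: int]) f i * g (k - i)).

Definition lone : laurent F := laurent_of (fun k => (k == 0)%:R).

Lemma ldE f g k : (f + g) k = f k + g k. Proof. by []. Qed.
Lemma l0E k : (0 : laurent F) k = 0. Proof. by []. Qed.

Lemma loneE k : lone k = (k == 0)%:R.
Proof.
by rewrite (@laurent_ofE _ 0)// => {}k k0; rewrite lt_eqF.
Qed.

Section Conv.
Variables (f g : int -> F) (N M : int).
Hypotheses (fN : forall k, k < N -> f k = 0) (gM : forall k, k < M -> g k = 0).

Lemma conv_shift (n : nat) :
  \sum_(i \in [set: int]) f i * g (N + M + n%:Z - i) =
  \sum_(i < n.+1) f (N + i%:Z) * g (M + (n - i)%N%:Z).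
Proof.
pose s := [seq N + i%:Z | i <- iota 0 n.+1].
have us : uniq s.
  by rewrite map_inj_uniq ?iota_uniq// => i j /addrI [].
rewrite -(@fsbig_widen _ _ _ _ [set` s])//=.
  rewrite -fsbig_seq// big_map -[iota 0 n.+1]/(index_iota 0 n.+1) big_mkord.
  apply: eq_bigr => i _; congr (_ * g _).
  by have := ltn_ord i; lia.
move=> i [_] /= ni.
have [iN|Ni] := ltP i N; first by rewrite fN// mul0r.
rewrite (@gM (_ - i)) ?mulr0// ltNge; apply/negP => Mi; apply: ni.
apply/mapP; exists `|i - N|%N; last by lia.
by rewrite mem_iota; lia.
Qed.

Lemma conv_lt (k : int) : k < N + M ->
  \sum_(i \in [set: int]) f i * g (k - i) = 0.
Proof.
move=> kNM; rewrite fsbig1// => i _.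
have [iN|Ni] := ltP i N; first by rewrite fN// mul0r.
by rewrite (@gM (k - i)) ?mulr0//; lia.
Qed.

End Conv.

Lemma lmulE f g k : lmul f g k = \sum_(i \in [set: int]) f i * g (k - i).
Proof.
have [N fN] := bounded_belowP f; have [M gM] := bounded_belowP g.
by rewrite (@laurent_ofE _ (N + M))// => {}k; exact: conv_lt fN gM k.
Qed.

(* The first n coefficients of f from the order N on, as a polynomial. *)
Definition ltrunc (n : nat) (N : int) (f : laurent F) : {poly F} :=
  \poly_(i < n) f (N + i%:Z).

Lemma lmul_lt f g N M k : (forall k, k < N -> f k = 0) ->
  (forall k, k < M -> g k = 0) -> k < N + M -> lmul f g k = 0.
Proof. by move=> fN gM ?; rewrite lmulE (conv_lt fN gM). Qed.

Lemma lmul_trunc f g N M (m n : nat) : (forall k, k < N -> f k = 0) ->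
  (forall k, k < M -> g k = 0) -> (m < n)%N ->
  lmul f g (N + M + m%:Z) = (ltrunc n N f * ltrunc n M g)`_m.
Proof.
move=> fN gM mn; rewrite lmulE (conv_shift fN gM) coefM.
apply: eq_bigr => i _; rewrite !coef_poly.
by rewrite (leq_trans (ltn_ord i) mn) (leq_ltn_trans (leq_subr _ _) mn).
Qed.

Lemma int_geP (N k : int) : N <= k -> exists m : nat, k = N + m%:Z.
Proof. by move=> Nk; exists `|k - N|%N; lia. Qed.

Lemma lmulC : commutative lmul.
Proof.
move=> f g; apply: laurentP => k.
have [N fN] := bounded_belowP f; have [M gM] := bounded_belowP g.
have [kNM|/int_geP[m ->]] := ltP k (N + M).
  by rewrite (lmul_lt fN gM)// (lmul_lt gM fN)// addrC.
rewrite (lmul_trunc fN gM (ltnSn m)) mulrC [N + M]addrC.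
by rewrite (lmul_trunc gM fN (ltnSn m)).
Qed.

Lemma lmulA : associative lmul.
Proof.
move=> f g h; apply: laurentP => k.
have [N fN] := bounded_belowP f; have [M gM] := bounded_belowP g.
have [L hL] := bounded_belowP h.
have fgNM k' : k' < N + M -> lmul f g k' = 0 by exact: lmul_lt.
have ghML k' : k' < M + L -> lmul g h k' = 0 by exact: lmul_lt.
have [kNM|/int_geP[m ->]] := ltP k (N + M + L).
  by rewrite (lmul_lt fgNM hL)// (lmul_lt fN ghML)// addrA.
rewrite (lmul_trunc fgNM hL (ltnSn m)) -(addrA N M L) (lmul_trunc fN ghML (ltnSn m)).
transitivity ((ltrunc m.+1 N f * ltrunc m.+1 M g * ltrunc m.+1 L h)`_m).
  rewrite -mulrA !coefM; apply: eq_bigr => i _; congr (_ * _).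
  have im : (m - i < m.+1)%N by rewrite ltnS leq_subr.
  by rewrite [LHS]coef_poly im (lmul_trunc gM hL im).
rewrite !coefM; apply: eq_bigr => i _; congr (_ * _).
by rewrite [RHS]coef_poly ltn_ord (lmul_trunc fN gM (ltn_ord i)).
Qed.

Lemma lmul1 : left_id lone lmul.
Proof.
move=> f; apply: laurentP => k; have [N fN] := bounded_belowP f.
have o0 k' : k' < 0 -> lone k' = 0 by move=> k0; rewrite loneE lt_eqF.
have [kN|/int_geP[m ->]] := ltP k N.
  by rewrite (lmul_lt o0 fN) ?add0r// fN.
rewrite -[in LHS](add0r N) (lmul_trunc o0 fN (ltnSn m)).
have -> : ltrunc m.+1 0 lone = 1.
  apply/polyP => i; rewrite coef_poly coef1 loneE add0r.
  by case: ifP => //; case: i.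
by rewrite mul1r coef_poly ltnSn.
Qed.

Lemma lmulDl : left_distributive lmul +%R.
Proof.
move=> f g h; apply: laurentP => k; rewrite ldE.
have [N0 fN0] := bounded_belowP f; have [M0 gM0] := bounded_belowP g.
have [L hL] := bounded_belowP h.
pose N := Num.min N0 M0.
have fN k' : k' < N -> f k' = 0 by rewrite lt_min => /andP[/fN0].
have gN k' : k' < N -> g k' = 0 by rewrite lt_min => /andP[_ /gM0].
have fgN k' : k' < N -> (f + g) k' = 0.
  by move=> k'N; rewrite ldE fN// gN// addr0.
have [kNL|/int_geP[m ->]] := ltP k (N + L).
  by rewrite (lmul_lt fN hL)// (lmul_lt gN hL)// (lmul_lt fgN hL)// addr0.
rewrite (lmul_trunc fN hL (ltnSn m)) (lmul_trunc gN hL (ltnSn m)).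
rewrite (lmul_trunc fgN hL (ltnSn m)) -coefD -mulrDl.
congr (polyseq (_ * _))`_m.
by apply/polyP => i; rewrite coefD !coef_poly; case: ifP; rewrite ?addr0.
Qed.

Lemma lone_neq0 : lone != 0.
Proof.
apply/negP => /eqP /(congr1 (fun f : laurent F => f 0)).
by rewrite loneE l0E eqxx => /eqP; rewrite oner_eq0.
Qed.

HB.instance Definition _ := GRing.Zmodule_isComNzRing.Build (laurent F)
  lmulA lmulC lmul1 lmulDl lone_neq0.

Lemma lME f g k : (f * g) k = \sum_(i \in [set: int]) f i * g (k - i).
Proof. exact: lmulE. Qed.

Lemma l1E k : (1 : laurent F) k = (k == 0)%:R. Proof. exact: loneE. Qed.

(* The coefficients c_0, ..., c_(n-1) of the inverse of the power series with *)
(* coefficients a.                                                            *)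
Fixpoint inv_coefs (a : nat -> F) (n : nat) : seq F :=
  if n is m.+1 then
    rcons (inv_coefs a m)
      ((a 0%N)^-1 *
       ((m == 0%N)%:R - \sum_(j < m) a (m - j)%N * (inv_coefs a m)`_j))
  else [::].

Lemma size_inv_coefs a n : size (inv_coefs a n) = n.
Proof. by elim: n => //= n IHn; rewrite size_rcons IHn. Qed.

Lemma inv_coefs_nth a m n : (m < n)%N ->
  (inv_coefs a n)`_m = (inv_coefs a m.+1)`_m.
Proof.
elim: n => // n IHn; rewrite ltnS leq_eqVlt => /orP[/eqP->//|mn].
by rewrite [in LHS]/= nth_rcons size_inv_coefs mn IHn.
Qed.

Lemma inv_coefsP (a : nat -> F) : a 0%N != 0 ->
  exists c : nat -> F, forall n,
    \sum_(j < n.+1) c j * a (n - j)%N = (n == 0%N)%:R.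
Proof.
move=> a0; exists (fun n => (inv_coefs a n.+1)`_n) => n.
rewrite big_ord_recr subnn.
have -> : (inv_coefs a (@ord_max n).+1)`_(@ord_max n) = (a 0%N)^-1 *
    ((n == 0%N)%:R - \sum_(j < n) a (n - j)%N * (inv_coefs a n)`_j).
  by rewrite /= nth_rcons size_inv_coefs ltnn eqxx.
rewrite mulrAC mulVf// mul1r.
rewrite (eq_bigr (fun j : 'I_n => a (n - j)%N * (inv_coefs a n)`_j)).
  by rewrite [LHS]addrC subrK.
by move=> j _; rewrite mulrC (inv_coefs_nth _ (ltn_ord j)).
Qed.

Definition linv f : laurent F := xget 0 [set g | g * f = 1].

Lemma lmulVf f : f != 0 -> linv f * f = 1.
Proof.
move=> f0; rewrite /linv; case: xgetP => // nf; exfalso.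
have [N fN] := bounded_belowP f.
have [m0 fm0] : exists m : nat, f (N + m%:Z) != 0.
  apply: contrapT => /forallNP fz; move/eqP: f0; apply; apply: laurentP => k.
  have [/fN//|/int_geP[m ->]] := ltP k N.
  by have /negP := fz m; rewrite negbK => /eqP.
have ex : exists m, f (N + m%:Z) != 0 by exists m0.
case: (ex_minnP ex) => d fd dmin; pose L := N + d%:Z.
have fL k : k < L -> f k = 0.
  have [/fN//|/int_geP[m ->]] := ltP k N.
  rewrite /L ltrD2l ltz_nat => md; apply/eqP; apply: contraTT md => fm.
  by rewrite -leqNgt dmin.
have a0 : f (L + 0%N%:Z) != 0 by rewrite addr0.
have [c cP] := @inv_coefsP (fun n => f (L + n%:Z)) a0.
pose c' := fun k : int => if k < - L then 0 else c `|(k + L)%R|%N.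
have c'L k : k < - L -> c' k = 0 by rewrite /c' => ->.
apply: (nf (laurent_of c')); apply: laurentP => k.
rewrite lME l1E (laurent_ofE c'L).
have [kL|/int_geP[m ->]] := ltP k (- L + L).
  rewrite (conv_lt c'L fL)// lt_eqF//; move: kL; rewrite addNr => //.
rewrite (conv_shift c'L fL) addNr add0r eqz_nat -cP.
apply: eq_bigr => i _; congr (_ * _).
by rewrite /c' ltNge lerDl/=; congr c; lia.
Qed.

Lemma linv0 : linv 0 = 0.
Proof.
rewrite /linv; case: xgetP => // g _ /= /eqP.
by rewrite mulr0 eq_sym oner_eq0.
Qed.

HB.instance Definition _ :=
  GRing.ComNzRing_isField.Build (laurent F) lmulVf linv0.

Definition lmonom (c : F) (m : int) : laurent F :=
  laurent_of (fun k => c *+ (k == m)).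

(* The formal derivative with respect to x. *)
Definition lderiv (f : laurent F) : laurent F :=
  laurent_of (fun k => f (k + 1) *~ (k + 1)).

End LaurentField.

(* Tensor calculus in one coordinate chart.  Scalars are functions on X with  *)
(* values in K, D a is the a-th coordinate derivation and g is the matrix of  *)
(* metric components.  It is used with K = R for metrics on a 3-manifold, and *)
(* with K = R((x)) for formal metrics on a collar of it.                      *)
Section Curvature.
Variables (K : fieldType) (n : nat) (X : Type).
Variables (D : 'I_n -> (X -> K) -> X -> K) (g : X -> 'M[K]_n).
Implicit Types (a b c d e f : 'I_n) (p : X).

Definition ginv a b p : K := invmx (g p) a b.

(* Gamma^c_{ab} *)
Definition christoffel c a b p : K :=
  2^-1 * \sum_d ginv c d p *
    (D a (fun q => g q b d) p + D b (fun q => g q a d) p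
     - D d (fun q => g q a b) p).

(* R^a_{bcd} *)
Definition riemann_up a b c d p : K :=
  D c (christoffel a d b) p - D d (christoffel a c b) p
  + \sum_e (christoffel a c e p * christoffel e d b p
            - christoffel a d e p * christoffel e c b p).

Definition riemann a b c d p : K := \sum_e g p a e * riemann_up e b c d p.

Definition ricci b d p : K := \sum_a riemann_up a b a d p.

Definition tr2 (T : 'I_n -> 'I_n -> X -> K) p : K :=
  \sum_a \sum_b ginv a b p * T a b p.

Definition raise2 (T : 'I_n -> 'I_n -> X -> K) a b p : K :=
  \sum_c \sum_d ginv a c p * ginv b d p * T c d p.

Definition normsq2 (T : 'I_n -> 'I_n -> X -> K) p : K :=
  \sum_a \sum_b raise2 T a b p * T a b p.

Definition scalar_curv p : K := tr2 ricci p.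

Definition schouten a b p : K :=
  (n%:R - 2)^-1 *
    (ricci a b p - scalar_curv p / (2 * (n%:R - 1)) * g p a b).

Definition weyl a b c d p : K :=
  riemann a b c d p
  - (g p a c * schouten b d p + g p b d * schouten a c p
     - g p a d * schouten b c p - g p b c * schouten a d p).

(* The components of a covariant k-tensor are indexed by the lists of k       *)
(* indices; the first index of (covd T) is that of the derivative.            *)
Definition covd (T : seq 'I_n -> X -> K) (s : seq 'I_n) p : K :=
  if s is e :: t then
    D e (T t) p
    - \sum_(j < size t) \sum_f
        christoffel f e (nth e t j) p * T (set_nth e t j f) p
  else 0.

Definition tens0 (u : X -> K) (s : seq 'I_n) : X -> K :=
  if s is [::] then u else fun=> 0.

Definition tens2 (T : 'I_n -> 'I_n -> X -> K) (s : seq 'I_n) : X -> K :=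
  if s is [:: a; b] then T a b else fun=> 0.

Definition tens4 (T : 'I_n -> 'I_n -> 'I_n -> 'I_n -> X -> K) (s : seq 'I_n) :
    X -> K :=
  if s is [:: a; b; c; d] then T a b c d else fun=> 0.

Definition laplacian (u : X -> K) : X -> K :=
  tr2 (fun a b => covd (covd (tens0 u)) [:: a; b]).

Definition div2 (T : 'I_n -> 'I_n -> X -> K) c : X -> K :=
  tr2 (fun a b => covd (tens2 T) [:: a; b; c]).

Definition bach a c p : K :=
  (n%:R - 3)^-1 *
    (\sum_b \sum_d \sum_e \sum_f ginv b e p * ginv d f p *
       covd (covd (tens4 weyl)) [:: e; f; a; b; c; d] p)
  + (n%:R - 2)^-1 * \sum_b \sum_d weyl a b c d p * raise2 ricci b d p.

(* Branson's Q-curvature, with the coefficients of dimension 4. *)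
Definition qcurv4 p : K :=
  6^-1 * (- laplacian scalar_curv p + scalar_curv p ^+ 2 - 3 * normsq2 ricci p).

End Curvature.

Section Manifolds.
Variable R : realType.

Definition partial n (i : 'I_n) (f : 'rV[R]_n -> R) (p : 'rV[R]_n) : R :=
  'D_(delta_mx 0 i) f p.

(* All iterated partial derivatives exist and are continuous on U. *)
Definition smooth_on n (U : set 'rV[R]_n) (f : 'rV[R]_n -> R) : Prop :=
  forall (l : seq 'I_n) (p : 'rV[R]_n), U p ->
    {for p, continuous (foldr (@partial n) f l)} /\
    forall i, derivable (foldr (@partial n) f l) p (delta_mx 0 i).

Record smooth_manifold (n : nat) := SmoothManifold {
  carrier :> topologicalType;
  carrier_hausdorff : hausdorff_space carrier;
  carrier_second_countable : @second_countable carrier;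
  chart : Type;
  chart_dom : chart -> set carrier;
  chart_map : chart -> carrier -> 'rV[R]_n;
  chart_inv : chart -> 'rV[R]_n -> carrier;
  chart_cover : forall p, exists c, chart_dom c p;
  chart_dom_open : forall c, open (chart_dom c);
  chart_img_open : forall c, open (chart_map c @` chart_dom c);
  chart_mapK : forall c p, chart_dom c p -> chart_inv c (chart_map c p) = p;
  chart_map_continuous : forall c, {within chart_dom c, continuous (chart_map c)};
  chart_inv_continuous : forall c,
    {within chart_map c @` chart_dom c, continuous (chart_inv c)};
  chart_transition_smooth : forall c c' (j : 'I_n),
    smooth_on (chart_map c @` (chart_dom c `&` chart_dom c'))
      (fun u => chart_map c' (chart_inv c u) 0 j) }.

Definition chart_img n (M : smooth_manifold n) (c : chart M) : set 'rV[R]_n :=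
  chart_map c @` chart_dom c.

Definition transition n (M : smooth_manifold n) (c c' : chart M) :
    'rV[R]_n -> 'rV[R]_n :=
  fun u => chart_map c' (chart_inv c u).

(* Smooth symmetric (0,2)-tensor fields, given by their components in all the *)
(* charts.  As 'J acts on row vectors from the right, the components T of the *)
(* tensor in c and T' in c' are related by T = J *m T' *m J^T.  Components in *)
(* c are meaningful on (chart_img c) only.                                    *)
Record sym2 n (M : smooth_manifold n) := Sym2 {
  sym2_comp :> chart M -> 'rV[R]_n -> 'M[R]_n;
  sym2_sym : forall c u, chart_img c u -> (sym2_comp c u)^T = sym2_comp c u;
  sym2_smooth : forall c i j, smooth_on (chart_img c) (fun u => sym2_comp c u i j);
  sym2_change : forall c c' p, chart_dom c p -> chart_dom c' p ->
    let u := chart_map c p in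
    let J := 'J (transition c c') u in
    sym2_comp c u = J *m sym2_comp c' (transition c c' u) *m J^T }.

Definition riemannian n (M : smooth_manifold n) (h : sym2 M) : Prop :=
  forall c u, chart_img c u ->
    forall v : 'rV[R]_n, v != 0 -> 0 < (v *m h c u *m v^T) 0 0.

End Manifolds.

Section Collar.
Variables (R : realType) (M : smooth_manifold R 3).

(* Coordinate derivations of formal series in x with coefficients functions   *)
(* on coordinate space: d/dx, then the partial derivatives, which are taken   *)
(* coefficientwise.  Index 0 is x, and (rshift 1 i) is the i-th coordinate on *)
(* the level sets of x.                                                       *)
Definition collar_partial (a : 'I_(1 + 3)) (f : 'rV[R]_3 -> laurent R)
    (u : 'rV[R]_3) : laurent R :=
  match fintype.split a with
  | inl _ => lderiv (f u)
  | inr i => laurent_of (fun k => partial i (fun v => f v k) u)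
  end.

(* sum_k x^k / k! h_k *)
Definition formal_series (h : nat -> R) : laurent R :=
  laurent_of (fun k => if k is Posz m then h m / m`!%:R else 0).

(* The components of g = x^-2 (dx^2 + h_x), where h_x is the formal power     *)
(* series with derivatives h at x = 0, in the chart c.                        *)
Definition normal_form (h : nat -> sym2 M) (c : chart M) (u : 'rV[R]_3) :
    'M[laurent R]_(1 + 3) :=
  lmonom 1 (-2) *: block_mx 1%:M 0 0
    (\matrix_(i, j) formal_series (fun m => h m c u i j)).

Definition formal_einstein (h : nat -> sym2 M) : Prop :=
  forall c u, chart_img c u -> forall a b,
    ricci collar_partial (normal_form h c) a b u
    + 3 * normal_form h c u a b = 0.

Definition formal_bach_flat (h : nat -> sym2 M) : Prop :=
  forall c u, chart_img c u -> forall a b,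
    bach collar_partial (normal_form h c) a b u = 0.

Definition formal_Q_eq (q : R) (h : nat -> sym2 M) : Prop :=
  forall c u, chart_img c u ->
    qcurv4 collar_partial (normal_form h c) u = lmonom q 0.

End Collar.

(* Main.v *)
Require Import Defs.
From HB Require Import structures.
From mathcomp Require Import all_boot all_order all_algebra.
From mathcomp Require Import all_classical all_reals all_analysis.
From mathcomp Require Import ring zify.
Import Order.TTheory GRing.Theory Num.Theory.
Import numFieldNormedType.Exports.
Local Open Scope classical_set_scope.
Local Open Scope ring_scope.
Set Implicit Arguments.
Unset Strict Implicit.
Unset Printing Implicit Defensive.

(** Why the equivalence holds.  Let E = Ric + 3 g, let e be its trace and put
    S = (E - (e / 6) g) / 2, so that the Schouten tensor of g is S - g / 2.
    Since the metric is parallel, the contracted second Bianchi identity turns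
    the two equations into equations on E:
      B_ac = nabla^b (nabla_b S_ac - nabla_a S_bc) + W_abcd E^bd / 2
                                                  (bach4E, con_W4_Ric, cottonE),
      6 Q = 36 - Delta e - 6 e + e^2 - 3 |E|^2                           (Q4E).
    So E = 0 gives B = 0 and Q = 6 (einstein_bach4, einstein_Q4).

    Conversely, filter everything by the order of vanishing in x, and say that
    E has order s if its components are O(x^(s-2)).  For g = x^-2 (dx^2 + h_x)
    the Levi-Civita connection is x^-1 times an explicit algebraic operator, up
    to terms of higher order (act_lead), and a tangential derivative gains one
    order over x d/dx.  Therefore, at the lowest order s of E, a differential
    equation becomes a polynomial in s, its indicial polynomial:
      Q = 6      reads  (s (s - 3) + 6) e = 0                      (Q4_step),
      div E = de / 2    reads  (s - 4) E_0b = 0               (bianchi_step),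
      B_ij = 0   reads  (s - 1) (s - 2) S_ij = 0                 (bach_step).
    The terms in which E occurs quadratically, or multiplied by the Weyl tensor
    (which has order 1, ord_W4), are of higher order.  From s = 3 on, the only
    root met is s = 4, in the components E_0b, and there the hypotheses on h'''
    and on the trace of h'''' enter: by the formulas ein00, ein0r and einrr for
    the Ricci tensor of a metric in normal form, the prescribed coefficients
    make E of order 3 (ord1_ein) and E_0b of order 5 (ord3_ein0).  Hence every
    coefficient of E vanishes (einstein_ord).

    The tensor calculus is done once and for all over a commutative ring with
    commuting derivations (diffRing).  In a chart with image U the ring consists
    of the functions on U with values in Laurent series, with smooth coefficients
    and poles of bounded order (ccollar); Schwarz's theorem (partialC) makes its
    derivations commute.  Curvature at a point, as it is defined for an arbitrary
    field of coefficients, is compared with curvature over this ring through a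
    relation that every operation preserves (Bridge and Bridge4). *)

(** * Tensor calculus over a differential ring *)

Section Deltas.
Variables (R : comPzRingType) (I : finType).

Lemma sum_deltal a (F : I -> R) : \sum_b (a == b)%:R * F b = F a.
Proof.
rewrite (bigD1 a)//= eqxx mul1r big1 ?addr0// => b ba.
by rewrite eq_sym (negbTE ba) mul0r.
Qed.

Lemma sum_deltar a (F : I -> R) : \sum_b F b * (b == a)%:R = F a.
Proof.
by rewrite -[RHS]sum_deltal; apply: eq_bigr => b _; rewrite mulrC eq_sym.
Qed.

End Deltas.

(** A ring of scalar functions with coordinate derivations. Only the primes 2
    and 3 have to be inverted in the curvature formulas of dimensions 3 and 4;
    half and third are fields of the record, so that no unit structure is needed
    on rings of functions. *)
Record diffRing (n : nat) := DiffRing {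
  dr_ring :> comPzRingType;
  der : 'I_n -> {additive dr_ring -> dr_ring};
  derM : forall i a b, der i (a * b) = der i a * b + a * der i b;
  derC : forall i j a, der i (der j a) = der j (der i a);
  half : dr_ring;
  third : dr_ring;
  half2 : half * 2 = 1;
  third3 : third * 3 = 1 }.
Arguments derM {n d}.
Arguments derC {n d}.
Arguments half {n d}.
Arguments third {n d}.

Record metric n (A : diffRing n) := Metric {
  met :> 'I_n -> 'I_n -> A;
  imet : 'I_n -> 'I_n -> A;
  metC : forall a b, met a b = met b a;
  imetC : forall a b, imet a b = imet b a;
  imetV : forall a c, \sum_b imet a b * met b c = (a == c)%:R }.

Section TensorCalculus.
Variables (n : nat) (A : diffRing n) (g : metric A).
Implicit Types (a b c d e f : 'I_n) (u v : A).
Local Notation gi := (imet g).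
Local Notation D := (@der n A).

Lemma der1 e : D e 1 = 0.
Proof.
have := @derM n A e 1 1; rewrite !mulr1 mul1r => h.
by apply: (addrI (D e 1)); rewrite addr0 -h.
Qed.

Lemma der_nat e k : D e k%:R = 0.
Proof. by rewrite raddfMn der1 mul0rn. Qed.

Lemma der_half e : D e half = 0.
Proof.
have := congr1 (D e) (half2 A); rewrite derM der_nat mulr0 addr0 der1 => h.
by rewrite -[LHS]mulr1 -(half2 A) mulrCA h mulr0.
Qed.

Lemma der_third e : D e third = 0.
Proof.
have := congr1 (D e) (third3 A); rewrite derM der_nat mulr0 addr0 der1 => h.
by rewrite -[LHS]mulr1 -(third3 A) mulrCA h mulr0.
Qed.

(** F lists the values of a tensor in the two slots to be contracted, the other
    slots being fixed. *)
Definition con (F : 'I_n -> 'I_n -> A) : A := \sum_a \sum_b gi a b * F a b.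

Lemma eq_con F G : (forall a b, F a b = G a b) -> con F = con G.
Proof. by move=> FG; do 2!apply: eq_bigr => ? _; rewrite FG. Qed.

Lemma conD F G : con (fun a b => F a b + G a b) = con F + con G.
Proof.
rewrite -big_split; apply: eq_bigr => a _ /=; rewrite -big_split.
by apply: eq_bigr => b _; rewrite mulrDr.
Qed.

Lemma conZ u F : con (fun a b => u * F a b) = u * con F.
Proof.
rewrite mulr_sumr; apply: eq_bigr => a _; rewrite mulr_sumr.
by apply: eq_bigr => b _; rewrite mulrCA.
Qed.

Lemma conZr u F : con (fun a b => F a b * u) = con F * u.
Proof. by rewrite mulrC -conZ; apply: eq_con => a b; rewrite mulrC. Qed.

Lemma conN F : con (fun a b => - F a b) = - con F.
Proof. by rewrite -mulN1r -conZ; apply: eq_con => a b; rewrite mulN1r. Qed.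

Lemma conB F G : con (fun a b => F a b - G a b) = con F - con G.
Proof. by rewrite conD conN. Qed.

Lemma con0 F : (forall a b, F a b = 0) -> con F = 0.
Proof. by move=> F0; rewrite /con big1// => a _; rewrite big1// => b _; rewrite F0 mulr0. Qed.

Lemma con_sym F : con (fun a b => F b a) = con F.
Proof.
rewrite [LHS]exchange_big; do 2!apply: eq_bigr => ? _.
by rewrite imetC.
Qed.

Lemma con_sum (I : finType) (F : I -> 'I_n -> 'I_n -> A) :
  con (fun a b => \sum_i F i a b) = \sum_i con (F i).
Proof.
rewrite exchange_big; apply: eq_bigr => a _; rewrite exchange_big.
by apply: eq_bigr => b _; rewrite mulr_sumr.
Qed.

Lemma con_exchange F :
  con (fun a b => con (F a b)) = con (fun c d => con (fun a b => F a b c d)).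
Proof.
rewrite /con; under eq_bigr => a _ do under eq_bigr => b _ do
  (rewrite mulr_sumr; under eq_bigr => c _ do rewrite mulr_sumr).
transitivity (\sum_c \sum_d \sum_a \sum_b gi a b * (gi c d * F a b c d)); last first.
  apply: eq_bigr => c _; apply: eq_bigr => d _; rewrite mulr_sumr.
  apply: eq_bigr => a _; rewrite mulr_sumr.
  by apply: eq_bigr => b _; rewrite mulrCA.
rewrite (eq_bigr (fun a => \sum_c \sum_d \sum_b gi a b * (gi c d * F a b c d))).
  rewrite exchange_big; apply: eq_bigr => c _; rewrite exchange_big.
  by apply: eq_bigr => d _.
move=> a _; rewrite exchange_big; apply: eq_bigr => c _; exact: exchange_big.
Qed.

Lemma con_metl c X : con (fun a b => g a c * X b) = X c.
Proof.
rewrite /con exchange_big -[RHS]sum_deltal; apply: eq_bigr => b _.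
rewrite [c == b]eq_sym -(imetV g) mulr_suml.
by apply: eq_bigr => a _; rewrite mulrA (imetC g).
Qed.

Lemma con_metr c X : con (fun a b => g c b * X a) = X c.
Proof.
by rewrite -con_sym -[RHS](con_metl c); apply: eq_con => a b; rewrite metC.
Qed.

Lemma con_met2 : con (fun a b => g a b) = n%:R.
Proof.
rewrite /con (eq_bigr (fun=> 1)) => [|a _].
  by rewrite sumr_const card_ord.
by under eq_bigr do rewrite metC; rewrite imetV eqxx.
Qed.

Definition Gam f a b : A :=
  half * \sum_d gi f d * (D a (g b d) + D b (g a d) - D d (g a b)).

Lemma GamC f a b : Gam f a b = Gam f b a.
Proof.
congr (_ * _); apply: eq_bigr => d _; congr (_ * _).
by rewrite (metC g a b) [X in X - _]addrC.
Qed.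

Lemma Gam_low a b c :
  \sum_f Gam f a b * g f c = half * (D a (g b c) + D b (g a c) - D c (g a b)).
Proof.
rewrite /Gam (eq_bigr (fun f => half * \sum_d gi f d * g f c *
    (D a (g b d) + D b (g a d) - D d (g a b)))) => [|f _]; last first.
  by rewrite -mulrA mulr_suml; congr (_ * _); apply: eq_bigr => d _; ring.
rewrite -mulr_sumr exchange_big; congr (_ * _).
rewrite -[RHS](sum_deltar c (fun d => D a (g b d) + D b (g a d) - D d (g a b))).
apply: eq_bigr => d _.
rewrite -(imetV g) mulr_sumr; apply: eq_bigr => f _; rewrite (imetC g f d); ring.
Qed.

(** The term of the covariant derivative in direction e due to the slot b; F
    lists the values of the tensor when that slot varies. *)
Definition act e b (F : 'I_n -> A) : A := \sum_f Gam f e b * F f.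

Lemma eq_act e b F G : (forall f, F f = G f) -> act e b F = act e b G.
Proof. by move=> FG; apply: eq_bigr => f _; rewrite FG. Qed.

Lemma actD e b F G : act e b (fun f => F f + G f) = act e b F + act e b G.
Proof. by rewrite -big_split; apply: eq_bigr => f _; rewrite mulrDr. Qed.

Lemma actZ e b u F : act e b (fun f => u * F f) = u * act e b F.
Proof. by rewrite mulr_sumr; apply: eq_bigr => f _; rewrite mulrCA. Qed.

Lemma actZr e b u F : act e b (fun f => F f * u) = act e b F * u.
Proof. by rewrite mulrC -actZ; apply: eq_act => f; rewrite mulrC. Qed.

Lemma actN e b F : act e b (fun f => - F f) = - act e b F.
Proof. by rewrite -mulN1r -actZ; apply: eq_act => f; rewrite mulN1r. Qed.

Lemma act0 e b F : (forall f, F f = 0) -> act e b F = 0.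
Proof. by move=> F0; rewrite /act big1// => f _; rewrite F0 mulr0. Qed.

Lemma act_con e c F :
  act e c (fun f => con (F f)) = con (fun a b => act e c (fun f => F f a b)).
Proof.
by rewrite /act con_sum; apply: eq_bigr => f _; rewrite conZ.
Qed.

(** The Christoffel symbols are defined so that the metric is parallel. *)
Lemma der_met e a b : D e (g a b) = act e a (fun f => g f b) + act e b (fun f => g a f).
Proof.
rewrite /act [X in _ + X](eq_bigr (fun f => Gam f e b * g f a)) => [|f _]; last first.
  by rewrite (metC g a f).
rewrite !Gam_low (metC g b a).
have h := half2 A; ring: h.
Qed.

(** Differentiate imet * g = 1 and replace the derivative of g by its expression
    through the connection. *)
Lemma der_imet e a b :
  D e (gi a b) = - (\sum_f Gam a e f * gi f b) - \sum_f Gam b e f * gi a f.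
Proof.
have h c : \sum_b D e (gi a b) * g b c = - \sum_b gi a b * D e (g b c).
  have := congr1 (D e) (imetV g a c); rewrite der_nat raddf_sum/=.
  under eq_bigr do rewrite derM; rewrite big_split/= => /eqP.
  by rewrite addr_eq0 => /eqP.
transitivity (\sum_c (\sum_b D e (gi a b) * g b c) * gi c b).
  under eq_bigr do rewrite mulr_suml; rewrite exchange_big/=.
  rewrite -[LHS](sum_deltar b (fun c => D e (gi a c))); apply: eq_bigr => c _.
  rewrite eq_sym -(imetV g) mulr_sumr; apply: eq_bigr => d _.
  by rewrite (metC g d c) (imetC g b d) -mulrA [g c d * _]mulrC.
under eq_bigr => c _ do rewrite h.
rewrite (eq_bigr (fun c => - ((\sum_d gi a d * act e d (fun f => g f c)) * gi c b)
   - (\sum_d gi a d * act e c (fun f => g d f)) * gi c b)); last first.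
  move=> c _; rewrite mulNr -opprD -mulrDl -big_split/=; congr (- (_ * _)).
  by apply: eq_bigr => d _; rewrite der_met mulrDr.
rewrite big_split/= addrC; congr (_ + _).
  rewrite -sumrN; apply: eq_bigr => c _; congr (- (_ * _)).
  under eq_bigr do rewrite mulr_sumr.
  rewrite exchange_big -[RHS](sum_deltal a (fun f => Gam f e c)).
  apply: eq_bigr => f _; rewrite -(imetV g) mulr_suml.
  by apply: eq_bigr => d _; ring.
rewrite -sumrN (eq_bigr (fun c => - \sum_d gi a d * (act e d (fun f => g f c) * gi c b))).
  rewrite !sumrN exchange_big; congr (- _); apply: eq_bigr => d _.
  rewrite -mulr_sumr mulrC; congr (_ * _); rewrite /act.
  under eq_bigr do rewrite mulr_suml.
  rewrite exchange_big -[RHS](sum_deltar b (fun f => Gam f e d)).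
  apply: eq_bigr => f _; rewrite eq_sym -(imetV g) mulr_sumr.
  by apply: eq_bigr => c _; rewrite (metC g f c) (imetC g c b); ring.
by move=> c _; rewrite mulr_suml; congr (- _); apply: eq_bigr => d _; rewrite mulrA.
Qed.

(** The metric being parallel, contraction commutes with covariant
    differentiation. The three lemmas con_nab below follow by adding the
    connection terms of the free slots. *)
Lemma der_con e F : D e (con F) =
  con (fun a b => D e (F a b) - act e a (fun f => F f b) - act e b (fun f => F a f)).
Proof.
rewrite !conB raddf_sum/=.
under eq_bigr do rewrite raddf_sum/=.
under eq_bigr => a _ do under eq_bigr => b _ do rewrite derM.
under eq_bigr do rewrite big_split/=.
rewrite big_split/= addrC -!addrA; congr (_ + _).
transitivity (\sum_a \sum_b (- (\sum_f Gam a e f * (gi f b * F a b))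
    - \sum_f Gam b e f * (gi a f * F a b))).
  apply: eq_bigr => a _; apply: eq_bigr => b _; rewrite der_imet mulrDl !mulNr.
  by congr (- _ - _); rewrite mulr_suml; apply: eq_bigr => f _; rewrite mulrA.
under eq_bigr do rewrite big_split/=; rewrite big_split/=; congr (_ + _).
  under eq_bigr do rewrite sumrN; rewrite sumrN; congr (- _).
  rewrite (eq_bigr (fun a => \sum_f \sum_b Gam a e f * (gi f b * F a b))); last first.
    by move=> a _; exact: exchange_big.
  rewrite exchange_big; apply: eq_bigr => f _; rewrite exchange_big.
  by apply: eq_bigr => b _; rewrite mulr_sumr; apply: eq_bigr => a _; rewrite mulrCA.
under eq_bigr do rewrite sumrN; rewrite sumrN; congr (- _).
apply: eq_bigr => a _; rewrite exchange_big; apply: eq_bigr => f _.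
by rewrite mulr_sumr; apply: eq_bigr => b _; rewrite mulrCA.
Qed.

Definition nab1 (T : 'I_n -> A) e a : A := D e (T a) - act e a T.

Definition nab2 (T : 'I_n -> 'I_n -> A) e a b : A :=
  D e (T a b) - act e a (fun f => T f b) - act e b (fun f => T a f).

Definition nab3 (T : 'I_n -> 'I_n -> 'I_n -> A) e a b c : A :=
  D e (T a b c) - act e a (fun f => T f b c) - act e b (fun f => T a f c)
  - act e c (fun f => T a b f).

Definition nab4 (T : 'I_n -> 'I_n -> 'I_n -> 'I_n -> A) e a b c d : A :=
  D e (T a b c d) - act e a (fun f => T f b c d) - act e b (fun f => T a f c d)
  - act e c (fun f => T a b f d) - act e d (fun f => T a b c f).

Definition nab5 (T : 'I_n -> 'I_n -> 'I_n -> 'I_n -> 'I_n -> A) e a b c d h : A :=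
  D e (T a b c d h) - act e a (fun f => T f b c d h)
  - act e b (fun f => T a f c d h) - act e c (fun f => T a b f d h)
  - act e d (fun f => T a b c f h) - act e h (fun f => T a b c d f).

Lemma nab2_0 T e a b : (forall a b, T a b = 0) -> nab2 T e a b = 0.
Proof. by move=> T0; rewrite /nab2 T0 raddf0 !act0 // !subr0. Qed.

Lemma nab3_0 T e a b c : (forall a b c, T a b c = 0) -> nab3 T e a b c = 0.
Proof. by move=> T0; rewrite /nab3 T0 raddf0 !act0 // !subr0. Qed.

Lemma con_nab2 T e : con (fun a b => nab2 T e a b) = D e (con T).
Proof. by rewrite der_con. Qed.

Lemma con_nab4_13 T e b d :
  con (fun a c => nab4 T e a b c d) = nab2 (fun b d => con (fun a c => T a b c d)) e b d.
Proof.
rewrite /nab2 der_con !act_con -!conB; apply: eq_con => a c.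
by rewrite /nab4; ring.
Qed.

Lemma con_nab4_24 T e a c :
  con (fun b d => nab4 T e a b c d) = nab2 (fun a c => con (fun b d => T a b c d)) e a c.
Proof.
rewrite /nab2 der_con !act_con -!conB; apply: eq_con => b d.
by rewrite /nab4; ring.
Qed.

Lemma con_nab5_15 T e a b c :
  con (fun d f => nab5 T e f a b c d) = nab3 (fun a b c => con (fun d f => T f a b c d)) e a b c.
Proof.
rewrite /nab3 der_con !act_con -!conB; apply: eq_con => d f.
by rewrite /nab5; ring.
Qed.

Lemma nab2_lin u v T S e a b : (forall e, D e u = 0) -> (forall e, D e v = 0) ->
  nab2 (fun a b => u * T a b + v * S a b) e a b = u * nab2 T e a b + v * nab2 S e a b.
Proof. by move=> u0 v0; rewrite /nab2 raddfD/= !derM u0 v0 !actD !actZ; ring. Qed.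

Lemma nab2_subZ u T e a b :
  nab2 (fun a b => T a b - u * g a b) e a b = nab2 T e a b - D e u * g a b.
Proof. by rewrite /nab2 raddfB/= derM der_met !(actD, actN, actZ); ring. Qed.

Lemma nab2_subZmet u T e a b : (forall i, D i u = 0) ->
  nab2 (fun a b => T a b - u * g a b) e a b = nab2 T e a b.
Proof. by move=> u0; rewrite nab2_subZ u0 mul0r subr0. Qed.

Lemma eq_nab2 T S e a b : (forall a b, T a b = S a b) -> nab2 T e a b = nab2 S e a b.
Proof. by move=> TS; rewrite /nab2 TS; congr (_ - _ - _); apply: eq_act. Qed.

Lemma eq_nab3 T S e a b c : (forall a b c, T a b c = S a b c) ->
  nab3 T e a b c = nab3 S e a b c.
Proof. by move=> TS; rewrite /nab3 TS; congr (_ - _ - _ - _); apply: eq_act. Qed.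

Lemma eq_nab4 T S e a b c d : (forall a b c d, T a b c d = S a b c d) ->
  nab4 T e a b c d = nab4 S e a b c d.
Proof. by move=> TS; rewrite /nab4 TS; congr (_ - _ - _ - _ - _); apply: eq_act. Qed.

(** The Ricci tensor of a metric in normal form produces a divergence of a
    tensor of type (1,1); raising the index first costs nothing, since the
    derivative of imet cancels a connection term. *)
Lemma div_mixed T i :
  \sum_j D j (\sum_k gi j k * T k i)
  + \sum_j \sum_k Gam j j k * (\sum_l gi k l * T l i)
  - \sum_j \sum_k Gam k j i * (\sum_l gi j l * T l k) = con (fun a b => nab2 T a b i).
Proof.
rewrite /nab2 !conB; congr (_ - _); last first.
  rewrite [LHS](eq_bigr (fun j => \sum_l gi j l * act j i (fun k => T l k))) => [|j _].
    by [].
  under eq_bigr do rewrite mulr_sumr; rewrite exchange_big; apply: eq_bigr => l _.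
  by rewrite mulr_sumr; apply: eq_bigr => k _; rewrite mulrCA.
rewrite (eq_bigr (fun j => \sum_k gi j k * D j (T k i)
   - \sum_k \sum_f Gam j j f * (gi f k * T k i)
   - \sum_k \sum_f Gam k j f * (gi j f * T k i))); last first.
  move=> j _; rewrite raddf_sum -!sumrB; apply: eq_bigr => k _.
  rewrite derM der_imet mulrBl mulNr !mulr_suml addrC addrA.
  congr (_ - _ - _); apply: eq_bigr => f _; exact: esym (mulrA _ _ _).
rewrite !sumrB -!addrA; congr (_ + _); rewrite addrC -addrA.
have -> : \sum_j \sum_k \sum_f Gam j j f * (gi f k * T k i) =
    \sum_j \sum_k Gam j j k * \sum_l gi k l * T l i.
  apply: eq_bigr => j _; rewrite exchange_big; apply: eq_bigr => f _.
  by rewrite mulr_sumr.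
rewrite subrr addr0; congr (- _).
apply: eq_bigr => j _; rewrite exchange_big; apply: eq_bigr => f _.
by rewrite mulr_sumr; apply: eq_bigr => k _; rewrite mulrCA.
Qed.

End TensorCalculus.
Arguments GamC {n A g}.
Arguments der_met {n A g}.
Arguments eq_con {n A g F G}.
Arguments con_sym {n A g}.
Arguments eq_act {n A g e b F G}.

(** * Curvature and the Bianchi identities *)

Section Curvature.
Variables (n : nat) (A : diffRing n) (g : metric A).
Implicit Types (a b c d e f : 'I_n) (u v : A).
Local Notation gi := (imet g).
Local Notation D := (@der n A).
Local Notation con := (con g).
Local Notation act := (act g).
Local Notation Gam := (Gam g).
Local Notation nab2 := (nab2 g).
Local Notation nab3 := (nab3 g).
Local Notation nab4 := (nab4 g).

Definition Rup a b c d : A :=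
  D c (Gam a d b) - D d (Gam a c b)
  + \sum_e (Gam a c e * Gam e d b - Gam a d e * Gam e c b).

Definition Rm a b c d : A := \sum_e g a e * Rup e b c d.

Definition Ric b d : A := \sum_a Rup a b a d.

Definition Sc : A := con Ric.

Lemma Rup_anti a b c d : Rup a b c d = - Rup a b d c.
Proof.
rewrite /Rup !opprD opprK -sumrN [- _ + _]addrC; congr (_ + _).
by apply: eq_bigr => e _; rewrite opprB.
Qed.

Lemma Rup_bianchi1 a b c d : Rup a b c d + Rup a c d b + Rup a d b c = 0.
Proof.
have s : \sum_e (Gam a c e * Gam e d b - Gam a d e * Gam e c b)
    + \sum_e (Gam a d e * Gam e b c - Gam a b e * Gam e d c)
    + \sum_e (Gam a b e * Gam e c d - Gam a c e * Gam e b d) = 0.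
  rewrite -!big_split big1 // => e _ /=.
  by rewrite (GamC e d b) (GamC e c b) (GamC e d c); ring.
rewrite -[RHS]s /Rup (GamC a d b) (GamC a c b) (GamC a d c); ring.
Qed.

Definition uact e a (F : 'I_n -> A) : A := \sum_f Gam a e f * F f.

Definition nabRup e a b c d : A :=
  D e (Rup a b c d) + uact e a (fun f => Rup f b c d)
  - act e b (fun f => Rup a f c d) - act e c (fun f => Rup a b f d)
  - act e d (fun f => Rup a b c f).

(** The connection and curvature forms as matrices: the differential Bianchi
    identity is then an identity in a noncommutative ring with commuting
    derivations. *)
Definition cmx e : 'M[A]_n := \matrix_(a, b) Gam a e b.
Definition dmx e (X : 'M[A]_n) : 'M[A]_n := map_mx (D e) X.

Lemma dmxM e (X Y : 'M[A]_n) : dmx e (X *m Y) = dmx e X *m Y + X *m dmx e Y.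
Proof.
apply/matrixP => a b; rewrite !mxE raddf_sum -big_split; apply: eq_bigr => f _.
by rewrite !mxE derM.
Qed.

Definition Rmx c d : 'M[A]_n :=
  dmx c (cmx d) - dmx d (cmx c) + (cmx c *m cmx d - cmx d *m cmx c).

Lemma RmxE c d a b : Rmx c d a b = Rup a b c d.
Proof.
rewrite !mxE /Rup sumrB; congr (_ + (_ - _)).
  by apply: eq_bigr => f _; rewrite !mxE.
by apply: eq_bigr => f _; rewrite !mxE.
Qed.

Lemma dmxC c d X : dmx c (dmx d X) = dmx d (dmx c X).
Proof. by apply/matrixP => a b; rewrite !mxE derC. Qed.

Definition covRmx e c d : 'M[A]_n :=
  dmx e (Rmx c d) + (cmx e *m Rmx c d - Rmx c d *m cmx e).

(** Every product of at most three factors cmx or dmx cmx occurs twice with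
    opposite signs; the products are generalized and what remains is additive. *)
Lemma covRmx_cyclic c d e : covRmx e c d + covRmx c d e + covRmx d e c = 0.
Proof.
have dD h (X Y : 'M[A]_n) : dmx h (X + Y) = dmx h X + dmx h Y.
  by apply/matrixP => a b; rewrite !mxE raddfD.
have dN h (X : 'M[A]_n) : dmx h (- X) = - dmx h X.
  by apply/matrixP => a b; rewrite !mxE raddfN.
rewrite /covRmx /Rmx !(dD, dN) !dmxM !(mulmxDr, mulmxDl, mulmxN, mulNmx) !mulmxA.
rewrite (dmxC d c) (dmxC e c) (dmxC e d).
repeat match goal with |- context [mulmx ?X ?Y] => move: (mulmx X Y) => ? end.
by apply/matrixP => a b; rewrite !mxE; ring.
Qed.

Lemma covRmxE e a b c d : covRmx e c d a b =
  D e (Rup a b c d) + uact e a (fun f => Rup f b c d) - act e b (fun f => Rup a f c d).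
Proof.
rewrite /covRmx mxE [X in _ + X]mxE [X in _ + (_ + X)]mxE -addrA.
congr (_ + (_ - _)); first by rewrite mxE RmxE.
  by rewrite mxE; apply: eq_bigr => f _; rewrite RmxE mxE.
by rewrite mxE; apply: eq_bigr => f _; rewrite RmxE mxE mulrC.
Qed.

Lemma act_sym e b F : act e b F = act b e F.
Proof. by apply: eq_bigr => f _; rewrite GamC. Qed.

(** The connection terms of the two form indices cancel in pairs, as the
    connection has no torsion. *)
Lemma nabRup_cyclic a b c d e :
  nabRup e a b c d + nabRup c a b d e + nabRup d a b e c = 0.
Proof.
have h : covRmx e c d a b + covRmx c d e a b + covRmx d e c a b = 0.
  by have := congr1 (fun X : 'M[A]_n => X a b) (covRmx_cyclic c d e); rewrite !mxE.
have anti i j k : act i j (fun f => Rup a b f k) = - act i j (fun f => Rup a b k f).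
  by rewrite -actN; apply: eq_act => f; rewrite Rup_anti.
by rewrite -[RHS]h !covRmxE /nabRup !anti (act_sym c e) (act_sym d e) (act_sym d c); ring.
Qed.

Lemma nab4_Rm e a b c d : nab4 Rm e a b c d = \sum_h g a h * nabRup e h b c d.
Proof.
have am i (F : 'I_n -> 'I_n -> A) :
    act e i (fun f => \sum_h g a h * F f h) = \sum_h g a h * act e i (fun f => F f h).
  rewrite /act /=; under eq_bigr do rewrite mulr_sumr.
  rewrite exchange_big; apply: eq_bigr => h _; rewrite mulr_sumr.
  by apply: eq_bigr => f _; rewrite mulrCA.
rewrite /nab4 /Rm !am raddf_sum/=.
under eq_bigr do rewrite derM der_met mulrDl.
rewrite !big_split/=.
have -> : act e a (fun f => \sum_h g f h * Rup h b c d) =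
    \sum_h act e a (fun f => g f h) * Rup h b c d.
  rewrite /act/=; under [RHS]eq_bigr do rewrite mulr_suml.
  under eq_bigr do rewrite mulr_sumr; rewrite exchange_big/=.
  by apply: eq_bigr => h _; apply: eq_bigr => f _; rewrite mulrA.
have -> : \sum_h act e h (fun f => g a f) * Rup h b c d =
    \sum_h g a h * uact e h (fun f => Rup f b c d).
  rewrite /act /uact/=; under [RHS]eq_bigr do rewrite mulr_sumr.
  under eq_bigr do rewrite mulr_suml; rewrite exchange_big/=.
  by apply: eq_bigr => h _; apply: eq_bigr => f _; ring.
rewrite /nabRup; under [RHS]eq_bigr do rewrite !mulrBr mulrDr.
rewrite !big_split/= !sumrN; ring.
Qed.

Lemma nab4_Rm_cyclic a b c d e :
  nab4 Rm e a b c d + nab4 Rm c a b d e + nab4 Rm d a b e c = 0.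
Proof.
rewrite !nab4_Rm -!big_split big1//= => h _.
by rewrite -!mulrDr nabRup_cyclic mulr0.
Qed.

Lemma Rm_anti34 a b c d : Rm a b c d = - Rm a b d c.
Proof. by rewrite /Rm -sumrN; apply: eq_bigr => h _; rewrite Rup_anti mulrN. Qed.

Lemma Rm_bianchi1 a b c d : Rm a b c d + Rm a c d b + Rm a d b c = 0.
Proof.
rewrite /Rm -!big_split big1//= => h _.
by rewrite -!mulrDr Rup_bianchi1 mulr0.
Qed.

(** Expand D c (D d (g a b)) with der_met: the part symmetric in a and b of the
    curvature is the commutator of the derivations D c and D d on g a b. *)
Lemma Rm_anti12 a b c d : Rm a b c d = - Rm b a c d.
Proof.
pose L d a b := \sum_f g a f * Gam f d b.
pose Q c d a b := \sum_f \sum_h g f h * Gam h c a * Gam f d b.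
have QC i j k l : Q i j k l = Q j i l k.
  rewrite /Q exchange_big; do 2!apply: eq_bigr => ? _.
  by rewrite mulrAC (metC g).
have gL i j k : D i (g j k) = L i j k + L i k j.
  rewrite der_met addrC /act /L; congr (_ + _); apply: eq_bigr => f _.
    by rewrite mulrC.
  by rewrite mulrC (metC g f k).
have RmE i j k l : Rm i j k l = D k (L l i j) - D l (L k i j) - (Q k l i j - Q l k i j).
  have DL k' l' : D k' (L l' i j) = Q k' l' i j
      + \sum_f (g i f * D k' (Gam f l' j) + g i f * \sum_h Gam f k' h * Gam h l' j).
    rewrite raddf_sum/=; under eq_bigr do rewrite derM gL !mulrDl.
    rewrite !big_split/= [X in X + _ = _]addrC -addrA; congr (_ + _).
      by apply: eq_bigr => f _; rewrite mulr_suml.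
    rewrite addrC; congr (_ + _).
    rewrite /L; under eq_bigr do rewrite mulr_suml.
    rewrite exchange_big; apply: eq_bigr => f _; rewrite mulr_sumr.
    by apply: eq_bigr => h _; rewrite mulrA.
  rewrite !DL /Rm /Rup.
  rewrite (eq_bigr (fun f => (g i f * D k (Gam f l j) + g i f * \sum_h Gam f k h * Gam h l j)
    - (g i f * D l (Gam f k j) + g i f * \sum_h Gam f l h * Gam h k j))).
    by rewrite big_split/= sumrN; ring.
  by move=> f _; rewrite sumrB; ring.
have h : D c (D d (g a b)) - D d (D c (g a b)) = 0 by rewrite derC subrr.
move: h; rewrite !gL !raddfD/= => h.
apply/eqP; rewrite -addr_eq0 !RmE (QC c d b a) (QC d c b a) -[X in _ == X]h.
by apply/eqP; ring.
Qed.

(** The octahedron argument: a signed sum of the four first Bianchi identities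
    h1 to h4. *)
Lemma Rm_pair a b c d : Rm a b c d = Rm c d a b.
Proof.
have h1 := Rm_bianchi1 a b c d; have h2 := Rm_bianchi1 b c d a.
have h3 := Rm_bianchi1 c d a b; have h4 := Rm_bianchi1 d a b c.
rewrite (Rm_anti34 a c d b) in h1.
rewrite (Rm_anti34 b c d a) (Rm_anti12 b a) in h2.
rewrite (Rm_anti12 c a) (Rm_anti12 c b d a) (Rm_anti34 b c d a) opprK in h3.
rewrite (Rm_anti12 d a) (Rm_anti12 d b c a) (Rm_anti34 b d c a) opprK (Rm_anti12 d c) in h4.
have h2' := half2 A.
rewrite -[LHS]mulr1 -[RHS]mulr1 -h2'.
transitivity (Rm c d a b * (half * 2) + half * (
 (Rm a b c d - Rm a c b d + Rm a d b c) - (- Rm b c a d + Rm b d a c - Rm a b c d)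
 - (Rm c d a b - Rm a c b d + Rm b c a d) + (- Rm a d b c + Rm b d a c - Rm c d a b))).
  ring.
by rewrite h1 h2 h3 h4; ring.
Qed.

Lemma RicE b d : Ric b d = con (fun a c => Rm a b c d).
Proof.
rewrite /con exchange_big; apply: eq_bigr => c _.
rewrite -(sum_deltal c (fun e => Rup e b c d)).
under [RHS]eq_bigr do rewrite mulr_sumr.
rewrite exchange_big; apply: eq_bigr => e _.
rewrite -(imetV g) mulr_suml; apply: eq_bigr => a _.
by rewrite mulrA (imetC g).
Qed.

Lemma RicC b d : Ric b d = Ric d b.
Proof.
by rewrite !RicE -con_sym; apply: eq_con => a c; rewrite Rm_pair.
Qed.

Lemma con24_Rm a c : con (fun b d => Rm a b c d) = Ric a c.
Proof.
rewrite RicE; apply: eq_con => b d.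
by rewrite Rm_anti12 Rm_anti34 opprK.
Qed.

Lemma nab2_RicC e a b : nab2 Ric e a b = nab2 Ric e b a.
Proof.
by rewrite /nab2 addrAC RicC; congr (_ - _ - _); apply: eq_act => f; exact: RicC.
Qed.

(** Contract the second Bianchi identity once, after moving the contracted slot
    to the first pair with Rm_pair. *)
Lemma div_Rm a b c :
  con (fun d f => nab4 Rm f a b c d) = nab2 Ric b a c - nab2 Ric a b c.
Proof.
have E d f : nab4 Rm f a b c d = - nab4 Rm a c d b f + nab4 Rm b d c f a.
  have -> : nab4 Rm f a b c d = nab4 Rm f c d a b.
    rewrite (@eq_nab4 n A g Rm (fun a b c d => Rm c d a b)); last exact: Rm_pair.
    by rewrite /nab4; ring.
  have -> : nab4 Rm b d c f a = - nab4 Rm b c d f a.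
    rewrite (@eq_nab4 n A g Rm (fun a b c d => - Rm b a c d)); last exact: Rm_anti12.
    by rewrite /nab4 raddfN !actN; ring.
  by rewrite -[LHS]subr0 -(nab4_Rm_cyclic c d a b f); ring.
rewrite (eq_con E) conD conN con_nab4_24 con_nab4_13 addrC.
congr (_ - _).
  rewrite (@eq_nab2 n A g _ Ric) => [|x y]; first exact: nab2_RicC.
  by rewrite RicE.
rewrite (@eq_nab2 n A g _ Ric); last exact: con24_Rm.
exact: nab2_RicC.
Qed.

(** Contract the divergence of the Riemann tensor a second time. *)
Lemma div_Ric b : con (fun a c => nab2 Ric a c b) = half * D b Sc.
Proof.
have h : con (fun d f => nab2 Ric f b d) = D b Sc - con (fun a c => nab2 Ric a c b).
  rewrite -con_nab2 -conB.
  rewrite -(eq_con (F := fun d f => con (fun a c => nab4 Rm f a b c d))); last first.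
    move=> d f; rewrite con_nab4_13; apply: eq_nab2 => x y; by rewrite RicE.
  rewrite con_exchange; apply: eq_con => a c.
  by rewrite div_Rm (nab2_RicC a b c).
have e : con (fun d f => nab2 Ric f b d) = con (fun a c => nab2 Ric a c b).
  by rewrite -con_sym; apply: eq_con => a c; rewrite nab2_RicC.
rewrite e in h; have h2 := half2 A.
transitivity (half * (con (fun a c => nab2 Ric a c b) + con (fun a c => nab2 Ric a c b))).
  by rewrite mulrDr -mulrDl -mulr2n -mulr_natr h2 mul1r.
by rewrite {1}h subrK.
Qed.

End Curvature.

(** * The Bach tensor and the Q-curvature through the Einstein operator *)

Section Conformal.
Variables (n : nat) (A : diffRing n) (g : metric A).
Implicit Types (a b c d e f : 'I_n) (u v : A).

(** k1 and k2 stand for 1 / (n - 2) and 1 / (2 (n - 1)), which are elements of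
    the ring in the dimensions at hand. *)
Definition sch (k1 k2 : A) a b : A := k1 * (Ric g a b - Sc g * k2 * g a b).

Definition wey (k1 k2 : A) a b c d : A :=
  Rm g a b c d - (g a c * sch k1 k2 b d + g b d * sch k1 k2 a c
     - g a d * sch k1 k2 b c - g b c * sch k1 k2 a d).

Definition lap u : A := con g (nab1 g (fun b => der A b u)).

Definition raise (T : 'I_n -> 'I_n -> A) a b : A :=
  \sum_c \sum_d imet g a c * imet g b d * T c d.

Definition normsq (T : 'I_n -> 'I_n -> A) : A := \sum_a \sum_b raise T a b * T a b.

Lemma sum_raise (T U : 'I_n -> 'I_n -> A) :
  \sum_a \sum_b T a b * raise U a b =
  con g (fun a c => con g (fun b d => T a b * U c d)).
Proof.
rewrite /con; apply: eq_bigr => a _.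
under [RHS]eq_bigr do rewrite mulr_sumr.
rewrite exchange_big/=; apply: eq_bigr => b _.
rewrite /raise mulr_sumr; apply: eq_bigr => c _; rewrite !mulr_sumr.
by apply: eq_bigr => d _; ring.
Qed.

Lemma normsqE T : normsq T = con g (fun a c => con g (fun b d => T a b * T c d)).
Proof.
rewrite -sum_raise /normsq; do 2!apply: eq_bigr => ? _; exact: mulrC.
Qed.

End Conformal.

Section Dim4.
Variables (A : diffRing (1 + 3)) (g : metric A).
Implicit Types (a b c d e f : 'I_(1 + 3)) (u v : A).
Local Notation gi := (imet g).
Local Notation D := (@der _ A).
Local Notation con := (con g).
Local Notation act := (act g).
Local Notation nab2 := (nab2 g).
Local Notation nab3 := (nab3 g).
Local Notation nab4 := (nab4 g).
Local Notation nab5 := (nab5 g).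
Local Notation Rm := (Rm g).
Local Notation Ric := (Ric g).
Local Notation Sc := (Sc g).

Definition P4 := sch g half (half * third).
Definition W4 := wey g half (half * third).

Definition bach4 a c : A :=
  (\sum_b \sum_d \sum_e \sum_f gi b e * gi d f *
     nab5 (fun f a b c d => nab4 W4 f a b c d) e f a b c d)
  + half * \sum_b \sum_d W4 a b c d * raise g Ric b d.

Definition Q4 : A := half * third * (- lap g Sc + Sc ^+ 2 - 3 * normsq g Ric).

Definition cotton a b c : A := nab2 P4 b a c - nab2 P4 a b c.

Lemma con_P4 : con P4 = half * third * Sc.
Proof.
rewrite /P4 /sch conZ conB conZ con_met2 -/Sc.
have h := half2 A; have t := third3 A.
rewrite [(1 + 3)%:R](_ : _ = 4 :> A) //.
transitivity (half * third * Sc +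
  half * Sc * ((1 - third * 3) + 2 * third * (1 - half * 2))); first by ring.
by rewrite h t; ring.
Qed.

Lemma con_W4 a c : con (fun b d => W4 a b c d) = 0.
Proof.
rewrite conB con24_Rm conB conB conD conZ.
rewrite [X in _ + X - _ - _](_ : _ = 4 * P4 a c); last first.
  by rewrite conZr con_met2.
rewrite [X in _ - X - _](_ : _ = P4 a c); last first.
  by rewrite -[RHS](con_metr g a (fun b => P4 b c)); apply: eq_con => b d.
rewrite [X in _ - X](_ : _ = P4 a c); last first.
  by rewrite -[RHS](con_metl g c (fun d => P4 a d)).
rewrite con_P4 /P4 /sch; have h := half2 A; have t := third3 A.
transitivity ((1 - half * 2) * Ric a c + half * third * Sc * g a c * (half * 2 - 1)).
  ring.
by rewrite h; ring.
Qed.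

(** The metric is parallel, so that only T is differentiated. *)
Lemma nab4_gP (T : 'I_(1 + 3) -> 'I_(1 + 3) -> A) e a b c d :
  nab4 (fun a b c d => Rm a b c d -
    (g a c * T b d + g b d * T a c - g a d * T b c - g b c * T a d)) e a b c d =
  nab4 Rm e a b c d -
  (g a c * nab2 T e b d + g b d * nab2 T e a c
   - g a d * nab2 T e b c - g b c * nab2 T e a d).
Proof.
rewrite /nab4 /nab2 !(raddfB, raddfD, raddfN)/= !derM !der_met.
by rewrite !(actD, actN, actZ, actZr); ring.
Qed.

Lemma nab2_P4 e a b :
  nab2 P4 e a b = half * nab2 Ric e a b - half * half * third * D e Sc * g a b.
Proof.
rewrite /nab2 /P4 /sch; rewrite !(derM, raddfB, der_half, der_third)/= der_met.
by rewrite !(actD, actN, actZ); ring.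
Qed.

Lemma div_P4 b : con (fun d f => nab2 P4 f b d) = half * third * D b Sc.
Proof.
rewrite (eq_con (fun d f => nab2_P4 f b d)) conB conZ.
have -> : con (fun d f => nab2 Ric f b d) = half * D b Sc.
  by rewrite -div_Ric -con_sym; apply: eq_con => d f; rewrite nab2_RicC.
have -> : con (fun d f => half * half * third * D f Sc * g b d) =
    half * half * third * D b Sc.
  rewrite -[RHS](con_metr g b (fun f => half * half * third * D f Sc)) -con_sym.
  by apply: eq_con => d f; rewrite mulrC.
have h := half2 A; have t := third3 A.
transitivity (half * third * D b Sc + half * half * D b Sc * (1 - third * 3)
  + half * third * D b Sc * (half * 2 - 1)); first by ring.
by rewrite h t; ring.
Qed.

(** Here the dimension matters: with n = 4 the trace terms of the Weyl tensor
    turn the divergence of the Riemann tensor into that of the Schouten tensor,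
    as div P = d (tr P). *)
Lemma div_W4 a b c : con (fun d f => nab4 W4 f a b c d) = cotton a b c.
Proof.
rewrite (eq_con (fun d f => nab4_gP P4 f a b c d)) conB div_Rm.
rewrite conB conB conD.
have -> : con (fun d f => g a c * nab2 P4 f b d) = g a c * (half * third * D b Sc).
  by rewrite conZ div_P4.
have -> : con (fun d f => g b c * nab2 P4 f a d) = g b c * (half * third * D a Sc).
  by rewrite conZ div_P4.
have -> : con (fun d f => g b d * nab2 P4 f a c) = nab2 P4 b a c.
  by rewrite -con_sym con_metr.
have -> : con (fun d f => g a d * nab2 P4 f b c) = nab2 P4 a b c.
  by rewrite -con_sym con_metr.
rewrite /cotton !nab2_P4.
have h := half2 A; have t := third3 A.
pose X := nab2 Ric b a c - nab2 Ric a b c.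
transitivity (half * X - half * half * third * (D b Sc * g a c - D a Sc * g b c)
  - (half * 2 - 1) * X - half * third * (1 - half * 2) * (D b Sc * g a c - D a Sc * g b c)).
  by rewrite /X; ring.
by rewrite h /X; ring.
Qed.

Lemma bach4E a c : bach4 a c =
  con (fun b e => nab3 cotton e a b c)
  + half * con (fun b b' => con (fun d d' => W4 a b c d * Ric b' d')).
Proof.
rewrite /bach4 sum_raise; congr (_ + _).
apply: eq_bigr => b _; rewrite exchange_big/=.
apply: eq_bigr => e _.
rewrite -(eq_nab3 g e a b c div_W4) -con_nab5_15 mulr_sumr; apply: eq_bigr => d _.
by rewrite mulr_sumr; apply: eq_bigr => f _; rewrite mulrA.
Qed.

(** The operator that vanishes on the Einstein metrics in question. *)
Definition ein a b : A := Ric a b + 3 * g a b.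

Lemma einC a b : ein a b = ein b a.
Proof. by rewrite /ein RicC metC. Qed.

Lemma ScE : Sc = con ein - 12.
Proof.
rewrite -[LHS]/(con Ric) /ein conD conZ con_met2; ring.
Qed.

(** The Schouten tensor plus g / 2 (see P4E); it vanishes together with ein and
    has the same covariant derivative as the Schouten tensor. *)
Definition Sein a b : A := half * (ein a b - con ein * (half * third) * g a b).

Lemma P4E a b : P4 a b = Sein a b - half * g a b.
Proof.
rewrite /P4 /sch /Sein ScE [Ric a b](_ : _ = ein a b - 3 * g a b); last first.
  by rewrite /ein addrK.
have h := half2 A; have t := third3 A.
transitivity (half * (ein a b - con ein * (half * third) * g a b)
  - half * g a b + half * g a b * (2 * (half * 2 * (third * 3) - 1))); first by ring.
by rewrite h t; ring.
Qed.

Lemma nab2_P4E e a b : nab2 P4 e a b = nab2 Sein e a b.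
Proof.
by rewrite (eq_nab2 g e a b P4E) nab2_subZmet// => i; exact: der_half.
Qed.

Lemma cottonE a b c : cotton a b c = nab2 Sein b a c - nab2 Sein a b c.
Proof. by rewrite /cotton !nab2_P4E. Qed.

(** The Weyl tensor is trace free, so that the multiple of g in Ric = E - 3 g
    disappears. *)
Lemma con_W4_Ric a c : con (fun b b' => con (fun d d' => W4 a b c d * Ric b' d')) =
  con (fun b b' => con (fun d d' => W4 a b c d * ein b' d')).
Proof.
apply/eqP; rewrite -subr_eq0 -conB; apply/eqP.
transitivity (con (fun b b' => con (fun d d' => - 3 * (W4 a b c d * g b' d')))).
  apply: eq_con => b b'; rewrite -conB; apply: eq_con => d d'; rewrite /ein; ring.
transitivity (- 3 * con (fun d d' => W4 a d' c d)); last first.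
  by rewrite con_sym con_W4 mulr0.
rewrite con_exchange -conZ; apply: eq_con => d d'.
rewrite conZ -(con_metr g d' (fun b => W4 a b c d)); congr (_ * _).
by apply: eq_con => b b'; rewrite mulrC (metC g).
Qed.

Lemma con_metmet : con (fun a c => con (fun b d => g a b * g c d)) = 4.
Proof.
rewrite -[4](con_met2 g); apply: eq_con => a c.
by rewrite -[RHS](con_metr g c (fun b => g a b)); apply: eq_con => b d; rewrite mulrC.
Qed.

Lemma con_metE (T : 'I_(1 + 3) -> 'I_(1 + 3) -> A) :
  con (fun a c => con (fun b d => T a b * g c d)) = con T.
Proof.
apply: eq_con => a c; rewrite -[RHS](con_metr g c (fun b => T a b)).
by apply: eq_con => b d; rewrite mulrC.
Qed.

Lemma con_metEl (T : 'I_(1 + 3) -> 'I_(1 + 3) -> A) :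
  con (fun a c => con (fun b d => g a b * T c d)) = con T.
Proof.
rewrite -(con_metE T) -con_sym; apply: eq_con => a c.
by rewrite -con_sym; apply: eq_con => b d; rewrite mulrC.
Qed.

(** Expanding around Ric = -3 g, the constant terms give Q = 6, and what is left
    is linear in E up to the squares. *)
Lemma Q4E : Q4 = half * third *
  (- lap g (con ein) - 6 * con ein + con ein ^+ 2 - 3 * normsq g ein + 36).
Proof.
rewrite /Q4; congr (_ * _).
have -> : lap g Sc = lap g (con ein).
  apply: eq_con => a b; rewrite /nab1 ScE.
  have d i : D i (con ein - 12) = D i (con ein) by rewrite raddfB/= der_nat subr0.
  by rewrite d; congr (_ - _); apply: eq_act => f; rewrite d.
have -> : normsq g Ric = normsq g ein - 6 * con ein + 36.
  rewrite !normsqE.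
  transitivity (con (fun a c => con (fun b d => ein a b * ein c d))
     - 3 * con (fun a c => con (fun b d => ein a b * g c d))
     - 3 * con (fun a c => con (fun b d => g a b * ein c d))
     + 9 * con (fun a c => con (fun b d => g a b * g c d))).
    rewrite -!conZ -!conB -conD; apply: eq_con => a c.
    rewrite -!conZ -!conB -conD; apply: eq_con => b d; rewrite /ein; ring.
  by rewrite con_metmet con_metE con_metEl; ring.
by rewrite ScE; ring.
Qed.

(** Adding a multiple of the parallel tensor g does not change the contracted
    Bianchi identity. *)
Lemma div_ein b : con (fun a c => nab2 ein a c b) = half * D b (con ein).
Proof.
have -> : half * D b (con ein) = half * D b Sc.
  by rewrite ScE raddfB/= der_nat subr0.
rewrite -div_Ric; apply: eq_con => a c.
rewrite -(@nab2_subZmet _ _ g (-3) Ric) => [|i]; last by rewrite raddfN der_nat oppr0.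
by apply: eq_nab2 => x y; rewrite /ein mulNr opprK.
Qed.

Lemma cotton_ein0 : (forall a b, ein a b = 0) -> forall a b c, cotton a b c = 0.
Proof.
move=> e0 a b c.
have s0 x y : Sein x y = 0 by rewrite /Sein e0 con0// !mul0r subrr mulr0.
by rewrite cottonE !nab2_0 ?subrr.
Qed.

Lemma einstein_bach4 : (forall a b, ein a b = 0) -> forall a c, bach4 a c = 0.
Proof.
move=> e0 a c; rewrite bach4E con_W4_Ric !con0 ?mulr0 ?addr0//.
  by move=> b b'; rewrite con0// => d d'; rewrite e0 mulr0.
by move=> b e; rewrite nab3_0//; exact: cotton_ein0.
Qed.

Lemma einstein_Q4 : (forall a b, ein a b = 0) -> Q4 = 6.
Proof.
move=> e0; have h := half2 A; have t := third3 A.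
have e1 : con ein = 0 by exact: con0.
have e2 : normsq g ein = 0.
  by rewrite normsqE con0// => x y; rewrite con0// => ? ?; rewrite e0 mul0r.
have e3 : lap g 0 = 0.
  by rewrite /lap con0// => a b; rewrite /nab1 !raddf0 act0 ?subr0// => f; rewrite raddf0.
rewrite Q4E e1 e2 e3.
transitivity (6 + 6 * ((half : A) * 2 * (third * 3) - 1)); first by ring.
by rewrite h t; ring.
Qed.

End Dim4.

(** * Orders of vanishing at the boundary *)

(** The ring of functions on a collar, with coordinate index 0 for the boundary
    defining function xx, whose inverse is xi. The predicate ord s means O(x^s).
    Only its algebraic properties are recorded: ord_der0 says that x d/dx
    multiplies the leading term of order s by s, ord_derT that tangential
    derivatives do not lower the order. *)
Record collarRing := CollarRing {
  cl :> diffRing (1 + 3);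
  ord : int -> cl -> Prop;
  ord_le : forall s t a, s <= t -> ord t a -> ord s a;
  ord_0 : forall s, ord s 0;
  ordB : forall s a b, ord s a -> ord s b -> ord s (a - b);
  ordM : forall s t a b, ord s a -> ord t b -> ord (s + t) (a * b);
  ord_1 : ord 0 1;
  ord_half : ord 0 half;
  ord_third : ord 0 third;
  ord_cancel : forall s k a, ord s (k.+1%:R * a) -> ord s a;
  xx : cl;
  xi : cl;
  xxi : xx * xi = 1;
  ord_x : ord 1 xx;
  ord_xi : ord (-1) xi;
  der_xx : forall a, der cl a xx = (a == 0)%:R;
  ord_derT : forall i s a, ord s a -> ord s (der cl (rshift 1 i) a);
  ord_der0 : forall s a, ord s a -> ord (s + 1) (xx * der cl 0 a - s%:~R * a) }.
Arguments xx {c}.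
Arguments xi {c}.
Arguments ord {c}.

Section Orders.
Variable A : collarRing.
Implicit Types (s t : int) (a b u v : A).
Local Notation D := (@der _ A).

Lemma ordN s a : ord s a -> ord s (- a).
Proof. by move=> sa; rewrite -sub0r; apply: ordB => //; exact: ord_0. Qed.

Lemma ordD s a b : ord s a -> ord s b -> ord s (a + b).
Proof. by move=> sa sb; rewrite -[b]opprK; apply: ordB => //; exact: ordN. Qed.

Lemma ordDr s a b : ord s (a - b) -> ord s b -> ord s a.
Proof. by move=> ab b0; rewrite -(subrK b a); exact: ordD. Qed.

Lemma ordDl s a b : ord s (a - b) -> ord s a -> ord s b.
Proof. by move=> ab a0; rewrite -[b](subKr a); exact: ordB. Qed.

Lemma ord_sum s (I : finType) (F : I -> A) : (forall i, ord s (F i)) -> ord s (\sum_i F i).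
Proof. by move=> sF; elim/big_ind: _ => //; [exact: ord_0|exact: ordD]. Qed.

Lemma ord_nat k : ord 0 (k%:R : A).
Proof.
elim: k => [|k IH]; first exact: ord_0.
by rewrite -natr1; apply: ordD => //; exact: ord_1.
Qed.

Lemma ord_int (k : int) : ord 0 (k%:~R : A).
Proof.
case: k => k; first exact: ord_nat.
by rewrite NegzE mulrNz; apply: ordN; exact: ord_nat.
Qed.

Lemma ordZ s a b : ord 0 a -> ord s b -> ord s (a * b).
Proof. by move=> a0 sb; rewrite -[s]add0r; exact: ordM. Qed.

Lemma ord_mx s t a : s <= t + 1 -> ord t a -> ord s (xx * a).
Proof.
move=> st ta; apply: (@ord_le _ _ (1 + t)); first by rewrite addrC.
by apply: ordM => //; exact: ord_x.
Qed.

Lemma ord_mxi s t a : s <= t - 1 -> ord t a -> ord s (xi * a).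
Proof.
move=> st ta; apply: (@ord_le _ _ (- 1 + t)); first by rewrite addrC.
by apply: ordM => //; exact: ord_xi.
Qed.

Lemma xxiK a : xx * (xi * a) = a. Proof. by rewrite mulrA xxi mul1r. Qed.
Lemma xixK a : xi * (xx * a) = a. Proof. by rewrite mulrCA xxiK. Qed.

Lemma ord_mx_inv s a : ord (s + 1) (xx * a) -> ord s a.
Proof. by move=> h; rewrite -[a]xixK; apply: ord_mxi h; rewrite addrK. Qed.

Lemma ord_cancel_int s (k : int) a : k != 0 -> ord s (k%:~R * a) -> ord s a.
Proof.
case: k => [[|k]|k]//= _ h; first exact: (ord_cancel h).
apply: (@ord_cancel _ s k).
by move: h; rewrite NegzE mulrNz mulNr => /ordN; rewrite opprK.
Qed.

Lemma der_xi e : D e xi = - (xi ^+ 2 * (e == 0)%:R).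
Proof.
have h : D e xx * xi + xx * D e xi = 0 by rewrite -derM xxi der1.
rewrite der_xx in h.
rewrite -[LHS]xixK; move/eqP: h; rewrite addrC addr_eq0 => /eqP ->.
by rewrite expr2; ring.
Qed.

(** Only d/dx contributes to the order t - 1. *)
Lemma ord_der_lead t e a : ord t a ->
  ord t (D e a - (e == 0)%:R * (xi * (t%:~R * a))).
Proof.
move=> ta; have [i ->|i ->] := fintype.split_ordP e.
  rewrite (ord1 i) (_ : lshift 3 0 = 0) ?eqxx; last exact/val_inj.
  rewrite mul1r -[X in X - _]xixK -mulrBr.
  by apply: ord_mxi (ord_der0 ta); rewrite addrK.
rewrite (_ : rshift 1 i == 0 = false) //.
by rewrite mul0r subr0; exact: ord_derT.
Qed.

Lemma ord_der t s e a : s <= t - 1 -> ord t a -> ord s (D e a).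
Proof.
move=> st ta; apply: (@ordDr _ _ ((e == 0)%:R * (xi * (t%:~R * a)))).
  apply: ord_le (ord_der_lead e ta); lia.
by apply: ordZ; [exact: ord_nat|apply: (ord_mxi st); apply: ordZ => //; exact: ord_int].
Qed.

Lemma ord0_der e a : ord 0 a -> ord 0 (D e a).
Proof.
move=> a0; have := ord_der_lead e a0.
by rewrite mulr0z mul0r !mulr0 subr0.
Qed.

End Orders.

(** * Leading terms of the Levi-Civita connection *)

(** The compactified metric dx^2 + h_x, through the properties that matter: x is
    a special defining function and the metric and its inverse are bounded. *)
Record ahMetric (A : collarRing) := AhMetric {
  gam :> metric A;
  gam0 : forall a, gam a 0 = (a == 0)%:R;
  ord_gam : forall a b, ord 0 (gam a b);
  ord_igam : forall a b, ord 0 (imet gam a b) }.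

Section AsymptoticallyHyperbolic.
Variables (A : collarRing) (gm : ahMetric A).
Implicit Types (a b c d e f : 'I_(1 + 3)) (s t : int) (u v : A).
Local Notation D := (@der _ A).

Lemma hyp_metC a b : xi ^+ 2 * gm a b = xi ^+ 2 * gm b a.
Proof. by rewrite metC. Qed.

Lemma hyp_imetC a b : xx ^+ 2 * imet gm a b = xx ^+ 2 * imet gm b a.
Proof. by rewrite imetC. Qed.

Lemma hyp_imetV a c : \sum_b xx ^+ 2 * imet gm a b * (xi ^+ 2 * gm b c) = (a == c)%:R.
Proof.
rewrite -(imetV gm); apply: eq_bigr => b _.
transitivity ((xx * xi) ^+ 2 * (imet gm a b * gm b c)); first by ring.
by rewrite xxi expr1n mul1r.
Qed.

(** The conformally compact metric x^-2 gm. *)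
Definition hyp : metric A := Metric hyp_metC hyp_imetC hyp_imetV.
Local Notation g := hyp.

Lemma con_hyp F : con g F = xx ^+ 2 * con gm F.
Proof.
rewrite /con mulr_sumr; apply: eq_bigr => a _; rewrite mulr_sumr.
by apply: eq_bigr => b _; rewrite mulrA.
Qed.

Lemma ord_con_gm s F : (forall a b, ord s (F a b)) -> ord s (con gm F).
Proof.
move=> sF; do 2!apply: ord_sum => ?; apply: ordZ => //; exact: ord_igam.
Qed.

Lemma ord_con s F : (forall a b, ord s (F a b)) -> ord (s + 2) (con g F).
Proof.
move=> /ord_con_gm sF; rewrite con_hyp expr2 -mulrA.
by apply: (@ord_mx _ _ (s + 1)); [lia|apply: (@ord_mx _ _ s)].
Qed.

(** Conformal change of the Christoffel symbols for the factor x^-2; the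
    derivative of this factor only sees the index 0, that is gm b 0. *)
Lemma Gam_hyp f a b : Gam g f a b = Gam gm f a b
  - xi * ((f == a)%:R * gm b 0 + (f == b)%:R * gm a 0 - gm a b * gm f 0).
Proof.
have dx e : D e (xi ^+ 2) = - (2 * xi ^+ 3 * gm e 0).
  by rewrite expr2 derM der_xi gam0; ring.
have x2 : xx ^+ 2 * xi ^+ 2 = 1 :> A by rewrite -exprMn xxi expr1n.
rewrite /Gam.
transitivity (half * (\sum_d imet gm f d * (D a (gm b d) + D b (gm a d) - D d (gm a b))
   - 2 * xi * \sum_d imet gm f d * (gm a 0 * gm b d + gm b 0 * gm a d - gm d 0 * gm a b))).
  congr (_ * _); rewrite mulr_sumr -sumrB; apply: eq_bigr => d _ /=.
  rewrite !(derM _ (xi ^+ 2) _) !dx.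
  transitivity (xx ^+ 2 * xi ^+ 2 * (imet gm f d * (D a (gm b d) + D b (gm a d) - D d (gm a b)))
    - xx ^+ 2 * xi ^+ 2 * (2 * xi * (imet gm f d *
     (gm a 0 * gm b d + gm b 0 * gm a d - gm d 0 * gm a b)))); first by ring.
  by rewrite x2 !mul1r.
rewrite mulrBr; congr (_ - _).
have -> : \sum_d imet gm f d * (gm a 0 * gm b d + gm b 0 * gm a d - gm d 0 * gm a b) =
    gm a 0 * (f == b)%:R + gm b 0 * (f == a)%:R - gm f 0 * gm a b.
  rewrite (eq_bigr (fun d => (gm a 0 * (imet gm f d * gm d b)
     + gm b 0 * (imet gm f d * gm d a)) - (imet gm f d * gm d 0) * gm a b)); last first.
    by move=> d _; rewrite (metC gm b d) (metC gm a d); ring.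
  by rewrite sumrB big_split/= -!mulr_sumr -mulr_suml !imetV (gam0 gm f).
transitivity (half * 2 * (xi * (gm a 0 * (f == b)%:R + gm b 0 * (f == a)%:R - gm f 0 * gm a b))).
  by ring.
by rewrite half2; ring.
Qed.

Lemma ord_Gam_gm f a b : ord 0 (Gam gm f a b).
Proof.
apply: ordZ; first exact: ord_half.
apply: ord_sum => d; apply: ordZ; first exact: ord_igam.
by apply: ordB; first apply: ordD; apply: ord0_der; exact: ord_gam.
Qed.

(** Minus x times the leading part of the connection on one slot, by the
    conformal change Gam_hyp. Kronecker symbols at the index 0 are written with
    gm, so that contraction with gm removes them by con_metl and con_metr. *)
Definition lead e b (F : 'I_(1 + 3) -> A) : A :=
  gm b 0 * F e + gm e 0 * F b - gm e b * F 0.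

Lemma actE e b F : act g e b F = act gm e b F - xi * lead e b F.
Proof.
rewrite /act (eq_bigr (fun f => Gam gm f e b * F f -
  (xi * gm b 0 * ((e == f)%:R * F f) + xi * gm e 0 * ((b == f)%:R * F f)
    - xi * gm e b * ((0 == f)%:R * F f)))).
  rewrite sumrB sumrB big_split/= -!mulr_sumr !sum_deltal /lead; ring.
move=> f _; rewrite Gam_hyp (gam0 gm f) (eq_sym f e) (eq_sym f b) (eq_sym f 0); ring.
Qed.

Lemma act_lead t e b F : (forall f, ord t (F f)) -> ord t (act g e b F + xi * lead e b F).
Proof.
move=> tF; rewrite actE subrK; apply: ord_sum => f.
by apply: ordZ => //; exact: ord_Gam_gm.
Qed.

Lemma der_lead t e u : ord t u -> ord t (D e u - xi * (t%:~R * gm e 0 * u)).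
Proof.
move=> tu; rewrite [X in _ - X](_ : _ = (e == 0)%:R * (xi * (t%:~R * u))).
  exact: ord_der_lead.
by rewrite gam0; ring.
Qed.

(** In this lemma and in the next two, T is O(x^t) in coordinates, the covariant
    derivative is O(x^(t-1)), and its part of order t - 1 is algebraic in T:
    differentiation enters only through the factor t. *)
Lemma nab1_lead t T e a : (forall a, ord t (T a)) ->
  ord t (nab1 g T e a - xi * (t%:~R * gm e 0 * T a + lead e a T)).
Proof.
move=> tT.
rewrite [X in ord _ X](_ : _ = (D e (T a) - xi * (t%:~R * gm e 0 * T a))
  - (act g e a T + xi * lead e a T)); last by rewrite /nab1; ring.
by apply: ordB; [exact: der_lead|exact: act_lead].
Qed.

Lemma nab2_lead t T e a b : (forall a b, ord t (T a b)) ->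
  ord t (nab2 g T e a b - xi * (t%:~R * gm e 0 * T a b
    + lead e a (fun f => T f b) + lead e b (fun f => T a f))).
Proof.
move=> tT.
rewrite [X in ord _ X](_ : _ = (D e (T a b) - xi * (t%:~R * gm e 0 * T a b))
  - (act g e a (fun f => T f b) + xi * lead e a (fun f => T f b))
  - (act g e b (fun f => T a f) + xi * lead e b (fun f => T a f))); last first.
  by rewrite /nab2; ring.
by do 2?[apply: ordB]; [exact: der_lead|exact: act_lead|exact: act_lead].
Qed.

Lemma nab3_lead t T e a b c : (forall a b c, ord t (T a b c)) ->
  ord t (nab3 g T e a b c - xi * (t%:~R * gm e 0 * T a b c
    + lead e a (fun f => T f b c) + lead e b (fun f => T a f c)
    + lead e c (fun f => T a b f))).
Proof.
move=> tT.
rewrite [X in ord _ X](_ : _ = (D e (T a b c) - xi * (t%:~R * gm e 0 * T a b c))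
  - (act g e a (fun f => T f b c) + xi * lead e a (fun f => T f b c))
  - (act g e b (fun f => T a f c) + xi * lead e b (fun f => T a f c))
  - (act g e c (fun f => T a b f) + xi * lead e c (fun f => T a b f))); last first.
  by rewrite /nab3; ring.
by do 3?[apply: ordB]; [exact: der_lead|exact: act_lead|exact: act_lead|exact: act_lead].
Qed.

End AsymptoticallyHyperbolic.

(** * Indicial roots and the bootstrap *)

Section IndicialRoots.
Variables (A : collarRing) (gm : ahMetric A).
Implicit Types (a b c d e f : 'I_(1 + 3)) (s t : int) (u v : A).
Local Notation D := (@der _ A).
Local Notation g := (hyp gm).
Local Notation E := (ein g).
Local Notation W4 := (W4 g).

Lemma con_gml0 X : con gm (fun a b => gm a 0 * X b) = X 0.
Proof. exact: con_metl. Qed.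

Lemma con_gmr0 X : con gm (fun a b => gm b 0 * X a) = X 0.
Proof. by rewrite con_sym con_gml0. Qed.

Lemma con_gm4 u : con gm (fun a b => gm a b * u) = 4 * u.
Proof. by rewrite conZr con_met2. Qed.

Lemma gm00 : gm 0 0 = 1. Proof. by rewrite gam0. Qed.

(** The indicial polynomial s (s - 3) of the Laplacian: contract the leading
    term of the second covariant derivative. *)
Lemma lap_lead s u : ord s u -> ord (s + 1) (lap g u - (s * (s - 3))%:~R * u).
Proof.
move=> su; pose T b := D b u.
have tT b : ord (s - 1) (T b) by apply: ord_der su.
pose L a b := xi * ((s - 1)%:~R * gm a 0 * T b + lead gm a b T).
have -> : lap g u - (s * (s - 3))%:~R * u =
    con g (fun a b => nab1 g T a b - L a b) + (s - 3)%:~R * (xx * T 0 - s%:~R * u).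
  have -> : con g (fun a b => nab1 g T a b - L a b) = lap g u - (s - 3)%:~R * (xx * T 0).
    rewrite conB; congr (_ - _); rewrite con_hyp /L conZ.
    have -> : con gm (fun a b => (s - 1)%:~R * gm a 0 * T b + lead gm a b T) =
        (s - 3)%:~R * T 0.
      transitivity (con gm (fun a b => (s%:~R * (gm a 0 * T b) + gm b 0 * T a) - gm a b * T 0)).
        by apply: eq_con => a b; rewrite /lead rmorphB/=; ring.
      rewrite conB conD conZ con_gml0 con_gmr0 con_gm4 rmorphB/=; ring.
    by rewrite expr2 -!mulrA xxiK; ring.
  by rewrite rmorphM/=; ring.
apply: ordD; last by apply: ordZ; [exact: ord_int|exact: ord_der0].
have -> : s + 1 = s - 1 + 2 by lia.
by apply: ord_con => a b; exact: nab1_lead.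
Qed.

(** By Gam_hyp, the Christoffel symbols of hyp gm are those of gm minus x^-1 G. *)
Let G f a b : A := (f == a)%:R * gm b 0 + (f == b)%:R * gm a 0 - gm a b * gm f 0.

Let ordG f a b : ord 0 (G f a b).
Proof.
have o := ord_gam gm; have n k : ord 0 (k%:R : A) by exact: ord_nat.
by apply: ordB; [apply: ordD|]; apply: ordZ.
Qed.

Let sumG (F : 'I_(1 + 3) -> A) d b : \sum_e F e * G e d b = lead gm d b F.
Proof.
rewrite (eq_bigr (fun e => gm b 0 * ((d == e)%:R * F e) + gm d 0 * ((b == e)%:R * F e)
    - gm d b * ((0 == e)%:R * F e))).
  by rewrite sumrB big_split/= -!mulr_sumr !sum_deltal.
by move=> e _; rewrite /G (gam0 gm e) (eq_sym e d) (eq_sym e b) (eq_sym e 0); ring.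
Qed.

(** The metric is asymptotically hyperbolic: its curvature is that of constant
    curvature -1, up to one order in x. *)
Lemma ord_Rup a b c d : ord (- 1)
  (Rup g a b c d + xi ^+ 2 * ((a == c)%:R * gm b d - (a == d)%:R * gm b c)).
Proof.
have rO f i j : ord (- 1) (Gam gm f i j) by apply: ord_le (ord_Gam_gm gm f i j).
have dO i f j k : ord (- 1) (D i (Gam g f j k) - xi ^+ 2 * gm i 0 * G f j k).
  rewrite Gam_hyp raddfB/= (derM _ xi) der_xi -(gam0 gm i) -/(G f j k).
  rewrite [X in ord _ X](_ : _ = D i (Gam gm f j k) - xi * D i (G f j k)); last by ring.
  apply: ordB.
    by apply: (@ord_le _ _ 0) => //; apply: ord0_der; exact: ord_Gam_gm.
  by apply: (@ord_mxi _ _ 0) => //; apply: ord0_der.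
have gO i j k l : ord (- 1)
    (\sum_e Gam g i j e * Gam g e k l - xi ^+ 2 * lead gm k l (G i j)).
  rewrite -sumG mulr_sumr -sumrB; apply: ord_sum => e; rewrite !Gam_hyp -!/(G _ _ _).
  rewrite [X in ord _ X](_ : _ = Gam gm i j e * (Gam gm e k l - xi * G e k l)
     - xi * (G i j e * Gam gm e k l)); last by ring.
  apply: ordB.
    apply: ordZ; first exact: ord_Gam_gm.
    by apply: ordB => //; exact: (@ord_mxi _ _ 0).
  by apply: (@ord_mxi _ _ 0) => //; apply: ordZ => //; exact: ord_Gam_gm.
have G0 i j : G i j 0 = (i == j)%:R by rewrite /G gm00 -(gam0 gm i); ring.
have GC i j k : G i j k = G i k j by rewrite /G (metC gm j k); ring.
rewrite [X in ord _ X](_ : _ =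
   (D c (Gam g a d b) - xi ^+ 2 * gm c 0 * G a d b)
   - (D d (Gam g a c b) - xi ^+ 2 * gm d 0 * G a c b)
   + (\sum_e Gam g a c e * Gam g e d b - xi ^+ 2 * lead gm d b (G a c))
   - (\sum_e Gam g a d e * Gam g e c b - xi ^+ 2 * lead gm c b (G a d))).
  by apply: ordB; [apply: ordD; first apply: ordB|].
by rewrite /Rup sumrB /lead !G0 (GC a d c) (metC gm b d) (metC gm b c); ring.
Qed.

Lemma ord_Rm a b c d : ord (- 3)
  (Rm g a b c d + xi ^+ 4 * (gm a c * gm b d - gm a d * gm b c)).
Proof.
have -> : Rm g a b c d + xi ^+ 4 * (gm a c * gm b d - gm a d * gm b c) =
  \sum_e g a e * (Rup g e b c d + xi ^+ 2 * ((e == c)%:R * gm b d - (e == d)%:R * gm b c)).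
  under [RHS]eq_bigr do rewrite mulrDr; rewrite big_split/=; congr (_ + _).
  rewrite (eq_bigr (fun e => xi ^+ 4 * gm b d * (gm a e * (e == c)%:R)
    - xi ^+ 4 * gm b c * (gm a e * (e == d)%:R))) => [|e _]; last by ring.
  by rewrite sumrB -!mulr_sumr !sum_deltar; ring.
apply: ord_sum => e; rewrite /= expr2 -!mulrA.
apply: (@ord_mxi _ _ (-2)) => //; apply: (@ord_mxi _ _ (-1)) => //.
by apply: ordZ; [exact: ord_gam|rewrite mulrA -expr2; exact: ord_Rup].
Qed.

(** The inductive step. All tensors are given by coordinate components, so that
    a 2-tensor of order s has components O(x^(s-2)). *)
Section Bootstrap.
Variable s : int.
Hypothesis s3 : 3 <= s.
Hypothesis ordE : forall a b, ord (s - 2) (E a b).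

Let tre := con g E.

Lemma ord_tre : ord s tre.
Proof. by rewrite -[s](subrK 2); exact: ord_con. Qed.

(** The quadratic terms have order 2 s > s, so that the trace is annihilated at
    order s by the indicial polynomial s (s - 3) + 6, which has no integer root. *)
Lemma Q4_step : Q4 g = 6 -> ord (s + 1) tre.
Proof.
move=> Q6.
have tO := ord_tre.
have X0 : - lap g tre - 6 * tre + tre ^+ 2 - 3 * normsq g E = 0.
  have h := half2 A; have t := third3 A.
  move: Q6; rewrite Q4E -/tre; set X := _ - 3 * _ => Q6.
  transitivity (X + 36 * ((half : A) * 2 * (third * 3) - 1)); first by rewrite h t; ring.
  transitivity (6 * (half * third * (X + 36)) - X * ((half : A) * 2 * (third * 3) - 1) - 36).
    by ring.
  by rewrite Q6 h t; ring.
have nO : ord (s + 1) (normsq g E).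
  rewrite normsqE; apply: (@ord_le _ _ (s - 2 + (s - 2) + 2 + 2)); first lia.
  by apply: ord_con => a c; apply: ord_con => b d; exact: ordM.
have eO : ord (s + 1) (tre ^+ 2).
  by rewrite expr2; apply: (@ord_le _ _ (s + s)); [lia|exact: ordM].
apply: (@ord_cancel_int _ _ (s * (s - 3) + 6)); first nia.
rewrite [X in ord _ X](_ : _ = - (lap g tre - (s * (s - 3))%:~R * tre)
  + tre ^+ 2 - 3 * normsq g E); last first.
  by rewrite -[LHS]addr0 -[X in _ + X]X0 rmorphD/=; ring.
apply: ordB; last by apply: ordZ => //; exact: ord_nat.
by apply: ordD => //; apply: ordN; exact: lap_lead.
Qed.

Hypothesis ord_tre1 : ord (s + 1) tre.

Lemma ord_trgm : ord (s - 1) (con gm E).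
Proof.
have -> : con gm E = xi * (xi * tre).
  by rewrite /tre con_hyp expr2 -mulrA !xixK.
by apply: (@ord_mxi _ _ s); [lia|apply: ord_mxi ord_tre1; lia].
Qed.

(** With the trace already of higher order, the contracted Bianchi identity at
    leading order is (s - 4) E_0b = 0. *)
Lemma bianchi_step b : s != 4 -> ord (s - 1) (E 0 b).
Proof.
move=> s4.
have trO := ord_trgm.
pose L a c := xi * ((s - 2)%:~R * gm a 0 * E c b
  + lead gm a c (fun f => E f b) + lead gm a b (fun f => E c f)).
have LO : con g L = xx * ((s - 4)%:~R * E 0 b + gm b 0 * con gm E).
  rewrite con_hyp /L conZ.
  have -> : con gm (fun a c => (s - 2)%:~R * gm a 0 * E c b
      + lead gm a c (fun f => E f b) + lead gm a b (fun f => E c f)) =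
      (s - 4)%:~R * E 0 b + gm b 0 * con gm E.
    transitivity (con gm (fun a c => s%:~R * (gm a 0 * E c b) + gm c 0 * E a b
        - gm a c * E 0 b + gm b 0 * E a c - gm a b * E 0 c)).
      apply: eq_con => a c; rewrite /lead (einC g c a) (einC g c 0) rmorphB/=; ring.
    rewrite conB conD conB conD !conZ con_gml0 con_gmr0 con_gm4 con_metl (einC g 0 b).
    by rewrite (rmorphB _ s 4)/=; ring.
  by rewrite expr2 -mulrA xxiK.
have dO : ord s (con g (fun a c => nab2 g E a c b)).
  rewrite div_ein; apply: ordZ; first exact: ord_half.
  by apply: ord_der ord_tre1; lia.
have NO : ord s (con g (fun a c => nab2 g E a c b - L a c)).
  by rewrite -[s](subrK 2); apply: ord_con => a c; exact: nab2_lead.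
rewrite conB LO in NO.
have {NO dO} := ordDl NO dO.
rewrite mulrDr => h.
apply: (@ord_cancel_int _ _ (s - 4)); first lia.
apply: ord_mx_inv; rewrite subrK -[X in ord _ X](addrK (xx * (gm b 0 * con gm E))).
apply: ordB => //; apply: (@ord_mx _ _ (s - 1)); first lia.
by apply: ordZ => //; exact: ord_gam.
Qed.

Lemma ord_Sein a b : ord (s - 2) (Sein g a b).
Proof.
apply: ordZ; first exact: ord_half.
apply: ordB; first exact: ordE.
rewrite [X in ord _ X](_ : _ = xi * (xi * (half * third * gm a b * tre))); last first.
  by rewrite /tre /=; ring.
apply: (@ord_mxi _ _ (s - 1)); first lia.
apply: (@ord_mxi _ _ s); first lia.
apply: ordZ; last exact: ord_tre.
by apply: ordZ; [apply: ordZ; [exact: ord_half|exact: ord_third]|exact: ord_gam].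
Qed.

(** The leading curvature of constant curvature -1 is cancelled by the part - g
    / 2 of the Schouten tensor. *)
Lemma ord_W4 a b c d : ord (- 3) (W4 a b c d).
Proof.
have gS i j k l : ord (- 3) (g i j * Sein g k l).
  rewrite /= expr2 -!mulrA; apply: (@ord_mxi _ _ (-2)) => //.
  apply: (@ord_mxi _ _ (-1)) => //; apply: ordZ; first exact: ord_gam.
  by apply: ord_le (ord_Sein k l); lia.
rewrite /W4 /wey -![sch g _ _ _ _]/(P4 g _ _) !P4E.
rewrite [X in ord _ X](_ : _ = Rm g a b c d + xi ^+ 4 * (gm a c * gm b d - gm a d * gm b c)
  - (g a c * Sein g b d + g b d * Sein g a c - g a d * Sein g b c - g b c * Sein g a d)).
  apply: ordB; first exact: ord_Rm.
  by apply: ordB => //; apply: ordB => //; apply: ordD.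
rewrite /=; transitivity (Rm g a b c d
  + half * 2 * (xi ^+ 4 * (gm a c * gm b d - gm a d * gm b c))
  - (g a c * Sein g b d + g b d * Sein g a c - g a d * Sein g b c - g b c * Sein g a d)).
  by rewrite /=; ring.
by rewrite half2 mul1r.
Qed.

Hypothesis ord_E0 : forall b, ord (s - 1) (E 0 b).

Local Notation S := (Sein g).
Local Notation K := (cotton g).

Let ord_trg a b : ord (s - 1) (tre * (half * third) * g a b).
Proof.
rewrite [X in ord _ X](_ : _ = xi * (xi * (half * third * gm a b * tre))); last first.
  by rewrite /=; ring.
apply: (@ord_mxi _ _ s); first lia.
apply: (@ord_mxi _ _ (s + 1)); first lia.
apply: ordZ; last exact: ord_tre1.
by apply: ordZ; [apply: ordZ; [exact: ord_half|exact: ord_third]|exact: ord_gam].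
Qed.

Let SC a b : S a b = S b a.
Proof. by rewrite /Sein einC metC. Qed.

Let ord_S0 b : ord (s - 1) (S 0 b).
Proof. by apply: ordZ; [exact: ord_half|apply: ordB]. Qed.

(** The leading part of the Cotton tensor once S_0b is of higher order, see
    cotton_lead. *)
Let C a b c : A := xi * ((s - 1)%:~R * (gm b 0 * S a c - gm a 0 * S b c)).

Let cotton_lead a b c : ord (s - 2) (K a b c - C a b c).
Proof.
pose L e x y := xi * ((s - 2)%:~R * gm e 0 * S x y
  + lead gm e x (fun f => S f y) + lead gm e y (fun f => S x f)).
have LO e x y : ord (s - 2) (nab2 g S e x y - L e x y).
  by apply: nab2_lead; exact: ord_Sein.
rewrite [X in ord _ X](_ : _ = (nab2 g S b a c - L b a c) - (nab2 g S a b c - L a b c)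
  + xi * (gm a c * S 0 b - gm b c * S 0 a)).
  apply: ordD; first exact: ordB.
  apply: (@ord_mxi _ _ (s - 1)); first lia.
  by apply: ordB; apply: ordZ => //; exact: ord_gam.
rewrite cottonE /L /C /lead (metC gm b a) (SC b a) (SC a 0) (SC b 0) !rmorphB/=; ring.
Qed.

Let ord_C a b c : ord (s - 3) (C a b c).
Proof.
apply: (@ord_mxi _ _ (s - 2)); first lia.
apply: ordZ; first exact: ord_int.
by apply: ordB; apply: ordZ; [exact: ord_gam|exact: ord_Sein|exact: ord_gam|exact: ord_Sein].
Qed.

Let ord_K a b c : ord (s - 3) (K a b c).
Proof.
apply: (ordDr _ (ord_C a b c)).
by apply: ord_le (cotton_lead a b c); lia.
Qed.

(** One more leading-order divergence; for tangential a and c, the Cotton tensor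
    contributes (s - 1) and its divergence (s - 2). *)
Lemma div_cotton_lead a c : gm a 0 = 0 -> gm c 0 = 0 ->
  ord (s - 1) (con g (fun b e => nab3 g K e a b c) - ((s - 1) * (s - 2))%:~R * S a c).
Proof.
move=> a0 c0.
pose L e a b c := xi * ((s - 3)%:~R * gm e 0 * K a b c
  + lead gm e a (fun f => K f b c) + lead gm e b (fun f => K a f c)
  + lead gm e c (fun f => K a b f)).
have LO : con g (fun b e => L e a b c) =
    xx * ((s - 3)%:~R * K a 0 c - K 0 a c - K a c 0).
  rewrite con_hyp /L conZ expr2 -mulrA xxiK; congr (_ * _).
  transitivity (con gm (fun b e => s%:~R * (gm e 0 * K a b c) - gm a e * K 0 b c
     + gm b 0 * K a e c - gm b e * K a 0 c - gm c e * K a b 0)).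
    apply: eq_con => b e; rewrite /lead a0 c0 (metC gm e a) (metC gm e b) (metC gm e c).
    by rewrite rmorphB/=; ring.
  rewrite conB conB conD conB conZ con_gmr0 con_gml0 con_gm4 !con_metr rmorphB/=; ring.
have C1 : C a 0 c = xi * ((s - 1)%:~R * S a c) by rewrite /C gm00 a0; ring.
have C2 : C 0 a c = - (xi * ((s - 1)%:~R * S a c)) by rewrite /C gm00 a0; ring.
have C3 : C a c 0 = 0 by rewrite /C a0 c0; ring.
rewrite [X in ord _ X](_ : _ = con g (fun b e => nab3 g K e a b c - L e a b c)
  + xx * ((s - 3)%:~R * (K a 0 c - C a 0 c) - (K 0 a c - C 0 a c) - (K a c 0 - C a c 0))).
  apply: ordD.
    have -> : s - 1 = s - 3 + 2 by lia.
    by apply: ord_con => b e; exact: nab3_lead.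
  apply: (@ord_mx _ _ (s - 2)); first lia.
  by do 2!apply: ordB => //; apply: ordZ => //; exact: ord_int.
have -> : con g (fun b e => nab3 g K e a b c - L e a b c) =
    con g (fun b e => nab3 g K e a b c) - con g (fun b e => L e a b c) by exact: conB.
rewrite LO C1 C2 C3.
transitivity (con g (fun b e => nab3 g K e a b c)
  - xx * (xi * (((s - 1) * (s - 2))%:~R * S a c))); first by rewrite xxiK.
by rewrite rmorphM !rmorphB/=; ring.
Qed.

(** The Weyl term of the Bach tensor has order s + 1, so that the divergence of
    the Cotton tensor must vanish at order s. *)
Lemma bach_step : (forall a c, bach4 g a c = 0) -> forall a c, ord (s - 1) (E a c).
Proof.
move=> B0 a c.
have [i ->|i ai] := fintype.split_ordP a.
  by rewrite (ord1 i) (_ : lshift 3 0 = 0); [exact: ord_E0|exact/val_inj].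
have [j ->|j cj] := fintype.split_ordP c.
  rewrite (ord1 j) (_ : lshift 3 0 = 0); last exact/val_inj.
  by rewrite einC; exact: ord_E0.
have a0 : gm a 0 = 0 by rewrite gam0 ai.
have c0 : gm c 0 = 0 by rewrite gam0 cj.
have SO : ord (s - 1) (S a c).
  apply: (@ord_cancel_int _ _ ((s - 1) * (s - 2))); first nia.
  have := B0 a c; rewrite bach4E con_W4_Ric => B.
  rewrite [X in ord _ X](_ : _ = - (con g (fun b e => nab3 g K e a b c)
    - ((s - 1) * (s - 2))%:~R * S a c)
    - half * con g (fun b b' => con g (fun d d' => W4 a b c d * E b' d'))); last first.
    transitivity (((s - 1) * (s - 2))%:~R * S a c
      - (con g (fun b e => nab3 g K e a b c)
      + half * con g (fun b b' => con g (fun d d' => W4 a b c d * E b' d')))).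
      by rewrite B subr0.
    by ring.
  apply: ordB; first by apply: ordN; exact: div_cotton_lead.
  apply: ordZ; first exact: ord_half.
  have -> : s - 1 = - 3 + (s - 2) + 2 + 2 by lia.
  apply: ord_con => b b'; apply: ord_con => d d'.
  by apply: ordM => //; exact: ord_W4.
have -> : E a c = 2 * S a c + tre * (half * third) * g a c.
  transitivity (half * 2 * (E a c - tre * (half * third) * g a c)
    + tre * (half * third) * g a c); first by rewrite half2; ring.
  by rewrite /Sein -/tre; ring.
by apply: ordD => //; apply: ordZ => //; exact: ord_nat.
Qed.

End Bootstrap.

(** Induction on the order, starting at s = 3. The hypothesis on E_0b serves the
    step s = 4, which the Bianchi identity does not cover. *)
Lemma einstein_ord :
  (forall a c, bach4 g a c = 0) -> Q4 g = 6 ->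
  (forall a b, ord 1 (E a b)) -> (forall b, ord 3 (E 0 b)) ->
  forall s a b, ord s (E a b).
Proof.
move=> B0 Q6 E1 E03.
have En (n : nat) : forall a b, ord (n%:Z + 1) (E a b).
  elim: n => [|n IH]; first by move=> a b; rewrite add0r; exact: E1.
  have s3 : 3 <= n%:Z + 3 by lia.
  have ordE a b : ord (n%:Z + 3 - 2) (E a b).
    by rewrite (_ : _ - 2 = n%:Z + 1); [exact: IH|lia].
  have tO := Q4_step s3 ordE Q6.
  have E0 b : ord (n%:Z + 3 - 1) (E 0 b).
    (* n = 1 is the step s = 4. *)
    have [n1|n1] := eqVneq n 1%N; first by rewrite n1; exact: E03.
    by apply: (bianchi_step s3 ordE tO); lia.
  move=> a b; rewrite (_ : _ + 1 = n%:Z + 3 - 1); last by lia.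
  exact: (bach_step s3 ordE tO E0 B0).
move=> s a b; apply: ord_le (En `|s|%N a b); lia.
Qed.

End IndicialRoots.

(** * Ricci curvature in normal form *)

Section Tangential.
Variable A : collarRing.

Lemma tang_derC (i j : 'I_3) a :
  der A (rshift 1 i) (der A (rshift 1 j) a) = der A (rshift 1 j) (der A (rshift 1 i) a).
Proof. exact: derC. Qed.

(** The differential ring of the level sets of x: the same functions, without
    d/dx. *)
Definition tang : diffRing 3 := @DiffRing 3 A (fun i => der A (rshift 1 i))
  (fun i => @derM _ A (rshift 1 i)) tang_derC half third (half2 A) (third3 A).

End Tangential.

Section BlockMetric.
Variables (A : collarRing) (h : metric (tang A)).
Hypothesis ordh : forall i j, ord 0 (h i j : A).
Hypothesis ordih : forall i j, ord 0 (imet h i j : A).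
Implicit Types (i j k l : 'I_3) (a b c d : 'I_(1 + 3)).
Local Notation rs := (@rshift 1 3).
Local Notation D := (@der _ A).

(** The components of dx^2 + m. *)
Definition blk (m : 'I_3 -> 'I_3 -> A) a b : A :=
  match fintype.split a, fintype.split b with
  | inl _, inl _ => 1
  | inr i, inr j => m i j
  | _, _ => 0
  end.

Lemma split_ord0 : fintype.split (0 : 'I_(1 + 3)) = inl 0.
Proof. by rewrite -[RHS](@unsplitK 1 3); congr (fintype.split _); exact/val_inj. Qed.

Lemma split_rshift i : fintype.split (rs i) = inr i.
Proof. exact: (unsplitK (inr i)). Qed.

Lemma blk00 m : blk m 0 0 = 1. Proof. by rewrite /blk split_ord0. Qed.
Lemma blk0r m i : blk m 0 (rs i) = 0. Proof. by rewrite /blk split_ord0 split_rshift. Qed.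
Lemma blkr0 m i : blk m (rs i) 0 = 0. Proof. by rewrite /blk split_ord0 split_rshift. Qed.
Lemma blkrr m i j : blk m (rs i) (rs j) = m i j. Proof. by rewrite /blk !split_rshift. Qed.

Lemma ind4 (P : 'I_(1 + 3) -> Prop) : P 0 -> (forall i, P (rs i)) -> forall a, P a.
Proof.
move=> P0 Pr a; have [i ->|i ->] := fintype.split_ordP a => //.
by rewrite (ord1 i) (_ : lshift 3 0 = 0) //; exact/val_inj.
Qed.

Lemma sum4 (F : 'I_(1 + 3) -> A) : \sum_a F a = F 0 + \sum_i F (rs i).
Proof.
rewrite big_split_ord big_ord1; congr (F _ + _).
by rewrite /=; exact/val_inj.
Qed.

Lemma blkC m a b : (forall i j, m i j = m j i) -> blk m a b = blk m b a.
Proof.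
by move=> mC; rewrite /blk; case: fintype.split => i; case: fintype.split.
Qed.

Lemma rs0 i : (rs i == 0) = false. Proof. by []. Qed.
Lemma r0s i : (0 == rs i) = false. Proof. by []. Qed.
Lemma rsE i j : (rs i == rs j) = (i == j).
Proof. by rewrite (inj_eq (@rshift_inj 1 3)). Qed.

Lemma blkV a c : \sum_b blk (imet h) a b * blk h b c = (a == c)%:R.
Proof.
rewrite sum4; elim/ind4: a => [|i]; elim/ind4: c => [|j].
- by rewrite !blk00 big1 ?eqxx ?mulr1 ?addr0// => k _; rewrite blk0r mul0r.
- by rewrite blk0r mulr0 add0r big1// => k _; rewrite blk0r mul0r.
- by rewrite blkr0 mul0r add0r big1// => k _; rewrite blkr0 mulr0.
- rewrite blkr0 mul0r add0r rsE -(imetV h); apply: eq_bigr => k _.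
  by rewrite !blkrr.
Qed.

Definition blkmetric : metric A := @Metric _ A (blk h) (blk (imet h))
  (fun a b => blkC a b (metC h)) (fun a b => blkC a b (imetC h)) blkV.

Lemma blk_gam0 a : blkmetric a 0 = (a == 0)%:R.
Proof. by elim/ind4: a => [|i] /=; rewrite ?blk00 ?blkr0. Qed.

Lemma ord_blk m a b : (forall i j, ord 0 (m i j : A)) -> ord 0 (blk m a b).
Proof.
move=> om; rewrite /blk; case: fintype.split => i; case: fintype.split => j //.
- exact: ord_1.
- exact: ord_0.
- exact: ord_0.
Qed.

Definition collar_metric : ahMetric A := @AhMetric A blkmetric blk_gam0
  (fun a b => ord_blk a b ordh) (fun a b => ord_blk a b ordih).

Local Notation gm := collar_metric.
Local Notation g := (hyp gm).

(** In this section h' is the x-derivative of h_x, K the second fundamental form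
    with one index raised, and tau its trace. *)
Definition h' i j : A := D 0 (h i j).
Definition K i j : A := half * \sum_k (imet h i k : A) * h' k j.
Definition tau : A := \sum_i K i i.
Definition gam3 k i j : A := Gam h k i j.

Lemma h'C i j : h' i j = h' j i. Proof. by rewrite /h' metC. Qed.

Lemma Gam_0 a b : Gam gm 0 a b = half * (D a (gm b 0) + D b (gm a 0) - D 0 (gm a b)).
Proof.
rewrite /Gam sum4 /= blk00 mul1r big1 ?addr0// => i _.
by rewrite blk0r mul0r.
Qed.

Lemma Gam_r i a b : Gam gm (rs i) a b =
  half * \sum_k imet h i k * (D a (gm b (rs k)) + D b (gm a (rs k)) - D (rs k) (gm a b)).
Proof.
rewrite /Gam sum4 /= blkr0 mul0r add0r; congr (_ * _).
by apply: eq_bigr => k _; rewrite blkrr.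
Qed.

Lemma Gam000 : Gam g 0 0 0 = - xi.
Proof. by rewrite Gam_hyp Gam_0 /= !blk00 !der1 ?eqxx; ring. Qed.

Lemma Gam00r j : Gam g 0 0 (rs j) = 0.
Proof. by rewrite Gam_hyp Gam_0 /= !blkr0 !blk0r blk00 der1 !raddf0 ?r0s; ring. Qed.

Lemma Gamr00 i : Gam g (rs i) 0 0 = 0.
Proof.
rewrite Gam_hyp Gam_r /= blk00 blkr0 big1 => [|k _].
  by rewrite ?rs0; ring.
by rewrite blk0r der1 !raddf0; ring.
Qed.

Lemma Gamr0r i j : Gam g (rs i) 0 (rs j) = K i j - xi * (i == j)%:R.
Proof.
rewrite Gam_hyp Gam_r /= blk00 blkr0 ?rs0 rsE blk0r.
rewrite /K (eq_bigr (fun k => (imet h i k : A) * h' k j)).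
  by ring.
by move=> k _; rewrite blkrr !blk0r !raddf0 ?subr0 !addr0 h'C.
Qed.

Lemma Gam0rr i j : Gam g 0 (rs i) (rs j) = xi * h i j - half * h' i j.
Proof.
by rewrite Gam_hyp Gam_0 /= !blkrr !blkr0 blk00 !raddf0 ?r0s /h'; ring.
Qed.

Lemma Gamrrr i j k : Gam g (rs i) (rs j) (rs k) = gam3 i j k.
Proof.
rewrite Gam_hyp Gam_r /= !blkr0 !mulr0 add0r subr0 mulr0 subr0.
by rewrite /gam3 /Gam; congr (_ * _); apply: eq_bigr => l _; rewrite !blkrr.
Qed.

Lemma Gam0r0 j : Gam g 0 (rs j) 0 = 0. Proof. by rewrite GamC Gam00r. Qed.

Lemma Gamrr0 i j : Gam g (rs i) (rs j) 0 = K i j - xi * (i == j)%:R.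
Proof. by rewrite GamC Gamr0r. Qed.

Definition KK : A := \sum_i \sum_k K i k * K k i.

Lemma sum_const3 (u : A) : \sum_(i < 3) u = 3 * u.
Proof. by rewrite sumr_const card_ord mulr_natl. Qed.

(** The Riccati equation for the second fundamental form of the level sets of x. *)
Lemma ein00 : ein g 0 0 = - D 0 tau + xi * tau - KK.
Proof.
rewrite /ein /Ric /Rup sum4 sum4 /= blk00 big1 => [|k _]; last by rewrite subrr.
rewrite (eq_bigr (fun i => xi * K i i - D 0 (K i i) - \sum_k K i k * K k i
   - xi ^+ 2)); last first.
  move=> i _; rewrite sum4 Gamr00 Gam0r0 Gamrr0 Gam000 eqxx raddf0.
  rewrite (eq_bigr (fun k => - (K i k * K k i) + xi * (K i k * (k == i)%:R)
     + xi * ((i == k)%:R * K k i) - xi ^+ 2 * ((i == k)%:R * (k == i)%:R))); last first.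
    by move=> k _; rewrite Gamr00 Gamr0r Gamrr0; ring.
  rewrite sumrB !big_split/= -!mulr_sumr sum_deltar !sum_deltal sumrN eqxx.
  by rewrite mulr1 raddfB/= der_xi eqxx /= ?mulr1n; ring.
rewrite !sumrB -mulr_sumr sum_const3.
by rewrite /tau /KK (raddf_sum (D 0))/=; ring.
Qed.

Local Notation nab2h := (nab2 h).

Lemma half_h' j i : \sum_k (h j k : A) * K k i = half * h' j i.
Proof.
rewrite /K (eq_bigr (fun k => \sum_l half * ((h j k * imet h k l) * h' l i))); last first.
  by move=> k _; rewrite !mulr_sumr; apply: eq_bigr => l _; ring.
rewrite exchange_big/= -(sum_deltal j (fun l => half * h' l i)); apply: eq_bigr => l _.
transitivity ((\sum_k (imet h l k : A) * h k j) * (half * h' l i)).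
  by rewrite mulr_suml; apply: eq_bigr => k _; rewrite (metC h j k) (imetC h k l); ring.
by rewrite (imetV h l j) eq_sym.
Qed.

Lemma tau_con : tau = con h (fun i j => half * h' i j) :> A.
Proof.
rewrite conZ /con mulr_sumr; apply: eq_bigr => i _; rewrite /K.
by congr (_ * _); apply: eq_bigr => j _; rewrite h'C.
Qed.

(** The Codazzi equation: the divergence of h' / 2 minus the differential of its
    trace. *)
Lemma ein0r i :
  ein g 0 (rs i) = con h (fun j k => nab2h (fun j k => half * h' j k) j k i) - D (rs i) tau.
Proof.
have KT k j : K k j = \sum_l (imet h k l : A) * (half * h' l j).
  by rewrite /K mulr_sumr; apply: eq_bigr => l _; ring.
rewrite -div_mixed.
rewrite /ein /Ric /Rup sum4 sum4 /= blk0r big1 => [|k _]; last first.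
  by rewrite Gam00r Gamr00 mul0r mulr0 subrr.
rewrite Gam0r0 Gam000 raddf0 raddfN der_xi rs0 mulr0n.
rewrite (eq_bigr (fun j => D (rs j) (K j i) - D (rs i) (K j j)
   + \sum_k gam3 j j k * K k i - \sum_k gam3 j i k * K k j)); last first.
  move=> j _; rewrite sum4 Gam0r0 !Gamrr0 Gam0r0.
  rewrite (eq_bigr (fun k => gam3 j j k * K k i - xi * (gam3 j j k * (k == i)%:R)
     - (gam3 j i k * K k j - xi * (gam3 j i k * (k == j)%:R)))); last first.
    by move=> k _; rewrite !Gamrrr !Gamrr0; ring.
  rewrite !sumrB -!mulr_sumr !sum_deltar.
  rewrite {2}/gam3 (GamC j j i) -/(gam3 j i j).
  rewrite !raddfB/= !(derM _ xi) !der_xi !rs0 !der_nat mulr0n.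
  by ring.
rewrite !(sumrB, big_split)/= -(raddf_sum (D (rs i)))/= -/tau.
have -> : \sum_j \sum_k gam3 j i k * K k j = \sum_j \sum_k gam3 k j i * K j k.
  rewrite exchange_big; apply: eq_bigr => k _; apply: eq_bigr => j _.
  by rewrite /gam3 (GamC j i k).
under [\sum_j D (rs j) (K j i)]eq_bigr do rewrite KT.
under [\sum_j \sum_k gam3 j j k * K k i]eq_bigr do under eq_bigr do rewrite KT.
under [\sum_j \sum_k gam3 k j i * K j k]eq_bigr do under eq_bigr do rewrite KT.
by rewrite /gam3 /=; ring.
Qed.

(** The Gauss equation. The terms in x^-2 cancel against 3 g. *)
Lemma einrr i j : ein g (rs i) (rs j) =
  Ric h i j + xi * h' i j - half * D 0 (h' i j) + tau * (xi * h i j - half * h' i j)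
  + half * \sum_k (h' j k * K k i + h' i k * K k j).
Proof.
pose B i j : A := xi * h i j - half * h' i j.
have BC k l : B k l = B l k by rewrite /B h'C metC.
have BK k l : \sum_m B k m * K m l = xi * (half * h' k l) - half * \sum_m h' k m * K m l.
  rewrite -half_h' !mulr_sumr -sumrB; apply: eq_bigr => m _; rewrite /B.
  by ring.
rewrite /ein /Ric /Rup sum4 sum4 /= blkrr.
rewrite (eq_bigr (fun k => xi * (B j k * (k == i)%:R) - B j k * K k i)); last first.
  by move=> k _; rewrite Gam00r Gam0rr Gamr0r /B; ring.
rewrite Gam00r Gam0r0 Gam0rr Gam000.
rewrite [\sum_k (_ - _ + _)](eq_bigr (fun k =>
   D (rs k) (gam3 k j i) - D (rs j) (gam3 k k i)
   + \sum_l (gam3 k k l * gam3 l j i - gam3 k j l * gam3 l k i)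
   + (B j i * K k k - xi * B j i) - (B i k * K k j - xi * (B i k * (k == j)%:R)))); last first.
  move=> k _; rewrite sum4 !Gamrrr !Gamrr0 !Gam0rr eqxx -/(B j i) -/(B k i) (BC k i).
  under eq_bigr do rewrite !Gamrrr.
  by rewrite mulr1n; ring.
have tB : \sum_k B j i * K k k = tau * B j i by rewrite -mulr_sumr mulrC.
rewrite !(sumrB, big_split)/= tB -!mulr_sumr !sum_deltar sum_const3 !BK (BC i j).
rewrite raddf0 raddfB/= !derM der_xi der_half eqxx mulr1n /B (metC h j i) (h'C j i) /gam3.
rewrite -/(h' i j).
by ring.
Qed.

End BlockMetric.

(** * Congruences between metrics on the level sets *)

Section Congruences.
Variable A : collarRing.
Implicit Types (s : int) (u v w : A).

Definition cong s u v := ord s (u - v).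

Lemma cong_refl s u : cong s u u. Proof. by rewrite /cong subrr; exact: ord_0. Qed.

Lemma cong_trans s v u w : cong s u v -> cong s v w -> cong s u w.
Proof. by move=> uv vw; rewrite /cong -(subrKA v); exact: ordD. Qed.

Lemma congD s u v u1 v1 : cong s u u1 -> cong s v v1 -> cong s (u + v) (u1 + v1).
Proof. by move=> uu vv; rewrite /cong opprD addrACA; exact: ordD. Qed.

Lemma congB s u v u1 v1 : cong s u u1 -> cong s v v1 -> cong s (u - v) (u1 - v1).
Proof.
move=> uu vv; rewrite /cong.
by rewrite (_ : _ - _ = (u - u1) - (v - v1)); [exact: ordB|ring].
Qed.

(** Each factor only has to be known modulo an order lowered by the order of the
    other one. *)
Lemma congM s t t1 u v u1 v1 : ord (s - t1) v -> ord (s - t) u1 ->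
  cong t1 u u1 -> cong t v v1 -> cong s (u * v) (u1 * v1).
Proof.
move=> v0 u0 uu vv; rewrite /cong.
rewrite (_ : _ - _ = (u - u1) * v + u1 * (v - v1)); last by ring.
apply: ordD; first by rewrite -[s](subrKC t1); exact: ordM.
by rewrite -[s](subrK t); exact: ordM.
Qed.

Lemma congZ s u v v1 : ord 0 u -> cong s v v1 -> cong s (u * v) (u * v1).
Proof. by move=> u0 vv; rewrite /cong -mulrBr; exact: ordZ. Qed.

Lemma cong_sum s (I : finType) (F G : I -> A) :
  (forall i, cong s (F i) (G i)) -> cong s (\sum_i F i) (\sum_i G i).
Proof. by move=> FG; rewrite /cong -sumrB; apply: ord_sum. Qed.

Lemma cong_derT s i u v : cong s u v ->
  cong s (der A (rshift 1 i) u) (der A (rshift 1 i) v).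
Proof. by move=> uv; rewrite /cong -raddfB; exact: ord_derT. Qed.

Lemma cong_le s t u v : s <= t -> cong t u v -> cong s u v.
Proof. exact: ord_le. Qed.

Lemma cong_ord s u v : cong s u v -> ord s v -> ord s u.
Proof. exact: ordDr. Qed.

End Congruences.

Section MetricCongruence.
Variables (A : collarRing) (h h0 : metric (tang A)) (s : int).
Hypothesis ordh : forall i j, ord 0 (h i j : A).
Hypothesis ordih : forall i j, ord 0 (imet h i j : A).
Hypothesis ordih0 : forall i j, ord 0 (imet h0 i j : A).
Hypothesis hh0 : forall i j, cong s (h i j : A) (h0 i j).
Implicit Types (i j k l : 'I_3).

(** The resolvent identity for the inverse of a metric. *)
Lemma imet_diff i j : imet h i j - imet h0 i j =
  \sum_k \sum_l (imet h i k : A) * (h0 k l - h k l) * imet h0 l j.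
Proof.
have e1 : \sum_k \sum_l (imet h i k : A) * h0 k l * imet h0 l j = imet h i j.
  rewrite -[RHS](sum_deltar j (fun k => imet h i k : A)); apply: eq_bigr => k _.
  rewrite eq_sym -(imetV h0 j k) mulr_sumr; apply: eq_bigr => l _.
  by rewrite (imetC h0 j l) (metC h0 l k); ring.
have e2 : \sum_k \sum_l (imet h i k : A) * h k l * imet h0 l j = imet h0 i j.
  rewrite exchange_big -[RHS](sum_deltal i (fun l => imet h0 l j : A)).
  by apply: eq_bigr => l _; rewrite -(imetV h i l) mulr_suml.
rewrite -e1 -e2 -sumrB; apply: eq_bigr => k _; rewrite -sumrB.
by apply: eq_bigr => l _; ring.
Qed.

Lemma cong_imet i j : cong s (imet h i j : A) (imet h0 i j).
Proof.
rewrite /cong imet_diff; do 2!apply: ord_sum => ?.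
rewrite mulrAC; apply: ordZ; first exact: ordZ.
by rewrite -opprB; apply: ordN; exact: hh0.
Qed.

Lemma ord_derT0 i (u : A) : ord 0 u -> ord 0 (der (tang A) i u).
Proof. exact: ord_derT. Qed.

Lemma cong_Gam i j k : cong s (Gam h i j k : A) (Gam h0 i j k).
Proof.
apply: congZ; first exact: ord_half.
apply: cong_sum => l; apply: (@congM _ _ s s); rewrite ?subrr.
- by apply: ordB; first apply: ordD; exact: ord_derT0.
- exact: ordih0.
- exact: cong_imet.
by apply: congB; first apply: congD; exact: cong_derT.
Qed.

Lemma ord_Gam3 i j k : ord 0 (Gam h i j k : A).
Proof.
apply: ordZ; first exact: ord_half.
apply: ord_sum => l; apply: ordZ => //.
by apply: ordB; first apply: ordD; exact: ord_derT0.
Qed.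
End MetricCongruence.

Section MetricCongruence2.
Variables (A : collarRing) (h h0 : metric (tang A)) (s : int).
Hypothesis ordh : forall i j, ord 0 (h i j : A).
Hypothesis ordih : forall i j, ord 0 (imet h i j : A).
Hypothesis ordh0 : forall i j, ord 0 (h0 i j : A).
Hypothesis ordih0 : forall i j, ord 0 (imet h0 i j : A).
Hypothesis hh0 : forall i j, cong s (h i j : A) (h0 i j).
Implicit Types (i j k l : 'I_3).

Let cG i j k := cong_Gam ordh ordih ordih0 hh0 i j k.
Let oG i j k := ord_Gam3 ordh ordih i j k.
Let oG0 i j k := ord_Gam3 ordh0 ordih0 i j k.

Lemma cong_Ric i j : cong s (Ric h i j : A) (Ric h0 i j).
Proof.
have cGG k l m n o p : cong s (Gam h k l m * Gam h n o p : A) (Gam h0 k l m * Gam h0 n o p).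
  by apply: (@congM _ _ s s) => //; rewrite subrr.
apply: cong_sum => k; apply: congD; first by apply: congB; exact: cong_derT.
by apply: cong_sum => l; apply: congB.
Qed.

Lemma cong_act t i j (F F0 : 'I_3 -> A) : (forall k, ord (t - s) (F k)) ->
  (forall k, cong t (F k) (F0 k)) -> cong t (act h i j F : A) (act h0 i j F0).
Proof.
move=> oF cF; apply: cong_sum => k; apply: (@congM _ _ t s) => //.
by rewrite subrr.
Qed.

Lemma cong_nab2 t i j k (F F0 : 'I_3 -> 'I_3 -> A) :
  (forall k l, ord (t - s) (F k l)) -> (forall k l, cong t (F k l) (F0 k l)) ->
  cong t (nab2 h F i j k : A) (nab2 h0 F0 i j k).
Proof.
move=> oF cF; apply: congB; last exact: cong_act.
by apply: congB; [exact: cong_derT|exact: cong_act].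
Qed.

Lemma ord_nab2 t i j k (F : 'I_3 -> 'I_3 -> A) :
  (forall k l, ord t (F k l)) -> ord t (nab2 h F i j k : A).
Proof.
move=> oF; have oa l m (X : 'I_3 -> A) : (forall k, ord t (X k)) -> ord t (act h l m X : A).
  by move=> oX; apply: ord_sum => o; exact: ordZ.
by apply: ordB; [apply: ordB; [exact: ord_derT|exact: oa]|exact: oa].
Qed.

Lemma cong_con t (F F0 : 'I_3 -> 'I_3 -> A) : (forall k l, ord (t - s) (F k l)) ->
  (forall k l, cong t (F k l) (F0 k l)) -> cong t (con h F : A) (con h0 F0).
Proof.
move=> oF cF; do 2!(apply: cong_sum => ?).
by apply: (@congM _ _ t s) => //; rewrite ?subrr//; exact: cong_imet.
Qed.

End MetricCongruence2.

(** * The initial data *)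

(** Here p, q and r are the coefficients of - x^2, x^3 and x^4 in the expansion
    of h_x around h0. Their derivatives in direction 0 vanish because they do
    not depend on x, and the bootstrap needs the terms of h_x up to x^4. *)
Section InitialData.
Variables (A : collarRing) (h h0 : metric (tang A)).
Hypothesis ordh : forall i j, ord 0 (h i j : A).
Hypothesis ordih : forall i j, ord 0 (imet h i j : A).
Hypothesis ordh0 : forall i j, ord 0 (h0 i j : A).
Hypothesis ordih0 : forall i j, ord 0 (imet h0 i j : A).
Local Notation D := (@der _ A).
Hypothesis D0h0 : forall i j, D 0 (h0 i j) = 0.
Hypothesis D0ih0 : forall i j, D 0 (imet h0 i j) = 0.
Variables (p q r : 'I_3 -> 'I_3 -> A).
Hypothesis ordq : forall i j, ord 0 (q i j).
Hypothesis ordr : forall i j, ord 0 (r i j).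
Hypothesis D0q : forall i j, D 0 (q i j) = 0.
Hypothesis D0r : forall i j, D 0 (r i j) = 0.
Implicit Types (i j k l : 'I_3).

Hypothesis pE : forall i j, p i j = sch h0 1 (half * half) i j.
Hypothesis ordp : forall i j, ord 0 (p i j).
Hypothesis D0p : forall i j, D 0 (p i j) = 0.

Hypothesis hE : forall i j,
  cong 5 (h i j : A) (h0 i j - xx ^+ 2 * p i j + xx ^+ 3 * q i j + xx ^+ 4 * r i j).
Hypothesis trq : con h0 q = 0 :> A.
Hypothesis divq : forall i, con h0 (fun k l => nab2 h0 q k l i) = 0 :> A.
Hypothesis trr : 4 * con h0 r = normsq h0 p :> A.

Local Notation N := (normsq h0 p : A).
Local Notation J := (con h0 p : A).
Local Notation gm := (collar_metric ordh ordih).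
Local Notation g := (hyp gm).
Local Notation rs := (@rshift 1 3).
Local Notation tau := (tau h).
Local Notation K := (K h).
Local Notation h' := (h' h).

Lemma ordX n : ord n%:Z (xx ^+ n : A).
Proof.
elim: n => [|n IH]; first exact: ord_1.
by rewrite exprS intS; apply: ordM => //; exact: ord_x.
Qed.

Lemma ord_expx s n (u : A) : s <= n%:Z -> ord 0 u -> ord s (xx ^+ n * u).
Proof.
move=> sn u0; apply: (ord_le sn); rewrite -[n%:Z]addr0.
by apply: ordM => //; exact: ordX.
Qed.

Lemma der0_xx : D 0 xx = 1. Proof. by rewrite der_xx eqxx. Qed.

Lemma der0_xxM n u : D 0 u = 0 -> D 0 (xx ^+ n.+1 * u) = n.+1%:R * xx ^+ n * u.
Proof.
move=> u0; rewrite derM u0 mulr0 addr0; congr (_ * _).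
elim: n => [|n IH]; first by rewrite expr1 der0_xx expr0 mulr1.
by rewrite exprS derM IH der0_xx -[in RHS]natr1 [xx ^+ n.+1]exprS; ring.
Qed.

Lemma p_sym i j : p i j = p j i.
Proof. by rewrite !pE /sch RicC metC. Qed.

(** The dimension is 3, so that the trace of P is R / 4. *)
Lemma J_E : J = half * half * (Sc h0 : A).
Proof.
rewrite (@eq_con _ (tang A) h0 _ _ pE) /sch conZ conB conZ con_met2 -/(Sc h0) mul1r.
have h2 := half2 A.
transitivity (half * half * (Sc h0 : A) + (Sc h0 : A) * (1 - half * 2 * (half * 2))).
  by rewrite /=; ring.
by rewrite h2; ring.
Qed.

(** The contracted Bianchi identity of h0; it makes the term of order 1 of E_0i
    vanish. *)
Lemma div_p i : con h0 (fun k l => nab2 h0 p k l i) = D (rs i) J :> A.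
Proof.
have d0 k : der (tang A) k (1 : A) = 0 by exact: der1.
have dh k : der (tang A) k (half : A) = 0 by exact: (der_half (tang A)).
pose T : 'I_3 -> 'I_3 -> tang A := fun k l => Ric h0 k l - Sc h0 * (half * half) * h0 k l.
have E k l m : nab2 h0 p k l m =
    nab2 h0 (Ric h0) k l m - half * half * der (tang A) k (Sc h0) * h0 l m.
  rewrite (@eq_nab2 _ (tang A) h0 p T); last by move=> x y; rewrite pE /sch mul1r.
  by rewrite nab2_subZ !derM !(der_half (tang A)); ring.
rewrite (eq_con (fun k l => E k l i)) conB div_Ric.
have -> : con h0 (fun k l => half * half * der (tang A) k (Sc h0) * h0 l i) =
    half * half * der (tang A) i (Sc h0).
  rewrite -[RHS](con_metl h0 i (fun k => half * half * der (tang A) k (Sc h0))).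
  by rewrite -con_sym; apply: eq_con => k l; rewrite mulrC.
rewrite J_E !derM !der_half.
have h2 := half2 A.
rewrite /=; set X := der A (rs i) _.
transitivity (half * half * X + half * X * (1 - half * 2)); first by ring.
by rewrite h2; ring.
Qed.

Lemma cong_h' i j : cong 4 (h' i j)
  (xx ^+ 1 * (- (2 * p i j)) + xx ^+ 2 * (3 * q i j) + xx ^+ 3 * (4 * r i j)).
Proof.
rewrite /cong (_ : _ - _ = D 0 (h i j - (h0 i j - xx ^+ 2 * p i j + xx ^+ 3 * q i j
  + xx ^+ 4 * r i j))).
  by apply: ord_der (hE i j); lia.
rewrite raddfB !raddfD raddfN/= D0h0 (der0_xxM _ (D0p i j)) (der0_xxM _ (D0q i j)).
by rewrite (der0_xxM _ (D0r i j)) /h'; ring.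
Qed.

Lemma cong_h i j : cong 2 (h i j : A) (h0 i j).
Proof.
apply: cong_trans (cong_le _ (hE i j)) _ => //; rewrite /cong.
rewrite (_ : _ - _ = - (xx ^+ 2 * p i j) + xx ^+ 3 * q i j + xx ^+ 4 * r i j); last by ring.
apply: ordD; last exact: ord_expx.
by apply: ordD; [apply: ordN|]; exact: ord_expx.
Qed.

Lemma ord_natl n (u : A) : ord 0 u -> ord 0 (n%:R * u).
Proof. by apply: ordZ; exact: ord_nat. Qed.

Lemma cong_h'3 i j : cong 3 (h' i j) (xx ^+ 1 * (- (2 * p i j)) + xx ^+ 2 * (3 * q i j)).
Proof.
apply: cong_trans (cong_le _ (cong_h' i j)) _ => //; rewrite /cong addrAC subrr add0r.
by apply: ord_expx => //; exact: ord_natl.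
Qed.

Lemma cong_h'2 i j : cong 2 (h' i j) (xx ^+ 1 * (- (2 * p i j))).
Proof.
apply: cong_trans (cong_le _ (cong_h'3 i j)) _ => //; rewrite /cong addrAC subrr add0r.
by apply: ord_expx => //; exact: ord_natl.
Qed.

Lemma ord_h' i j : ord 1 (h' i j).
Proof.
apply: cong_ord (cong_le _ (cong_h'2 i j)) _ => //.
by apply: ord_expx => //; apply: ordN; exact: ord_natl.
Qed.

Let F i j : A := half * h' i j.

Lemma ordF i j : ord 1 (F i j).
Proof. by apply: ordZ; [exact: ord_half|exact: ord_h']. Qed.

Lemma half2l (u : A) : half * (2 * u) = u.
Proof. by rewrite mulrA half2 mul1r. Qed.

Lemma cong_F i j : cong 4 (F i j)
  (xx ^+ 1 * (- p i j) + xx ^+ 2 * (half * (3 * q i j)) + xx ^+ 3 * (2 * r i j)).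
Proof.
rewrite -{1}[p i j]half2l -[2 * r i j]half2l.
rewrite [X in cong _ _ X](_ : _ = half *
  (xx ^+ 1 * (- (2 * p i j)) + xx ^+ 2 * (3 * q i j) + xx ^+ 3 * (4 * r i j))).
  by apply: congZ; [exact: ord_half|exact: cong_h'].
by ring.
Qed.

Lemma cong_F3 i j : cong 3 (F i j) (xx ^+ 1 * (- p i j) + xx ^+ 2 * (half * (3 * q i j))).
Proof.
apply: cong_trans (cong_le _ (cong_F i j)) _ => //; rewrite /cong addrAC subrr add0r.
by apply: ord_expx => //; exact: ord_natl.
Qed.

Lemma cong_F2 i j : cong 2 (F i j) (xx ^+ 1 * (- p i j)).
Proof.
apply: cong_trans (cong_le _ (cong_F3 i j)) _ => //; rewrite /cong addrAC subrr add0r.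
by apply: ord_expx => //; apply: ordZ; [exact: ord_half|exact: ord_natl].
Qed.

Lemma ord_con0 s (X : 'I_3 -> 'I_3 -> A) : (forall i j, ord s (X i j)) ->
  ord s (con h0 X : A).
Proof. by move=> oX; do 2!apply: ord_sum => ?; exact: ordZ. Qed.

Lemma ordN0 : ord 0 N.
Proof. by rewrite normsqE; do 2!apply: ord_con0 => ??; exact: ordZ. Qed.

Lemma cong_con0 s (X Y : 'I_3 -> 'I_3 -> A) : (forall i j, cong s (X i j) (Y i j)) ->
  cong s (con h0 X : A) (con h0 Y).
Proof. by move=> XY; do 2!apply: cong_sum => ?; exact: congZ. Qed.

(** The coefficient of x^2 in the inverse of h0 - x^2 p. *)
Lemma cong_imet3 i j : cong 3 (imet h i j : A) (imet h0 i j + xx ^+ 2 * raise h0 p i j).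
Proof.
have ci k l := cong_imet ordih ordih0 cong_h k l.
rewrite /cong opprD addrA imet_diff /raise mulr_sumr -sumrB; apply: ord_sum => k.
rewrite mulr_sumr -sumrB; apply: ord_sum => l.
rewrite (imetC h0 j l) (_ : _ - _ = imet h i k * imet h0 l j * (h0 k l - h k l - xx ^+ 2 * p k l)
  + (imet h i k - imet h0 i k) * (xx ^+ 2 * (imet h0 l j * p k l))); last by rewrite /=; ring.
apply: ordD.
  apply: ordZ; first exact: ordZ.
  rewrite (_ : _ - _ = - (h k l - (h0 k l - xx ^+ 2 * p k l + xx ^+ 3 * q k l
    + xx ^+ 4 * r k l)) - (xx ^+ 3 * q k l + xx ^+ 4 * r k l)); last by rewrite /=; ring.
  apply: ordB; first by apply: ordN; apply: ord_le (hE k l).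
  by apply: ordD; exact: ord_expx.
apply: (@ord_le _ _ (2 + 2)) => //; apply: ordM; first exact: ci.
by apply: ord_expx => //; exact: ordZ.
Qed.

(** The trace condition 4 tr r = |P|^2 fixes the coefficient of x^3; the
    coefficient of x^2 is a multiple of tr q. *)
Lemma cong_tau : cong 4 tau (- (xx * J) - half * xx ^+ 3 * N).
Proof.
rewrite tau_con -/F.
have e1 : cong 4 (con h F : A) (con h0 F + xx ^+ 2 * \sum_i \sum_j raise h0 p i j * F i j).
  rewrite /con mulr_sumr -big_split; apply: cong_sum => i /=.
  rewrite mulr_sumr -big_split; apply: cong_sum => j /=.
  rewrite mulrA -mulrDl; rewrite /cong -mulrBl -[4]/(3 + 1 : int).
  by apply: ordM; [exact: cong_imet3|exact: ordF].
apply: cong_trans e1 _.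
have e2 : cong 4 (con h0 F : A) (- (xx * J) + 2 * xx ^+ 3 * con h0 r).
  apply: cong_trans (cong_con0 cong_F) _.
  rewrite !conD !conZ trq conN.
  rewrite [X in cong _ X](_ : _ = - (xx * J) + 2 * xx ^+ 3 * con h0 r).
    exact: cong_refl.
  by rewrite expr1; ring.
have e3 : cong 4 (xx ^+ 2 * \sum_i \sum_j raise h0 p i j * F i j) (- (xx ^+ 3 * N)).
  rewrite [X in cong _ _ X](_ : _ = xx ^+ 2 * \sum_i \sum_j raise h0 p i j *
     (xx ^+ 1 * (- p i j))); last first.
    rewrite /normsq -mulrN -sumrN !mulr_sumr; apply: eq_bigr => i _.
    rewrite -sumrN !mulr_sumr; apply: eq_bigr => j _; ring.
  rewrite /cong -mulrBr -[4]/(2%:Z + 2); apply: ordM; first exact: ordX.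
  do 2!apply: cong_sum => ?; apply: congZ; last exact: cong_F2.
  by do 2!apply: ord_sum => ?; apply: ordZ => //; exact: ordZ.
apply: cong_trans (congD e2 e3) _.
have -> : 2 * xx ^+ 3 * con h0 r = half * xx ^+ 3 * N.
  rewrite -trr; transitivity (half * 2 * (2 * xx ^+ 3 * con h0 r)); last by ring.
  by rewrite half2 mul1r.
rewrite [X in cong _ X](_ : _ = - (xx * J) - half * xx ^+ 3 * N + xx ^+ 3 * N * (half * 2 - 1)).
  by rewrite half2 subrr mulr0 addr0; exact: cong_refl.
by ring.
Qed.

Lemma D0con0 (X : 'I_3 -> 'I_3 -> A) : (forall i j, D 0 (X i j) = 0) ->
  D 0 (con h0 X : A) = 0.
Proof.
move=> X0; rewrite raddf_sum big1// => i _; rewrite raddf_sum big1// => j _.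
by rewrite derM D0ih0 X0 mul0r mulr0 addr0.
Qed.

Lemma D0J : D 0 J = 0. Proof. exact: D0con0. Qed.

Lemma D0N : D 0 N = 0.
Proof.
rewrite normsqE; do 2!apply: D0con0 => ??.
by rewrite derM !D0p mul0r mulr0 addr0.
Qed.

Lemma cong_K i j : cong 2 (K i j) (- (xx * \sum_k (imet h0 i k : A) * p k j)).
Proof.
rewrite /K mulr_sumr mulr_sumr -sumrN; apply: cong_sum => k.
rewrite [X in cong _ X](_ : _ = (imet h i k : A) * F k j); last by rewrite /F; ring.
rewrite [X in cong _ _ X](_ : _ = (imet h0 i k : A) * (xx ^+ 1 * (- p k j))); last by ring.
apply: (@congM _ _ 2 2); rewrite ?subrr//.
- by apply: ord_le (ordF k j).
- exact: (cong_imet ordih ordih0 cong_h).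
exact: cong_F2.
Qed.

Lemma ord_K i j : ord 1 (K i j).
Proof.
apply: cong_ord (cong_le _ (cong_K i j)) _ => //; apply: ordN.
by rewrite -[xx]expr1; apply: ord_expx => //; apply: ord_sum => k; exact: ordZ.
Qed.

Lemma cong_KK : cong 3 (KK h) (xx ^+ 2 * N).
Proof.
pose Q i j : A := \sum_k (imet h0 i k : A) * p k j.
have -> : xx ^+ 2 * N = \sum_i \sum_k - (xx * Q i k) * - (xx * Q k i).
  transitivity (xx ^+ 2 * \sum_i \sum_k Q i k * Q k i); last first.
    by rewrite mulr_sumr; apply: eq_bigr => i _; rewrite mulr_sumr; apply: eq_bigr => k _; ring.
  congr (_ * _); rewrite normsqE /con exchange_big; apply: eq_bigr => i _.
  under [RHS]eq_bigr do rewrite mulr_suml.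
  rewrite exchange_big; apply: eq_bigr => j _; rewrite mulr_sumr; apply: eq_bigr => k _.
  rewrite mulr_sumr mulr_sumr; apply: eq_bigr => l _.
  by rewrite (imetC h0 j i) (p_sym i l) /=; ring.
do 2!apply: cong_sum => ?; apply: (@congM _ _ 2 2); rewrite -?[3 - 2]/(1 : int).
- exact: ord_K.
- apply: ordN; rewrite -[xx]expr1; apply: ord_expx => //.
  by apply: ord_sum => k; exact: ordZ.
- exact: cong_K.
- exact: cong_K.
Qed.

(** The terms in J cancel and those in |P|^2 cancel between the derivative of
    tau and the square of K: this is where the trace of the fourth derivative of
    h has to be |P|^2. *)
Lemma ord_ein00 : ord 3 (ein g 0 0).
Proof.
rewrite ein00; set u := tau - (- (xx * J) - half * xx ^+ 3 * N).
have uO : ord 4 u := cong_tau.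
have Du : D 0 u = D 0 tau + J + half * (3 * xx ^+ 2 * N).
  rewrite /u raddfB raddfB raddfN/= -[xx * J]/(xx ^+ 1 * J) (der0_xxM _ D0J) -(mulrA half).
  by rewrite (derM _ half) der_half (der0_xxM _ D0N) expr0; ring.
have xu : xi * u = xi * tau + J + half * xx ^+ 2 * N.
  transitivity (xi * tau + xi * (xx * J) + xi * (xx * (half * xx ^+ 2 * N))).
    by rewrite /u; ring.
  by rewrite !xixK.
rewrite [X in ord _ X](_ : _ = - D 0 u + xi * u - (KK h - xx ^+ 2 * N)).
  apply: ordB; last exact: cong_KK.
  apply: ordD; first by apply: ordN; apply: ord_der uO; lia.
  by apply: ord_mxi uO; lia.
rewrite Du xu; transitivity (- D 0 tau + xi * tau - KK h + xx ^+ 2 * N * (1 - half * 2)).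
  by rewrite half2 subrr mulr0 addr0.
by ring.
Qed.

(** The coefficient of x is div P - d (tr P) = 0, that of x^2 the divergence of
    q. *)
Lemma ord_ein0r i : ord 3 (ein g 0 (rs i)).
Proof.
pose F0 k l : A := xx ^+ 1 * (- p k l) + xx ^+ 2 * (half * (3 * q k l)).
have oF := ordF; have cF := cong_F3.
have e1 : cong 3 (con h (fun j k => nab2 h F j k i) : A)
   (con h0 (fun j k => nab2 h0 F0 j k i)).
  apply: (@cong_con _ _ _ 2) => //.
  - exact: cong_h.
  - by move=> j k; apply: ord_nab2.
  move=> j k; apply: (@cong_nab2 _ _ _ 2) => //.
  exact: cong_h.
have e2 : con h0 (fun j k => nab2 h0 F0 j k i) = - (xx * D (rs i) J) :> A.
  have E j k : nab2 h0 F0 j k i =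
      - xx * nab2 h0 p j k i + xx ^+ 2 * (half * 3) * nab2 h0 q j k i.
    rewrite -(@nab2_lin _ (tang A)) => [|l|l].
    - by apply: eq_nab2 => l m; rewrite /F0 /=; ring.
    - by rewrite raddfN/= der_xx /= oppr0.
    - by rewrite /= !(derM, der_half, der_nat, der_xx) /= mulr0n; ring.
  rewrite (@eq_con _ (tang A) h0 _ _ E) conD !conZ div_p divq.
  by rewrite /=; ring.
rewrite ein0r -/F.
rewrite [X in ord _ X](_ : _ = (con h (fun j k => nab2 h F j k i) -
    con h0 (fun j k => nab2 h0 F0 j k i)) - D (rs i) (tau - (- (xx * J) - half * xx ^+ 3 * N))
    + D (rs i) (half * xx ^+ 3 * N)); last first.
  rewrite e2 !(raddfB (D (rs i))) (raddfN (D (rs i))).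
  by rewrite /= (derM _ xx) der_xx /= mulr0n; ring.
apply: ordD.
  by apply: ordB; [exact: e1|apply: ord_derT; apply: cong_le cong_tau].
apply: ord_derT; rewrite -mulrA mulrCA; apply: ord_expx => //.
by apply: ordZ; [exact: ord_half|exact: ordN0].
Qed.

Lemma cong_tau2 : cong 2 tau (- (xx * J)).
Proof.
apply: cong_trans (cong_le _ cong_tau) _ => //.
rewrite /cong addrAC subrr add0r; apply: ordN; rewrite mulrAC mulrC.
by apply: ord_expx => //; apply: ordZ; [exact: ord_half|exact: ordN0].
Qed.

(** At x = 0 the Gauss equation reads Ric - P - (tr P) h0, and this vanishes by
    the definition of P in dimension 3. *)
Lemma ord_einrr i j : ord 1 (ein g (rs i) (rs j)).
Proof.
have oJ : ord 0 J by exact: ord_con0.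
have oxi s u : ord (s + 1) u -> ord s (xi * u).
  by move=> su; apply: ord_mxi su; rewrite addrK.
have oh'K k l m : ord 1 (h' k l * K l m).
  by apply: (@ord_le _ _ (1 + 1)) => //; apply: ordM; [exact: ord_h'|exact: ord_K].
have otau : ord 1 tau.
  apply: cong_ord (cong_le _ cong_tau2) _ => //; apply: ordN.
  by rewrite -[xx]expr1; exact: ord_expx.
pose u := h' i j - xx ^+ 1 * (- (2 * p i j)).
have uO : ord 2 u by exact: cong_h'2.
have Du : D 0 (h' i j) = D 0 u - 2 * p i j.
  have p20 : D 0 (- (2 * p i j)) = 0.
    by rewrite raddfN derM der_nat D0p mul0r mulr0 addr0 oppr0.
  by rewrite /u raddfB/= (der0_xxM _ p20) expr0; ring.
have xh' : xi * h' i j = xi * u - 2 * p i j.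
  transitivity (xi * u + xi * (xx * - (2 * p i j))); first by rewrite /u; ring.
  by rewrite xixK.
have xt : xi * tau = xi * (tau + xx * J) - J.
  transitivity (xi * (tau + xx * J) - xi * (xx * J)); first by ring.
  by rewrite xixK.
have R0 : Ric h0 i j = p i j + J * h0 i j.
  rewrite pE J_E /sch; ring.
rewrite einrr [X in ord _ X](_ : _ = (Ric h i j - Ric h0 i j) + xi * u - half * D 0 u
   + xi * (tau + xx * J) * h i j - J * (h i j - h0 i j) - half * tau * h' i j
   + half * \sum_k (h' j k * K k i + h' i k * K k j)
   + p i j * (half * 2 - 1)).
  rewrite half2 subrr mulr0 addr0.
  apply: ordD; last first.
    by apply: ordZ; [exact: ord_half|apply: ord_sum => k; exact: ordD].
  apply: ordB; last first.
    rewrite mulrC -[1]addr0; apply: ordM; first exact: ord_h'.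
    by apply: ordZ; [exact: ord_half|apply: ord_le otau].
  apply: ordB; last first.
    by apply: ordZ => //; apply: (cong_le _ (cong_h i j)).
  apply: ordD; last first.
    rewrite mulrC; apply: ordZ => //; apply: oxi.
    by have := cong_tau2; rewrite /cong opprK.
  apply: ordB; last first.
    by apply: ordZ; [exact: ord_half|apply: ord_der uO].
  apply: ordD; last exact: oxi.
  by apply: (@cong_le _ _ 2) => //; apply: cong_Ric => //; exact: cong_h.
rewrite Du xh' R0 [tau * (_ - _)](_ : _ = xi * tau * h i j - half * tau * h' i j); last by ring.
rewrite xt; ring.
Qed.

Lemma ord1_ein a b : ord 1 (ein g a b).
Proof.
elim/ind4: a => [|i]; elim/ind4: b => [|j].
- by apply: ord_le ord_ein00.
- by apply: ord_le (ord_ein0r j).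
- by rewrite einC; apply: ord_le (ord_ein0r i).
- exact: ord_einrr.
Qed.

Lemma ord3_ein0 b : ord 3 (ein g 0 b).
Proof. by elim/ind4: b => [|i]; [exact: ord_ein00|exact: ord_ein0r]. Qed.

End InitialData.

(** * Smooth functions and the symmetry of second derivatives *)

Section Smooth.
Variables (R : realType) (n : nat) (U : set 'rV[R]_n).
Hypothesis Uo : open U.
Implicit Types (f g : 'rV[R]_n -> R) (p : 'rV[R]_n) (i j : 'I_n).
Local Notation e_ i := (delta_mx 0 i : 'rV[R]_n).
Local Notation pd := (@partial R n).

Lemma near_open (P : 'rV[R]_n -> Prop) p : U p -> (forall q, U q -> P q) ->
  \forall q \near p, P q.
Proof.
move=> Up UP; have : nbhs p U by apply: open_nbhs_nbhs.
by apply: filterS => q; exact: UP.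
Qed.

Lemma eq_partial f g i p : (forall q, U q -> f q = g q) -> U p -> pd i f p = pd i g p.
Proof. by move=> fg Up; apply: near_eq_derive; exact: near_open. Qed.

(** Differentiability of finite order, by recursion on the order: closure of
    smoothness under products and inverses is proved by induction on it. *)
Fixpoint smoothN (k : nat) f : Prop :=
  (forall p, U p -> {for p, continuous f} /\ forall i, derivable f p (e_ i)) /\
  if k is k'.+1 then forall i, smoothN k' (pd i f) else True.

Lemma smoothNP f : smooth_on U f <-> forall k, smoothN k f.
Proof.
split=> [sf k|sf].
  elim: k f sf => [|k IH] f sf; (split; first by move=> p Up; exact: (sf [::] p Up)) => //.
  - by move=> i; apply: IH => l p Up; have := sf (rcons l i) p Up; rewrite foldr_rcons.
move=> l; elim/last_ind: l f sf => [|l i IH] f sf p Up.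
  by have [h _] := sf 0%N; exact: h.
rewrite foldr_rcons; apply: IH => // k.
by have [_ h] := sf k.+1; exact: h.
Qed.

Lemma smoothN_at k f p : smoothN k f -> U p ->
  {for p, continuous f} /\ forall i, derivable f p (e_ i).
Proof. by case: k => [|k] [h _] Up; exact: h. Qed.

Lemma smoothNS k f : smoothN k.+1 f -> smoothN k f.
Proof.
elim: k f => [|k IH] f; first by move=> [h _].
by move=> [h1 h2]; split=> // i; apply: IH.
Qed.

Definition regular f := forall p, U p ->
  {for p, continuous f} /\ forall i, derivable f p (e_ i).

Lemma smoothN_regular k f : smoothN k f -> regular f.
Proof. by move=> sf p Up; exact: smoothN_at sf Up. Qed.

Lemma smoothNI k f : regular f -> (forall i k', k = k'.+1 -> smoothN k' (pd i f)) ->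
  smoothN k f.
Proof. by case: k => [|k] h1 h2; split=> // i; exact: h2. Qed.

Lemma eq_regular f g : (forall q, U q -> f q = g q) -> regular f -> regular g.
Proof.
move=> fg rf p Up; have [cf df] := rf p Up; split=> [|i].
  move: cf; rewrite /prop_for /continuous_at fg// => cf; apply: cvg_trans cf.
  apply: (@near_eq_cvg _ _ (nbhs p) _ f g).
  by apply: (@near_open (fun q => f q = g q)).
by apply: near_eq_derivable (df i); exact: (@near_open (fun q => f q = g q)).
Qed.

Lemma eq_smoothN k f g : (forall q, U q -> f q = g q) -> smoothN k f -> smoothN k g.
Proof.
elim: k f g => [|k IH] f g fg sf.
  by split=> //; apply: eq_regular fg _; exact: smoothN_regular sf.
split=> [|i]; first by apply: eq_regular fg _; exact: smoothN_regular sf.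
by apply: IH (sf.2 i) => q Uq; exact: eq_partial.
Qed.

Lemma smoothN_cst k (c : R) : smoothN k (cst c).
Proof.
elim: k c => [|k IH] c; (split; [move=> p Up; split; [exact: cst_continuous|]|]) => //.
move=> i; apply: eq_smoothN (IH 0) => q Uq.
by rewrite /partial derive_cst.
Qed.

Lemma regularD f g : regular f -> regular g -> regular (f + g).
Proof.
move=> rf rg p Up; have [cf df] := rf p Up; have [cg dg] := rg p Up.
by split=> [|i]; [exact: continuousD|exact: derivableD].
Qed.

Lemma smoothND k f g : smoothN k f -> smoothN k g -> smoothN k (f + g).
Proof.
have r f' g' k' : smoothN k' f' -> smoothN k' g' -> regular (f' + g').
  by move=> sf sg; exact: regularD (smoothN_regular sf) (smoothN_regular sg).
elim: k f g => [|k IH] f g sf sg; (apply: smoothNI; first exact: r sf sg) => // i _ [<-].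
apply: eq_smoothN (IH _ _ (sf.2 i) (sg.2 i)) => q Uq.
have [_ df] := smoothN_at sf Uq; have [_ dg] := smoothN_at sg Uq.
by rewrite /partial deriveD.
Qed.

Lemma regularM f g : regular f -> regular g -> regular (f * g).
Proof.
move=> rf rg p Up; have [cf df] := rf p Up; have [cg dg] := rg p Up.
by split=> [|i]; [exact: continuousM|exact: derivableM].
Qed.

Lemma smoothNM k f g : smoothN k f -> smoothN k g -> smoothN k (f * g).
Proof.
have r f' g' k' : smoothN k' f' -> smoothN k' g' -> regular (f' * g').
  by move=> sf sg; exact: regularM (smoothN_regular sf) (smoothN_regular sg).
elim: k f g => [|k IH] f g sf sg; (apply: smoothNI; first exact: r sf sg) => // i _ [<-].
apply: (@eq_smoothN _ (f * pd i g + g * pd i f)) => [q Uq|].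
  have [_ df] := smoothN_at sf Uq; have [_ dg] := smoothN_at sg Uq.
  by rewrite /partial deriveM.
by apply: smoothND; apply: IH; [exact: smoothNS|exact: sg.2|exact: smoothNS|exact: sf.2].
Qed.

Lemma regularV f : (forall p, U p -> f p != 0) -> regular f ->
  regular (fun p => (f p)^-1).
Proof.
move=> f0 rf p Up; have [cf df] := rf p Up.
by split=> [|i]; [apply: continuousV => //; exact: f0|apply: derivableV => //; exact: f0].
Qed.

Lemma smoothNV k f : (forall p, U p -> f p != 0) -> smoothN k f ->
  smoothN k (fun p => (f p)^-1).
Proof.
move=> f0; have r k' : smoothN k' f -> regular (fun p => (f p)^-1).
  by move=> sf; exact: regularV f0 (smoothN_regular sf).
elim: k => [|k IH] sf; (apply: smoothNI; first exact: r sf) => // i _ [<-].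
pose g p := (f p)^-1.
apply: (@eq_smoothN _ (cst (- 1) * (g * g) * pd i f)) => [q Uq|].
  have [_ df] := smoothN_at sf Uq.
  rewrite /partial deriveV//; last exact: f0.
  by rewrite /g /= /GRing.scale/=/GRing.mul/= mulN1r -exprVn expr2.
have sg : smoothN k g by apply: IH; exact: smoothNS.
apply: smoothNM; last exact: sf.2.
by apply: smoothNM; [exact: smoothN_cst|exact: smoothNM].
Qed.

Lemma smooth_partial f i : smooth_on U f -> smooth_on U (pd i f).
Proof. by move=> /smoothNP sf; apply/smoothNP => k; exact: (sf k.+1).2. Qed.

Lemma eq_smooth f g : (forall q, U q -> f q = g q) -> smooth_on U f -> smooth_on U g.
Proof. by move=> fg /smoothNP sf; apply/smoothNP => k; exact: eq_smoothN (sf k). Qed.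

Lemma smooth_cst (c : R) : smooth_on U (fun=> c).
Proof. by apply/smoothNP => k; exact: smoothN_cst. Qed.

Lemma smoothD f g : smooth_on U f -> smooth_on U g -> smooth_on U (fun p => f p + g p).
Proof. by move=> /smoothNP sf /smoothNP sg; apply/smoothNP => k; exact: smoothND. Qed.

Lemma smoothM f g : smooth_on U f -> smooth_on U g -> smooth_on U (fun p => f p * g p).
Proof. by move=> /smoothNP sf /smoothNP sg; apply/smoothNP => k; exact: smoothNM. Qed.

Lemma smoothV f : (forall p, U p -> f p != 0) -> smooth_on U f ->
  smooth_on U (fun p => (f p)^-1).
Proof. by move=> f0 /smoothNP sf; apply/smoothNP => k; exact: smoothNV. Qed.

Lemma smooth_sum (I : finType) (F : I -> 'rV[R]_n -> R) :
  (forall x, smooth_on U (F x)) -> smooth_on U (fun p => \sum_x F x p).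
Proof.
move=> sF; elim: (index_enum I) => [|x r IH].
  by apply: eq_smooth (smooth_cst 0) => q Uq; rewrite big_nil.
by apply: eq_smooth (smoothD (sF x) IH) => q Uq; rewrite big_cons.
Qed.

Lemma smooth_at f p : smooth_on U f -> U p ->
  {for p, continuous f} /\ forall i, derivable f p (e_ i).
Proof. by move=> /(_ [::] p); exact. Qed.

Lemma partialD f g i p : smooth_on U f -> smooth_on U g -> U p ->
  pd i (fun p => f p + g p) p = pd i f p + pd i g p.
Proof.
move=> sf sg Up; have [_ df] := smooth_at sf Up; have [_ dg] := smooth_at sg Up.
by rewrite /partial -deriveD.
Qed.

Lemma partialB f g i p : smooth_on U f -> smooth_on U g -> U p ->
  pd i (fun p => f p - g p) p = pd i f p - pd i g p.
Proof.
move=> sf sg Up; have [_ df] := smooth_at sf Up; have [_ dg] := smooth_at sg Up.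
by rewrite /partial -deriveB.
Qed.

Lemma partialM f g i p : smooth_on U f -> smooth_on U g -> U p ->
  pd i (fun p => f p * g p) p = pd i f p * g p + f p * pd i g p.
Proof.
move=> sf sg Up; have [_ df] := smooth_at sf Up; have [_ dg] := smooth_at sg Up.
by rewrite /partial (@deriveM _ _ f g)// addrC /GRing.scale/= [X in X + _]mulrC.
Qed.

Lemma partial_cst (c : R) i p : pd i (fun=> c) p = 0.
Proof. exact: derive_cst. Qed.

Lemma partial_sum (I : finType) (F : I -> 'rV[R]_n -> R) i p :
  (forall x, smooth_on U (F x)) -> U p ->
  pd i (fun p => \sum_x F x p) p = \sum_x pd i (F x) p.
Proof.
move=> sF Up; have sums r : smooth_on U (fun p => \sum_(x <- r) F x p).
  elim: r => [|x r IH].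
    by apply: eq_smooth (smooth_cst 0) => q Uq; rewrite big_nil.
  by apply: eq_smooth (smoothD (sF x) IH) => q Uq; rewrite big_cons.
elim: (index_enum I) => [|x r IH].
  rewrite big_nil -[RHS](partial_cst 0 i p); apply: eq_partial => // q Uq.
  by rewrite big_nil.
rewrite big_cons -IH -partialD//; apply: eq_partial => // q Uq.
by rewrite big_cons.
Qed.

Lemma is_derive_line f (v q : 'rV[R]_n) (s : R) : derivable f (q + s *: v) v ->
  is_derive s (1 : R) (fun t : R => f (q + t *: v)) ('D_v f (q + s *: v)).
Proof.
move=> df.
have E : (fun h : R => h^-1 *: (((fun t : R => f (q + t *: v)) \o shift s) (h *: 1) -
    f (q + s *: v))) =
  (fun h : R => h^-1 *: ((f \o shift (q + s *: v)) (h *: v) - f (q + s *: v))).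
  apply/funext => h /=; congr (_ *: (f _ - _)).
  by rewrite [h *: 1]mulr1 scalerDl addrCA.
by apply: DeriveDef; rewrite /derivable /derive E.
Qed.

Lemma MVT_line f (v q : 'rV[R]_n) (h : R) : 0 < h ->
  (forall s, 0 <= s <= h -> derivable f (q + s *: v) v) ->
  exists2 s, 0 < s < h & f (q + h *: v) - f q = 'D_v f (q + s *: v) * h.
Proof.
move=> h0 df.
have dl s : 0 <= s <= h ->
    is_derive s (1 : R) (fun t : R => f (q + t *: v)) ('D_v f (q + s *: v)).
  by move=> /df; exact: is_derive_line.
have [||s sI E] := @MVT R (fun t : R => f (q + t *: v))
  (fun s => 'D_v f (q + s *: v)) 0 h h0.
- by move=> s; rewrite in_itv/= => /andP[s0 sh]; apply: dl; rewrite !ltW.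
- apply: derivable_within_continuous => s; rewrite in_itv/= => /dl.
  by move=> [].
exists s; first by move: sI; rewrite in_itv.
by move: E; rewrite scale0r addr0 subr0.
Qed.

Lemma is_derive_shift f (v q c : 'rV[R]_n) : derivable f (q + c) v ->
  is_derive q v (fun x => f (x + c)) ('D_v f (q + c)).
Proof.
move=> df.
have E : (fun h : R => h^-1 *: (((fun x => f (x + c)) \o shift q) (h *: v) - f (q + c))) =
  (fun h : R => h^-1 *: ((f \o shift (q + c)) (h *: v) - f (q + c))).
  by apply/funext => h /=; rewrite addrA.
by apply: DeriveDef; rewrite /derivable /derive E.
Qed.

(** Apply the mean value theorem in direction i to q |-> f (q + h e_j) - f q,
    then in direction j to the partial derivative obtained. *)
Lemma second_difference f i j p (h : R) : smooth_on U f -> 0 < h ->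
  (forall s t, 0 <= s <= h -> 0 <= t <= h -> U (p + s *: e_ i + t *: e_ j)) ->
  exists s t, [/\ 0 <= s <= h, 0 <= t <= h &
    f (p + h *: e_ i + h *: e_ j) - f (p + h *: e_ i) - (f (p + h *: e_ j) - f p)
    = pd j (pd i f) (p + s *: e_ i + t *: e_ j) * h * h].
Proof.
move=> sf h0 Ubox; have h00 : 0 <= (0 : R) <= h by rewrite lexx ltW.
have hh : 0 <= h <= h by rewrite lexx ltW.
have ltW2 (s t : R) : 0 < s < t -> 0 <= s <= t by move=> /andP[? ?]; rewrite !ltW.
pose G q := f (q + h *: e_ j) - f q.
have dG s : 0 <= s <= h -> is_derive (p + s *: e_ i) (e_ i) G
    ('D_(e_ i) f (p + s *: e_ i + h *: e_ j) - 'D_(e_ i) f (p + s *: e_ i)).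
  move=> sI; have [_ d1] := smooth_at sf (Ubox s h sI hh).
  have Us : U (p + s *: e_ i) by have := Ubox s 0 sI h00; rewrite scale0r addr0.
  have [_ d2] := smooth_at sf Us.
  apply: is_deriveB; first exact: is_derive_shift.
  exact: derivableP.
have [s sI Gs] : exists2 s, 0 < s < h & G (p + h *: e_ i) - G p =
    'D_(e_ i) G (p + s *: e_ i) * h.
  by apply: MVT_line => // s /dG []. 
have [t tI Ft] : exists2 t, 0 < t < h &
    pd i f (p + s *: e_ i + h *: e_ j) - pd i f (p + s *: e_ i) =
    'D_(e_ j) (pd i f) (p + s *: e_ i + t *: e_ j) * h.
  apply: MVT_line => // t tI.
  by have [_] := smooth_at (smooth_partial i sf) (Ubox _ _ (ltW2 _ _ sI) tI); exact.
exists s, t; split; [exact: ltW2 sI|exact: ltW2 tI|].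
move: Gs; rewrite /G (@derive_val _ _ _ _ _ _ _ (dG s (ltW2 _ _ sI))) => ->.
by rewrite /partial in Ft *; rewrite Ft.
Qed.

Lemma eq_of_near_values (a b : 'rV[R]_n -> R) p :
  {for p, continuous a} -> {for p, continuous b} ->
  (forall e, 0 < e -> exists q q', [/\ ball p e q, ball p e q' & a q = b q']) ->
  a p = b p.
Proof.
move=> ca cb close; apply: contrapT => /eqP neq.
pose eps := `|b p - a p| / 2.
have eps0 : 0 < eps by rewrite divr_gt0// normr_gt0 subr_eq0 eq_sym.
have na : \forall q \near p, `|a p - a q| < eps by move/cvgrPdist_lt: ca; exact.
have nb : \forall q \near p, `|b p - b q| < eps by move/cvgrPdist_lt: cb; exact.
have : nbhs p [set q | `|a p - a q| < eps /\ `|b p - b q| < eps].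
  by apply: filterS2 na nb => q.
move=> /nbhs_ballP[e /= e0 be].
have [q [q' [/be[/= aq _] /be[/= _ bq] ab]]] := close e e0.
rewrite ab in aq.
have tri (u v w : R) : `|v - w| < eps -> `|u - w| < eps -> `|u - v| < eps + eps.
  move=> vw uw; rewrite -(subrKA w); apply: le_lt_trans (ler_normD _ _) _.
  by apply: ltrD => //; rewrite distrC.
have := tri _ _ _ aq bq.
by rewrite /eps -splitr ltxx.
Qed.

(** Schwarz's theorem. The second difference over a small square is symmetric in
    the two directions, so that both mixed derivatives take a common value
    arbitrarily close to p; conclude by continuity. *)
Lemma partialC f i j p : smooth_on U f -> U p -> pd i (pd j f) p = pd j (pd i f) p.
Proof.
move=> sf Up; apply: eq_of_near_values.
- by have [] := smooth_at (smooth_partial i (smooth_partial j sf)) Up.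
- by have [] := smooth_at (smooth_partial j (smooth_partial i sf)) Up.
have : nbhs p U by apply: open_nbhs_nbhs.
move=> /nbhs_ballP[e1 /= e10 be] e2 e20.
pose e := Num.min e1 e2.
have e0 : 0 < e by rewrite lt_min e10.
pose C := `|e_ i| + `|e_ j|.
have C0 : 0 <= C by rewrite addr_ge0.
pose h := e / (C + 1).
have C1 : 0 < C + 1 by rewrite ltr_wpDl.
have h0 : 0 < h by rewrite divr_gt0.
have box (k l : 'I_n) s t : `|e_ k| + `|e_ l| = C -> 0 <= s <= h -> 0 <= t <= h ->
    ball p e (p + s *: e_ k + t *: e_ l).
  move=> kl /andP[s0 sh] /andP[t0 th]; rewrite -ball_normE /ball_/=.
  rewrite -addrA opprD addrA subrr sub0r normrN.
  apply: le_lt_trans (ler_normD _ _) _; rewrite !normrZ !ger0_norm//.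
  apply: (@le_lt_trans _ _ (h * C)).
    by rewrite -kl mulrDr lerD// ler_wpM2r.
  by rewrite /h mulrAC ltr_pdivrMr// ltr_pM2l// ltrDl.
have ee1 : ball p e `<=` ball p e1 by apply: le_ball; rewrite ge_min lexx.
have ee2 : ball p e `<=` ball p e2 by apply: le_ball; rewrite ge_min lexx orbT.
have boxU (k l : 'I_n) s t : `|e_ k| + `|e_ l| = C -> 0 <= s <= h -> 0 <= t <= h ->
    U (p + s *: e_ k + t *: e_ l).
  by move=> kl sI tI; apply: be; apply: ee1; apply: box.
have box2 (k l : 'I_n) s t : `|e_ k| + `|e_ l| = C -> 0 <= s <= h -> 0 <= t <= h ->
    ball p e2 (p + s *: e_ k + t *: e_ l).
  by move=> kl sI tI; apply: ee2; apply: box.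
have [|s [t [sI tI E]]] := second_difference (i := j) (j := i) (p := p) sf h0.
  by move=> s t sI tI; apply: boxU => //; rewrite addrC.
have [|s' [t' [sI' tI' E']]] := second_difference (i := i) (j := j) (p := p) sf h0.
  by move=> s' t' sI' tI'; apply: boxU.
exists (p + s *: e_ j + t *: e_ i), (p + s' *: e_ i + t' *: e_ j); split.
- by apply: box2 => //; rewrite addrC.
- exact: box2.
apply: (mulIf (lt0r_neq0 h0)); apply: (mulIf (lt0r_neq0 h0)).
apply: etrans (esym E) _; apply: etrans _ E'; rewrite [p + h *: e_ j + _]addrAC.
move: (f (p + h *: e_ i + h *: e_ j)) (f (p + h *: e_ i)) (f (p + h *: e_ j)) (f p).
by move=> w1 w2 w3 w4; ring.
Qed.

End Smooth.

(** * The ring of collar functions *)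

Section LaurentCalculus.
Variable F : fieldType.
Implicit Types f g : laurent F.

Lemma lmonomE (c : F) m k : lmonom c m k = c *+ (k == m).
Proof.
by rewrite /lmonom (@laurent_ofE _ _ m)// => j jm; rewrite lt_eqF.
Qed.

Lemma lmonom_mulE (c : F) m g k : (lmonom c m * g) k = c * g (k - m).
Proof.
have [M gM] := bounded_belowP g.
have mM j : j < m -> lmonom c m j = 0 by move=> jm; rewrite lmonomE lt_eqF.
rewrite lME; have [kM|/int_geP[n ->]] := ltP k (m + M).
  by rewrite (conv_lt mM gM)// gM ?mulr0//; lia.
rewrite (conv_shift mM gM) big_ord_recl big1 ?addr0 => [|i _].
  by rewrite lmonomE eqxx subn0; congr (_ * g _); lia.
rewrite lmonomE (_ : _ == _ = false) ?mul0r//.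
by apply/eqP; rewrite /= /bump/=; lia.
Qed.

Lemma lmonomM (a b : F) m n : lmonom a m * lmonom b n = lmonom (a * b) (m + n).
Proof.
apply: laurentP => k; rewrite lmonom_mulE !lmonomE mulrnAr.
by congr (_ *+ nat_of_bool _); apply/eqP/eqP; lia.
Qed.

Lemma lmonom1 : lmonom 1 0 = 1 :> laurent F.
Proof. by apply: laurentP => k; rewrite lmonomE. Qed.

Lemma lderivE f k : lderiv f k = f (k + 1) *~ (k + 1).
Proof.
have [N fN] := bounded_belowP f.
by rewrite /lderiv (@laurent_ofE _ _ (N - 1))// => j jN; rewrite fN ?mul0rz//; lia.
Qed.

Lemma lderivB f g : lderiv (f - g) = lderiv f - lderiv g.
Proof.
apply: laurentP => k; rewrite lderivE -[RHS]/(lderiv f k - lderiv g k) !lderivE.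
by rewrite -mulrzBl.
Qed.

(** Both sides are finite sums by conv_shift; the factor N + M + n of the left-
    hand side splits as (N + i) + (M + (n - i)). *)
Lemma lderivM f g : lderiv (f * g) = lderiv f * g + f * lderiv g.
Proof.
have [N fN] := bounded_belowP f; have [M gM] := bounded_belowP g.
have dN k : k < N - 1 -> lderiv f k = 0 by move=> ?; rewrite lderivE fN ?mul0rz//; lia.
have dM k : k < M - 1 -> lderiv g k = 0 by move=> ?; rewrite lderivE gM ?mul0rz//; lia.
apply: laurentP => k; rewrite lderivE ldE !lME.
have [kM|/int_geP[n kE]] := ltP (k + 1) (N + M).
  by rewrite (conv_lt fN gM)// (conv_lt dN gM) ?(conv_lt fN dM) ?mul0rz ?addr0//; lia.
have k1 : k = (N - 1) + M + n%:Z by lia.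
have k2 : k = N + (M - 1) + n%:Z by lia.
have e1 := conv_shift dN gM n; have e2 := conv_shift fN dM n.
rewrite -k1 in e1; rewrite -k2 in e2; rewrite e1 e2 kE (conv_shift fN gM).
rewrite -big_split mulrz_suml; apply: eq_bigr => i _ /=; rewrite !lderivE.
have -> : N - 1 + i%:Z + 1 = N + i%:Z by lia.
have -> : M - 1 + (n - i)%N%:Z + 1 = M + (n - i)%N%:Z by lia.
rewrite mulrzAl mulrzAr -mulrzDr; congr (_ *~ _).
by have := ltn_ord i; lia.
Qed.

End LaurentCalculus.

Section CollarFunctions.
Variable R : realType.

(** The open set is part of a structure, so that the ring of functions on it can
    be inferred. *)
Record openDom := OpenDom { dom :> set 'rV[R]_3; dom_open : open dom }.

Variable Ud : openDom.
Local Notation U := (dom Ud).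

(** The bound on the poles is uniform in the point, which makes the coefficients
    of a product finite sums of smooth functions. Functions vanish off U, so
    that equality on U is equality. *)
Definition collar_fun_prop (f : 'rV[R]_3 -> laurent R) : Prop :=
  [/\ exists N : int, forall u k, k < N -> f u k = 0,
      forall k, smooth_on U (fun u => f u k) & forall u, ~ U u -> f u = 0].

Definition collar_fun_pred (f : 'rV[R]_3 -> laurent R) : bool := `[< collar_fun_prop f >].

Record cfun := Cfun { cval :> 'rV[R]_3 -> laurent R; _ : collar_fun_pred cval }.

HB.instance Definition _ := [isSub for cval].
HB.instance Definition _ := [Choice of cfun by <:].

Lemma cfunP (f g : cfun) : (forall u, U u -> f u = g u) -> f = g.
Proof.
move=> fg; apply/val_inj/funext => u.
have [Uu|Uu] := pselect (U u); first exact: fg.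
by case: f {fg} => f /= /asboolP[_ _ ->]//; case: g => g /= /asboolP[_ _ ->].
Qed.

Lemma cfun_off (f : cfun) u : ~ U u -> f u = 0.
Proof. by case: f => f /= /asboolP[_ _ f0] /f0. Qed.

Lemma cfun_smooth (f : cfun) k : smooth_on U (fun u => f u k).
Proof. by case: f => f /= /asboolP[_ fs _]. Qed.

Lemma cfun_bound (f : cfun) : exists N : int, forall u k, k < N -> f u k = 0.
Proof. by case: f => f /= /asboolP[fN _ _]. Qed.

Lemma collar_fun_zmod : zmod_closed collar_fun_pred.
Proof.
have Uo : open U := @dom_open Ud; split.
  by apply/asboolP; split=> //; [exists 0|move=> k; exact: smooth_cst].
move=> f g /asboolP[[N fN] fs f0] /asboolP[[M gM] gs g0]; apply/asboolP; split.
- exists (Num.min N M) => u k; rewrite lt_min => /andP[kN kM].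
  by rewrite -[LHS]/(f u k - g u k) fN// gM// subr0.
- move=> k; apply: (eq_smooth Uo) (smoothD Uo (fs k) (smoothM Uo (smooth_cst Uo (- 1)) (gs k))).
  by move=> u _; rewrite mulN1r.
- by move=> u Uu; rewrite -[LHS]/(f u - g u) f0// g0// subr0.
Qed.

HB.instance Definition _ := GRing.isZmodClosed.Build _ collar_fun_pred collar_fun_zmod.
HB.instance Definition _ := [SubChoice_isSubZmodule of cfun by <:].

Lemma collar_fun_mul (f g : cfun) : collar_fun_pred (fun u => f u * g u).
Proof.
have Uo : open U := @dom_open Ud; apply/asboolP.
have [N fN] := cfun_bound f; have [M gM] := cfun_bound g; split.
- exists (N + M) => u k kNM; rewrite lME.
  exact: (conv_lt (fN u) (gM u)).
- move=> k; have [kNM|/int_geP[n ->]] := ltP k (N + M).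
    apply: (eq_smooth Uo) (smooth_cst Uo 0) => u _.
    by rewrite lME (conv_lt (fN u) (gM u)).
  apply: (eq_smooth Uo) (smooth_sum Uo (F := fun (i : 'I_n.+1) u =>
     f u (N + i%:Z) * g u (M + (n - i)%N%:Z)) _).
    by move=> u _; rewrite lME (conv_shift (fN u) (gM u)).
  by move=> i; apply: smoothM => //; exact: cfun_smooth.
- by move=> u Uu; rewrite cfun_off// mul0r.
Qed.

Definition cmul (f g : cfun) : cfun := Cfun (collar_fun_mul f g).

(** The constants of the ring; the unit is the indicator function of U. *)
Definition cutoff (a : laurent R) u : laurent R := if `[< U u >] then a else 0.

Lemma cutoffE a u : U u -> cutoff a u = a.
Proof. by move=> Uu; rewrite /cutoff asboolT. Qed.

Lemma collar_fun_cst (a : laurent R) : collar_fun_pred (cutoff a).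
Proof.
have Uo : open U := @dom_open Ud; apply/asboolP; split.
- have [N aN] := bounded_belowP a; exists N => u k kN; rewrite /cutoff.
  by case: ifP => _; rewrite ?aN.
- move=> k; apply: (eq_smooth Uo) (smooth_cst Uo (a k)) => u Uu.
  by rewrite cutoffE.
- by move=> u Uu; rewrite /cutoff asboolF.
Qed.

Definition ccst (a : laurent R) : cfun := Cfun (collar_fun_cst a).

Lemma ccstE a u : U u -> ccst a u = a. Proof. exact: cutoffE. Qed.

Lemma caddE (f g : cfun) u : (f + g) u = f u + g u. Proof. by []. Qed.

Fact cmulA : associative cmul.
Proof. by move=> f g h; apply: cfunP => u _; exact: mulrA. Qed.
Fact cmulC : commutative cmul.
Proof. by move=> f g; apply: cfunP => u _; exact: mulrC. Qed.
Fact cmul1 : left_id (ccst 1) cmul.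
Proof. by move=> f; apply: cfunP => u Uu; rewrite -[LHS]/(ccst 1 u * f u) ccstE// mul1r. Qed.
Fact cmulDl : left_distributive cmul +%R.
Proof. by move=> f g h; apply: cfunP => u _; exact: mulrDl. Qed.

HB.instance Definition _ := GRing.Zmodule_isComPzRing.Build cfun
  cmulA cmulC cmul1 cmulDl.

Lemma cmulE (f g : cfun) u : (f * g) u = f u * g u. Proof. by []. Qed.
Lemma coneE u : U u -> (1 : cfun) u = 1. Proof. exact: ccstE. Qed.
Lemma cnatE k u : U u -> (k%:R : cfun) u = k%:R.
Proof.
move=> Uu; elim: k => [|k IH]; first by [].
by rewrite -!natr1 caddE IH coneE.
Qed.

Lemma csumE (I : Type) (r : seq I) (F : I -> cfun) u :
  (\sum_(i <- r) F i) u = \sum_(i <- r) F i u.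
Proof. by elim: r => [|i r IH]; rewrite ?big_nil// !big_cons caddE IH. Qed.

Lemma lsumE (I : Type) (r : seq I) (F : I -> laurent R) k :
  (\sum_(i <- r) F i) k = \sum_(i <- r) F i k.
Proof. by elim: r => [|i r IH]; rewrite ?big_nil ?l0E// !big_cons ldE IH. Qed.

Definition cderx_fun (f : cfun) u : laurent R := lderiv (f u).

Lemma cderx_pred (f : cfun) : collar_fun_pred (cderx_fun f).
Proof.
have Uo : open U := @dom_open Ud.
apply/asboolP; split.
- have [N fN] := cfun_bound f; exists (N - 1) => u k kN.
  by rewrite /cderx_fun lderivE fN ?mul0rz//; lia.
- move=> k.
  apply: (eq_smooth Uo) (smoothM Uo (cfun_smooth f (k + 1)) (smooth_cst Uo (k + 1)%:~R)).
  by move=> u _; rewrite /cderx_fun lderivE mulrzr.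
- move=> u Uu; rewrite /cderx_fun cfun_off//.
  by apply: laurentP => k; rewrite lderivE l0E mul0rz.
Qed.

Definition cderx (f : cfun) : cfun := Cfun (cderx_pred f).

(** The cut-off at U is needed because the partial derivatives at points outside
    U are arbitrary. *)
Definition cdert_fun (i : 'I_3) (f : cfun) u : laurent R :=
  if `[< U u >] then laurent_of (fun k => partial i (fun v => f v k) u) else 0.

Lemma cdert_funE i f u k : U u -> cdert_fun i f u k = partial i (fun v => f v k) u.
Proof.
move=> Uu; have [N fN] := cfun_bound f; rewrite /cdert_fun asboolT//.
rewrite (@laurent_ofE _ _ N)// => j jN.
rewrite (_ : (fun v => f v j) = (fun=> 0)); first exact: partial_cst.
by apply/funext => v; rewrite fN.
Qed.

Lemma cdert_pred i (f : cfun) : collar_fun_pred (cdert_fun i f).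
Proof.
have Uo : open U := @dom_open Ud.
apply/asboolP; split.
- have [N fN] := cfun_bound f; exists N => u k kN.
  have [Uu|Uu] := pselect (U u); last by rewrite /cdert_fun asboolF.
  rewrite cdert_funE// (_ : (fun v => f v k) = (fun=> 0)); first exact: partial_cst.
  by apply/funext => v; rewrite fN.
- move=> k; apply: (eq_smooth Uo) (smooth_partial i (cfun_smooth f k)) => u Uu.
  by rewrite cdert_funE.
- by move=> u Uu; rewrite /cdert_fun asboolF.
Qed.

Definition cdert i (f : cfun) : cfun := Cfun (cdert_pred i f).

Lemma cdertE i f u k : U u -> cdert i f u k = partial i (fun v => f v k) u.
Proof. exact: cdert_funE. Qed.

Lemma cderxE f u k : cderx f u k = f u (k + 1) *~ (k + 1).
Proof. exact: lderivE. Qed.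

Definition cder (a : 'I_(1 + 3)) : cfun -> cfun :=
  match fintype.split a with inl _ => cderx | inr i => cdert i end.

Fact cder_zmod a : zmod_morphism (cder a).
Proof.
have Uo : open U := @dom_open Ud.
move=> f g; apply: cfunP => u Uu; rewrite /cder; case: fintype.split => i.
  exact: lderivB.
apply: laurentP => k; rewrite cdertE// -[RHS]/(cdert i f u k - cdert i g u k) !cdertE//.
by rewrite -(partialB (U := U))//; exact: cfun_smooth.
Qed.

HB.instance Definition _ a := GRing.isZmodMorphism.Build cfun cfun (cder a) (cder_zmod a).

Fact cderM a (f g : cfun) : cder a (f * g) = cder a f * g + f * cder a g.
Proof.
have Uo : open U := @dom_open Ud.
apply: cfunP => u Uu; rewrite /cder; case: fintype.split => i; first exact: lderivM.
have [N fN] := cfun_bound f; have [M gM] := cfun_bound g.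
have dN k : k < N -> cdert i f u k = 0.
  move=> kN; rewrite cdertE// (_ : (fun v => f v k) = (fun=> 0)); first exact: partial_cst.
  by apply/funext => v; rewrite fN.
have dM k : k < M -> cdert i g u k = 0.
  move=> kN; rewrite cdertE// (_ : (fun v => g v k) = (fun=> 0)); first exact: partial_cst.
  by apply/funext => v; rewrite gM.
apply: laurentP => k; rewrite cdertE// caddE ldE !cmulE !lME.
have [kNM|/int_geP[n ->]] := ltP k (N + M).
  rewrite (conv_lt dN (gM u))// (conv_lt (fN u) dM)// addr0.
  rewrite (_ : (fun v => (f * g) v k) = (fun=> 0)); first exact: partial_cst.
  by apply/funext => v; rewrite -[LHS]/((f v * g v) k) lME (conv_lt (fN v) (gM v)).
rewrite (conv_shift dN (gM u)) (conv_shift (fN u) dM) -big_split/=.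
rewrite (@eq_partial _ _ _ Uo _ (fun v =>
    \sum_(j < n.+1) f v (N + j%:Z) * g v (M + (n - j)%N%:Z))) //.
  rewrite (partial_sum Uo) => [|j|//]; last by apply: smoothM => //; exact: cfun_smooth.
  apply: eq_bigr => j _; rewrite (partialM (U := U))//; [|exact: cfun_smooth|exact: cfun_smooth].
  by rewrite !cdertE.
by move=> v _; rewrite -[LHS]/((f v * g v) _) lME (conv_shift (fN v) (gM v)).
Qed.

Fact cderC a b (f : cfun) : cder a (cder b f) = cder b (cder a f).
Proof.
have Uo : open U := @dom_open Ud.
have xt i : cderx (cdert i f) = cdert i (cderx f).
  apply: cfunP => u Uu; apply: laurentP => k; rewrite cderxE !cdertE//.
  rewrite [RHS](@eq_partial _ _ _ Uo _ (fun v => f v (k + 1) * (k + 1)%:~R)) //.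
    rewrite (partialM (U := U))//; [|exact: cfun_smooth|exact: smooth_cst].
    by rewrite partial_cst mulr0 addr0 mulrzr.
  by move=> v _; rewrite cderxE mulrzr.
rewrite /cder; case: (fintype.split a) => i; case: (fintype.split b) => j //.
apply: cfunP => u Uu; apply: laurentP => k.
apply: etrans (cdertE i (cdert j f) k Uu) _.
apply: etrans _ (esym (cdertE j (cdert i f) k Uu)).
have d l m : partial l (fun v => cdert m f v k) u = partial l (partial m (fun v => f v k)) u.
  by apply: (eq_partial Uo) => // v Uv; exact: cdertE.
apply: etrans (d i j) _; apply: etrans _ (esym (d j i)).
exact: (@partialC _ _ _ Uo (fun v => f v k) i j u (cfun_smooth f k) Uu).
Qed.

Lemma lnatE n k : (n%:R : laurent R) k = n%:R *+ (k == 0).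
Proof.
elim: n => [|n IH]; first by rewrite l0E mul0rn.
by rewrite -!natr1 ldE IH l1E mulrnDl.
Qed.

Lemma lnat_neq0 n : (n.+1%:R : laurent R) != 0.
Proof.
apply/eqP => /(congr1 (fun f : laurent R => f 0)); rewrite lnatE l0E eqxx mulr1n.
by move/eqP; rewrite pnatr_eq0.
Qed.

Lemma linv_nat n : (n.+1%:R : laurent R)^-1 = lmonom (n.+1%:R^-1) 0.
Proof.
apply: (mulfI (lnat_neq0 n)); rewrite mulfV ?lnat_neq0//.
have -> : (n.+1%:R : laurent R) = lmonom n.+1%:R 0.
  by apply: laurentP => k; rewrite lnatE lmonomE.
by rewrite lmonomM mulfV ?pnatr_eq0// lmonom1.
Qed.

Fact ccst_invK n : ccst (n.+1%:R^-1) * n.+1%:R = 1.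
Proof.
apply: cfunP => u Uu; rewrite cmulE ccstE// cnatE// coneE//.
by rewrite mulVf ?lnat_neq0.
Qed.

Definition cdiffRing : diffRing (1 + 3) := @DiffRing (1 + 3) cfun
  (fun a => cder a : {additive cfun -> cfun}) cderM cderC
  (ccst 2^-1) (ccst 3^-1) (ccst_invK 1) (ccst_invK 2).

Definition cord (s : int) (f : cfun) : Prop := forall u k, k < s -> f u k = 0.

Fact cord_le s t (f : cfun) : s <= t -> cord t f -> cord s f.
Proof. by move=> st tf u k ks; apply: tf; exact: lt_le_trans st. Qed.

Fact cord0 s : cord s 0. Proof. by []. Qed.

Fact cordB s (f g : cfun) : cord s f -> cord s g -> cord s (f - g).
Proof. by move=> sf sg u k ks; rewrite -[LHS]/(f u k - g u k) sf// sg// subr0. Qed.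

Fact cordM s t (f g : cfun) : cord s f -> cord t g -> cord (s + t) (f * g).
Proof. by move=> sf tg u k kst; rewrite cmulE lME (conv_lt (sf u) (tg u)). Qed.

Lemma cord_cst s (a : laurent R) : (forall k, k < s -> a k = 0) -> cord s (ccst a).
Proof.
move=> a0 u k ks; have [Uu|Uu] := pselect (U u); first by rewrite ccstE// a0.
by rewrite cfun_off.
Qed.

Lemma lmonom_lt (c : R) m k : k < m -> lmonom c m k = 0.
Proof. by move=> km; rewrite lmonomE lt_eqF. Qed.

Fact cord1 : cord 0 1.
Proof. by apply: cord_cst => k k0; rewrite l1E lt_eqF. Qed.

Fact cord_inv n : cord 0 (ccst n.+1%:R^-1).
Proof. by apply: cord_cst => k k0; rewrite linv_nat lmonom_lt. Qed.

Fact cord_cancel s n (f : cfun) : cord s (n.+1%:R * f) -> cord s f.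
Proof.
move=> nf; rewrite -[f]mul1r -(ccst_invK n) -mulrA -[s]add0r.
by apply: cordM => //; exact: cord_inv.
Qed.

Fact cxxi : ccst (lmonom 1 1) * ccst (lmonom 1 (- 1)) = 1.
Proof.
by apply: cfunP => u Uu; rewrite cmulE !ccstE// lmonomM mulr1 subrr lmonom1.
Qed.

Lemma cder_t i : cder (rshift 1 i) = cdert i.
Proof. by rewrite /cder split_rshift. Qed.

Lemma cder_x : cder 0 = cderx.
Proof. by rewrite /cder split_ord0. Qed.

Lemma cdert_cst i (a : laurent R) : cdert i (ccst a) = 0.
Proof.
have Uo : open U := @dom_open Ud.
apply: cfunP => u Uu; apply: laurentP => k; rewrite cdertE// l0E.
rewrite -[RHS](partial_cst (a k) i u); apply: (eq_partial Uo) => // v Uv.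
by rewrite ccstE.
Qed.

Fact cder_xx a : cder a (ccst (lmonom 1 1)) = (a == 0)%:R.
Proof.
elim/ind4: a => [|i]; last by rewrite cder_t cdert_cst.
rewrite cder_x eqxx; apply: cfunP => u Uu; apply: laurentP => k.
rewrite cderxE ccstE// cnatE// lmonomE lnatE.
have [->|k0] := eqVneq k 0; first by rewrite add0r eqxx.
by rewrite (_ : k + 1 == 1 = false) ?mul0rz//; lia.
Qed.

Fact cord_derT i s f : cord s f -> cord s (cder (rshift 1 i) f).
Proof.
move=> sf u k ks; rewrite cder_t.
have [Uu|Uu] := pselect (U u); last by rewrite cfun_off.
rewrite cdertE// (_ : (fun v => f v k) = (fun=> 0)); first exact: partial_cst.
by apply/funext => v; rewrite sf.
Qed.

Lemma cmulznE (m : int) (f : cfun) u k : (m%:~R * f) u k = m%:~R * f u k.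
Proof.
have nE n : (f *+ n) u k = f u k *+ n.
  by elim: n => [|n IH]; rewrite ?mulr0n// !mulrSr -IH.
rewrite !mulrzl; case: m => n; first exact: nE.
rewrite !NegzE !mulrNz; exact: (congr1 -%R (nE n.+1)).
Qed.

Fact cord_der0 s f : cord s f ->
  cord (s + 1) (ccst (lmonom 1 1) * cder 0 f - s%:~R * f).
Proof.
move=> sf u k ks; have [Uu|Uu] := pselect (U u); last by rewrite cfun_off.
rewrite -[LHS]/((ccst (lmonom 1 1) * cder 0 f : cfun) u k - (s%:~R * f : cfun) u k).
rewrite cmulznE cmulE ccstE// lmonom_mulE mul1r cder_x cderxE subrK.
have [kE|] := eqVneq k s; first by rewrite kE mulrzl subrr.
move=> kns; rewrite sf ?mul0rz ?mulr0 ?subr0//; lia.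
Qed.

Definition ccollar : collarRing := @CollarRing cdiffRing cord cord_le cord0 cordB cordM
  cord1 (cord_inv 1) (cord_inv 2) cord_cancel (ccst (lmonom 1 1)) (ccst (lmonom 1 (- 1)))
  cxxi (cord_cst (fun k => @lmonom_lt 1 1 k)) (cord_cst (fun k => @lmonom_lt 1 (-1) k))
  cder_xx cord_derT cord_der0.

End CollarFunctions.

(** * From tensor fields at points to a differential ring *)

(** The relation rel F u says that the function F represents the ring element u.
    It is used with values of F in the Laurent series and with real values. Each
    definition at points is built from operations that preserve rel, so that it
    is related to its counterpart over the ring; inverses of matrices are
    covered by the hypothesis rel_gi. *)
Section Bridge.
Variables (K : fieldType) (n : nat) (X : Type).
Variables (D : 'I_n -> (X -> K) -> X -> K) (g : X -> 'M[K]_n).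
Variables (A : diffRing n) (gm : metric A) (rel : (X -> K) -> A -> Prop).
Implicit Types (a b c d e f : 'I_n) (F G : X -> K) (u v : A).
Hypothesis relD : forall F G u v, rel F u -> rel G v -> rel (fun p => F p + G p) (u + v).
Hypothesis relN : forall F u, rel F u -> rel (fun p => - F p) (- u).
Hypothesis relM : forall F G u v, rel F u -> rel G v -> rel (fun p => F p * G p) (u * v).
Hypothesis rel1 : rel (fun=> 1) 1.
Hypothesis rel_der : forall i F u, rel F u -> rel (D i F) (der A i u).
Hypothesis rel_half : rel (fun=> 2^-1) half.
Hypothesis rel_g : forall a b, rel (fun p => g p a b) (gm a b).
Hypothesis rel_gi : forall a b, rel (ginv g a b) (imet gm a b).

Lemma relB F G u v : rel F u -> rel G v -> rel (fun p => F p - G p) (u - v).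
Proof. by move=> Fu Gv; apply: relD => //; exact: relN. Qed.

Lemma rel0 : rel (fun=> 0) 0.
Proof.
by have : rel (fun=> 1 - 1) (1 - 1) := relB rel1 rel1; rewrite !subrr.
Qed.

Lemma rel_nat k : rel (fun=> k%:R) k%:R.
Proof.
by elim: k => [|k IH]; [exact: rel0|rewrite -!natr1; exact: relD].
Qed.

Lemma rel_sum (I : finType) (F : I -> X -> K) (u : I -> A) :
  (forall i, rel (F i) (u i)) -> rel (fun p => \sum_i F i p) (\sum_i u i).
Proof.
move=> Fu; elim: (index_enum I) => [|i r IH].
  rewrite big_nil [X in rel X](_ : _ = (fun=> 0)); first exact: rel0.
  by apply/funext => p; rewrite big_nil.
rewrite big_cons [X in rel X](_ : _ = (fun p => F i p + \sum_(i <- r) F i p)).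
  exact: relD.
by apply/funext => p; rewrite big_cons.
Qed.

Lemma rel_christoffel c a b : rel (christoffel D g c a b) (Gam gm c a b).
Proof.
apply: relM rel_half _; apply: rel_sum => d; apply: relM; first exact: rel_gi.
by apply: relB; [apply: relD|]; apply: rel_der; exact: rel_g.
Qed.

Lemma rel_riemann_up a b c d : rel (riemann_up D g a b c d) (Rup gm a b c d).
Proof.
apply: relD.
  by apply: relB; apply: rel_der; exact: rel_christoffel.
by apply: rel_sum => e; apply: relB; apply: relM; exact: rel_christoffel.
Qed.

Lemma rel_riemann a b c d : rel (riemann D g a b c d) (Rm gm a b c d).
Proof.
by apply: rel_sum => e; apply: relM; [exact: rel_g|exact: rel_riemann_up].
Qed.

Lemma rel_ricci b d : rel (ricci D g b d) (Ric gm b d).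
Proof. by apply: rel_sum => a; exact: rel_riemann_up. Qed.

Lemma rel_tr2 (T : 'I_n -> 'I_n -> X -> K) (T' : 'I_n -> 'I_n -> A) :
  (forall a b, rel (T a b) (T' a b)) -> rel (tr2 g T) (con gm T').
Proof.
by move=> TT; apply: rel_sum => a; apply: rel_sum => b; apply: relM => //; exact: rel_gi.
Qed.

Lemma rel_raise2 (T : 'I_n -> 'I_n -> X -> K) (T' : 'I_n -> 'I_n -> A) a b :
  (forall a b, rel (T a b) (T' a b)) -> rel (raise2 g T a b) (raise gm T' a b).
Proof.
move=> TT; apply: rel_sum => c; apply: rel_sum => d; apply: relM => //.
by apply: relM; exact: rel_gi.
Qed.

Lemma rel_normsq2 (T : 'I_n -> 'I_n -> X -> K) (T' : 'I_n -> 'I_n -> A) :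
  (forall a b, rel (T a b) (T' a b)) -> rel (normsq2 g T) (normsq gm T').
Proof.
move=> TT; apply: rel_sum => a; apply: rel_sum => b; apply: relM => //.
exact: rel_raise2.
Qed.

Lemma rel_scalar_curv : rel (scalar_curv D g) (Sc gm).
Proof. by apply: rel_tr2; exact: rel_ricci. Qed.

Section Schouten.
Variables k1 k2 : A.
Hypothesis rel_k1 : rel (fun=> (n%:R - 2)^-1) k1.
Hypothesis rel_k2 : rel (fun=> (2 * (n%:R - 1))^-1) k2.

Lemma rel_schouten a b : rel (schouten D g a b) (sch gm k1 k2 a b).
Proof.
apply: relM => //; apply: relB; first exact: rel_ricci.
apply: relM; last exact: rel_g.
by apply: relM => //; exact: rel_scalar_curv.
Qed.

Lemma rel_weyl a b c d : rel (weyl D g a b c d) (wey gm k1 k2 a b c d).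
Proof.
apply: relB; first exact: rel_riemann.
have h a' b' c' d' : rel (fun p => g p a' b' * schouten D g c' d' p)
    (gm a' b' * sch gm k1 k2 c' d').
  by apply: relM; [exact: rel_g|exact: rel_schouten].
by apply: relB => //; apply: relB => //; apply: relD.
Qed.
End Schouten.

Lemma rel_act e b (T : 'I_n -> X -> K) (T' : 'I_n -> A) :
  (forall f, rel (T f) (T' f)) ->
  rel (fun p => \sum_f christoffel D g f e b p * T f p) (act gm e b T').
Proof.
move=> TT; apply: rel_sum => f; apply: relM => //; exact: rel_christoffel.
Qed.

(** The covariant derivatives of tensors with 0, 1, 2, 4 and 5 slots are all
    that the Laplacian, the divergence and the Bach tensor involve. *)
Lemma rel_covd0 (T : seq 'I_n -> X -> K) (T' : A) e :
  rel (T [::]) T' -> rel (covd D g T [:: e]) (der A e T').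
Proof.
move=> TT; rewrite (_ : covd _ _ _ _ = D e (T [::])); first exact: rel_der.
by apply/funext => p; rewrite /covd/= big_ord0 subr0.
Qed.

Lemma rel_covd1 (T : seq 'I_n -> X -> K) (T' : 'I_n -> A) e a :
  (forall a, rel (T [:: a]) (T' a)) -> rel (covd D g T [:: e; a]) (nab1 gm T' e a).
Proof.
move=> TT; rewrite (_ : covd _ _ _ _ = fun p => D e (T [:: a]) p -
    \sum_f christoffel D g f e a p * T [:: f] p).
  by apply: relB; [exact: rel_der|exact: rel_act].
by apply/funext => p; rewrite /covd/= !big_ord_recl big_ord0 /= addr0.
Qed.

Lemma rel_covd2 (T : seq 'I_n -> X -> K) (T' : 'I_n -> 'I_n -> A) e a b :
  (forall a b, rel (T [:: a; b]) (T' a b)) ->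
  rel (covd D g T [:: e; a; b]) (nab2 gm T' e a b).
Proof.
move=> TT; rewrite (_ : covd _ _ _ _ = fun p => D e (T [:: a; b]) p
    - \sum_f christoffel D g f e a p * T [:: f; b] p
    - \sum_f christoffel D g f e b p * T [:: a; f] p).
  by do ![apply: relB]; [exact: rel_der|exact: rel_act|exact: rel_act].
by apply/funext => p; rewrite /covd/= !big_ord_recl big_ord0 /= addr0 !opprD !addrA.
Qed.

Lemma rel_covd4 (T : seq 'I_n -> X -> K) (T' : 'I_n -> 'I_n -> 'I_n -> 'I_n -> A) e a b c d :
  (forall a b c d, rel (T [:: a; b; c; d]) (T' a b c d)) ->
  rel (covd D g T [:: e; a; b; c; d]) (nab4 gm T' e a b c d).
Proof.
move=> TT; rewrite (_ : covd _ _ _ _ = fun p => D e (T [:: a; b; c; d]) p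
    - \sum_f christoffel D g f e a p * T [:: f; b; c; d] p
    - \sum_f christoffel D g f e b p * T [:: a; f; c; d] p
    - \sum_f christoffel D g f e c p * T [:: a; b; f; d] p
    - \sum_f christoffel D g f e d p * T [:: a; b; c; f] p).
  by do 4?[apply: relB]; [exact: rel_der|exact: rel_act|exact: rel_act
    |exact: rel_act|exact: rel_act].
by apply/funext => p; rewrite /covd/= !big_ord_recl big_ord0 /= addr0 !opprD !addrA.
Qed.

Lemma rel_covd5 (T : seq 'I_n -> X -> K) (T' : 'I_n -> 'I_n -> 'I_n -> 'I_n -> 'I_n -> A)
    e a b c d h :
  (forall a b c d h, rel (T [:: a; b; c; d; h]) (T' a b c d h)) ->
  rel (covd D g T [:: e; a; b; c; d; h]) (nab5 gm T' e a b c d h).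
Proof.
move=> TT; rewrite (_ : covd _ _ _ _ = fun p => D e (T [:: a; b; c; d; h]) p
    - \sum_f christoffel D g f e a p * T [:: f; b; c; d; h] p
    - \sum_f christoffel D g f e b p * T [:: a; f; c; d; h] p
    - \sum_f christoffel D g f e c p * T [:: a; b; f; d; h] p
    - \sum_f christoffel D g f e d p * T [:: a; b; c; f; h] p
    - \sum_f christoffel D g f e h p * T [:: a; b; c; d; f] p).
  by do 5?[apply: relB]; [exact: rel_der|exact: rel_act|exact: rel_act
    |exact: rel_act|exact: rel_act|exact: rel_act].
by apply/funext => p; rewrite /covd/= !big_ord_recl big_ord0 /= addr0 !opprD !addrA.
Qed.

Lemma rel_laplacian F u : rel F u -> rel (laplacian D g F) (lap gm u).
Proof.
move=> Fu; apply: rel_tr2 => a b; apply: rel_covd1 => c.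
exact: rel_covd0.
Qed.

Lemma rel_div2 (T : 'I_n -> 'I_n -> X -> K) (T' : 'I_n -> 'I_n -> A) c :
  (forall a b, rel (T a b) (T' a b)) ->
  rel (div2 D g T c) (con gm (fun a b => nab2 gm T' a b c)).
Proof.
by move=> TT; apply: rel_tr2 => a b; apply: rel_covd2.
Qed.

End Bridge.

Section Bridge4.
Variables (K : fieldType) (X : Type).
Variables (D : 'I_(1 + 3) -> (X -> K) -> X -> K) (g : X -> 'M[K]_(1 + 3)).
Variables (A : diffRing (1 + 3)) (gm : metric A) (rel : (X -> K) -> A -> Prop).
Implicit Types (a b c d e f : 'I_(1 + 3)) (F G : X -> K) (u v : A).
Hypothesis relD : forall F G u v, rel F u -> rel G v -> rel (fun p => F p + G p) (u + v).
Hypothesis relN : forall F u, rel F u -> rel (fun p => - F p) (- u).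
Hypothesis relM : forall F G u v, rel F u -> rel G v -> rel (fun p => F p * G p) (u * v).
Hypothesis rel1 : rel (fun=> 1) 1.
Hypothesis rel_der : forall i F u, rel F u -> rel (D i F) (der A i u).
Hypothesis rel_half : rel (fun=> 2^-1) half.
Hypothesis rel_third : rel (fun=> 3^-1) third.
Hypothesis rel_g : forall a b, rel (fun p => g p a b) (gm a b).
Hypothesis rel_gi : forall a b, rel (ginv g a b) (imet gm a b).

Lemma rel_k1 : rel (fun=> ((1 + 3)%:R - 2)^-1) half.
Proof. by rewrite (_ : (1 + 3)%:R - 2 = 2 :> K) //; ring. Qed.

Lemma rel_sixth : rel (fun=> 6^-1) (half * third).
Proof.
rewrite (_ : 6^-1 = 2^-1 * 3^-1 :> K); first exact: relM.
by rewrite -invfM; congr (_^-1); ring.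
Qed.

Lemma rel_k2 : rel (fun=> (2 * ((1 + 3)%:R - 1))^-1) (half * third).
Proof.
by rewrite (_ : 2 * ((1 + 3)%:R - 1) = 6 :> K); [exact: rel_sixth|ring].
Qed.

Let rsum := rel_sum relD relN rel1.
Let rricci := rel_ricci relD relN relM rel1 rel_der rel_half rel_g rel_gi.
Let rweyl := rel_weyl relD relN relM rel1 rel_der rel_half rel_g rel_gi rel_k1 rel_k2.
Let rcovd4 := rel_covd4 relD relN relM rel1 rel_der rel_half rel_g rel_gi.
Let rcovd5 := rel_covd5 relD relN relM rel1 rel_der rel_half rel_g rel_gi.

Lemma rel_bach a c : rel (bach D g a c) (bach4 gm a c).
Proof.
rewrite /bach4 -[X in X + _]mul1r; apply: relD; apply: relM.
- by rewrite (_ : ((1 + 3)%:R - 3)^-1 = 1 :> K) // (_ : _ - 3 = 1) ?invr1 //; ring.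
- do 4!(apply: rsum => ?); apply: relM; first by apply: relM; exact: rel_gi.
  by apply: rcovd5 => f a' b' c' d'; apply: rcovd4 => *; exact: rweyl.
- exact: rel_k1.
do 2!(apply: rsum => ?); apply: relM; first exact: rweyl.
by apply: (rel_raise2 relD relN relM rel1 rel_gi) => *; exact: rricci.
Qed.

Lemma rel_qcurv4 : rel (qcurv4 D g) (Q4 gm).
Proof.
have rSc := rel_scalar_curv relD relN relM rel1 rel_der rel_half rel_g rel_gi.
apply: relM; first exact: rel_sixth.
apply: (relB relD relN); last first.
  apply: relM; first exact: (rel_nat relD relN rel1 3).
  by apply: (rel_normsq2 relD relN relM rel1 rel_gi) => *; exact: rricci.
apply: relD.
  apply: relN.
  exact: (rel_laplacian relD relN relM rel1 rel_der rel_half rel_g rel_gi rSc).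
exact: relM.
Qed.

Lemma rel_ein a b : rel (fun p => ricci D g a b p + 3 * g p a b) (ein gm a b).
Proof.
apply: relD; first exact: rricci.
by apply: relM; [exact: (rel_nat relD relN rel1 3)|exact: rel_g].
Qed.

End Bridge4.

(** * Inverting a power series of matrices *)

Section SeriesInverse.
Variables (F : fieldType) (n : nat).
Implicit Types H : nat -> 'M[F]_n.

(** The coefficients of the left inverse of a power series of matrices, computed
    one after the other; being given by a recursion, they depend smoothly on
    parameters (smooth_mxinv). *)
Fixpoint mxinv_seq H (m : nat) : seq 'M[F]_n :=
  if m is k.+1 then
    rcons (mxinv_seq H k) (((k == 0%N)%:R%:M
      - \sum_(j < k) (mxinv_seq H k)`_j *m H (k - j)%N) *m invmx (H 0%N))
  else [::].

Lemma size_mxinv_seq H m : size (mxinv_seq H m) = m.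
Proof. by elim: m => //= m IH; rewrite size_rcons IH. Qed.

Definition mxinv H m : 'M[F]_n := (mxinv_seq H m.+1)`_m.

Lemma mxinv_seq_nth H k m : (k < m)%N -> (mxinv_seq H m)`_k = mxinv H k.
Proof.
elim: m => // m IH; rewrite ltnS leq_eqVlt => /orP[/eqP->//|km].
by rewrite [in LHS]/= nth_rcons size_mxinv_seq km IH.
Qed.

Lemma mxinvE H m : mxinv H m = ((m == 0%N)%:R%:M
  - \sum_(j < m) mxinv H j *m H (m - j)%N) *m invmx (H 0%N).
Proof.
rewrite /mxinv /= nth_rcons size_mxinv_seq ltnn eqxx; congr ((_ - _) *m _).
by apply: eq_bigr => j _; rewrite mxinv_seq_nth.
Qed.

Lemma mxinvP H m : H 0%N \in unitmx ->
  \sum_(j < m.+1) mxinv H j *m H (m - j)%N = (m == 0%N)%:R%:M.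
Proof.
move=> H0; rewrite big_ord_recr /= subnn [mxinv H m]mxinvE mulmxKV//.
by rewrite addrC subrK.
Qed.

End SeriesInverse.

Section SmoothMatrix.
Variables (R : realType) (n : nat) (U : set 'rV[R]_n).
Hypothesis Uo : open U.

Lemma smooth_prod (I : finType) (F : I -> 'rV[R]_n -> R) :
  (forall x, smooth_on U (F x)) -> smooth_on U (fun p => \prod_x F x p).
Proof.
move=> sF; elim: (index_enum I) => [|x r IH].
  by apply: (eq_smooth Uo) (smooth_cst Uo 1) => q Uq; rewrite big_nil.
by apply: (eq_smooth Uo) (smoothM Uo (sF x) IH) => q Uq; rewrite big_cons.
Qed.

Lemma smooth_det m (A : 'rV[R]_n -> 'M[R]_m) :
  (forall i j, smooth_on U (fun p => A p i j)) -> smooth_on U (fun p => \det (A p)).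
Proof.
move=> sA; apply: smooth_sum => // s.
by apply: smoothM => //; [exact: smooth_cst|exact: smooth_prod].
Qed.

Lemma smooth_mulmx m1 m2 m3 (A : 'rV[R]_n -> 'M[R]_(m1, m2))
    (B : 'rV[R]_n -> 'M[R]_(m2, m3)) i j :
  (forall i j, smooth_on U (fun p => A p i j)) ->
  (forall i j, smooth_on U (fun p => B p i j)) ->
  smooth_on U (fun p => (A p *m B p) i j).
Proof.
move=> sA sB; apply: (eq_smooth Uo) (smooth_sum Uo (F := fun k p => A p i k * B p k j) _).
  by move=> q _; rewrite mxE.
by move=> k; apply: smoothM.
Qed.

Lemma smooth_invmx m (A : 'rV[R]_n -> 'M[R]_m) i j :
  (forall p, U p -> A p \in unitmx) ->
  (forall i j, smooth_on U (fun p => A p i j)) -> smooth_on U (fun p => invmx (A p) i j).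
Proof.
move=> uA sA; apply: (eq_smooth Uo) (smoothM Uo (f := fun p => (\det (A p))^-1)
    (g := fun p => cofactor (A p) j i) _ _).
- by move=> q Uq; rewrite /invmx uA// !mxE.
- apply: smoothV => //; last exact: smooth_det.
  by move=> p Up; have := uA p Up; rewrite unitmxE unitfE.
apply: smoothM => //; first exact: smooth_cst.
apply: smooth_det => k l; apply: (eq_smooth Uo) (sA (lift j k) (lift i l)) => q _.
by rewrite !mxE.
Qed.

Lemma smooth_mxinv m (H : nat -> 'rV[R]_n -> 'M[R]_m) k i j :
  (forall p, U p -> H 0%N p \in unitmx) ->
  (forall k i j, smooth_on U (fun p => H k p i j)) ->
  smooth_on U (fun p => mxinv (fun k => H k p) k i j).
Proof.
move=> uH sH; elim/ltn_ind: k i j => k IH i j.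
apply: (eq_smooth Uo) (smooth_mulmx i j (A := fun p => (k == 0%N)%:R%:M
  - \sum_(l < k) mxinv (fun k => H k p) l *m H (k - l)%N p)
  (B := fun p => invmx (H 0%N p)) _ _).
- by move=> q _; rewrite -mxinvE.
- move=> {}i {}j.
  apply: (eq_smooth Uo) (smoothD Uo (smooth_cst Uo (((k == 0%N)%:R%:M : 'M[R]_m) i j))
    (smoothM Uo (smooth_cst Uo (- 1)) (smooth_sum Uo (F := fun (l : 'I_k) p =>
     (mxinv (fun k => H k p) l *m H (k - l)%N p) i j) _))).
    by move=> q _; rewrite [RHS]mxE [X in _ = _ + X]mxE summxE mulN1r.
  by move=> l; apply: smooth_mulmx => // *; exact: IH.
by move=> *; exact: smooth_invmx.
Qed.

End SmoothMatrix.

(** * Collar functions built from functions on a chart *)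

Section Lifts.
Variables (R : realType) (Ud : openDom R).
Local Notation U := (dom Ud).
Local Notation A := (ccollar Ud).
Implicit Types (F : nat -> 'rV[R]_3 -> R).

Lemma lift_pred F : (forall m, smooth_on U (F m)) ->
  collar_fun_pred Ud (fun u => if `[< U u >] then
    laurent_of (fun k => if k is Posz m then F m u else 0) else 0).
Proof.
have Uo : open U := @dom_open _ Ud.
have E u : laurent_of (fun k => if k is Posz m then F m u else 0) =
    (fun k => if k is Posz m then F m u else 0) :> (int -> R).
  by apply: (@laurent_ofE _ _ 0) => -[].
move=> sF; apply/asboolP; split.
- by exists 0 => u [] // k _; case: ifP => _ //; rewrite E.
- move=> [m|m].
    by apply: (eq_smooth Uo) (sF m) => u Uu; rewrite asboolT// E.
  by apply: (eq_smooth Uo) (smooth_cst Uo 0) => u Uu; rewrite asboolT// E.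
- by move=> u Uu; rewrite asboolF.
Qed.

Definition slift F (sF : forall m, smooth_on U (F m)) : cfun Ud := Cfun (lift_pred sF).

Lemma sliftE F (sF : forall m, smooth_on U (F m)) u : U u ->
  slift sF u = laurent_of (fun k => if k is Posz m then F m u else 0).
Proof. by move=> Uu; rewrite /slift/= asboolT. Qed.

Lemma slift_coef F (sF : forall m, smooth_on U (F m)) u k : U u ->
  slift sF u k = if k is Posz m then F m u else 0.
Proof.
by move=> Uu; rewrite sliftE// (@laurent_ofE _ _ 0)// => -[].
Qed.

Lemma ord_slift F (sF : forall m, smooth_on U (F m)) : ord 0 (slift sF : A).
Proof.
move=> u k k0; have [Uu|Uu] := pselect (U u); last by rewrite cfun_off.
by rewrite slift_coef//; case: k k0.
Qed.

Lemma xconst_smooth (f : 'rV[R]_3 -> R) (sf : smooth_on U f) m :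
  smooth_on U (fun u => f u *+ (m == 0%N)).
Proof.
have Uo : open U := @dom_open _ Ud.
case: m => [|m]; first by apply: (eq_smooth Uo) sf => u _; rewrite mulr1n.
by apply: (eq_smooth Uo) (smooth_cst Uo 0) => u _; rewrite mulr0n.
Qed.

Definition clift f (sf : smooth_on U f) : cfun Ud := slift (xconst_smooth sf).

Lemma cliftE f (sf : smooth_on U f) u : U u -> clift sf u = lmonom (f u) 0.
Proof.
move=> Uu; apply: laurentP => k; rewrite slift_coef// lmonomE.
by case: k.
Qed.

Lemma ord_clift f (sf : smooth_on U f) : ord 0 (clift sf : A).
Proof. exact: ord_slift. Qed.

Lemma der0_clift f (sf : smooth_on U f) : der A 0 (clift sf) = 0.
Proof.
apply: cfunP => u Uu; apply: laurentP => k.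
rewrite -[LHS]/(cder 0 (clift sf) u k) cder_x cderxE cliftE// lmonomE l0E.
by have [->|_] := eqVneq (k + 1) 0; rewrite ?mulr0z// mulr0n mul0rz.
Qed.

(** Values at points lie in a field, where a left inverse of a symmetric matrix
    is symmetric and two-sided; this makes the pointwise inverse of a metric an
    inverse over the ring B of functions. The map inj evaluates an element of B. *)
Section MakeMetric.
Variables (n : nat) (B : diffRing n) (inj : B -> 'rV[R]_3 -> laurent R).
Hypothesis injP : forall f g : B, (forall u, U u -> inj f u = inj g u) -> f = g.
Hypothesis injD : forall I (r : seq I) (F : I -> B) u,
  inj (\sum_(i <- r) F i) u = \sum_(i <- r) inj (F i) u.
Hypothesis injM : forall f g u, inj (f * g) u = inj f u * inj g u.
Hypothesis injN : forall k u, U u -> inj k%:R u = k%:R.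
Variables (m im : 'I_n -> 'I_n -> B).
Hypothesis mC : forall a b, m a b = m b a.
Hypothesis imV : forall u, U u ->
  (\matrix_(a, b) inj (im a b) u) *m (\matrix_(a, b) inj (m a b) u) = 1%:M.

Lemma mk_imetC a b : im a b = im b a.
Proof.
apply: injP => u Uu; have h := imV Uu.
have mT : (\matrix_(a, b) inj (m a b) u)^T = \matrix_(a, b) inj (m a b) u.
  by apply/matrixP => i j; rewrite !mxE mC.
have := congr1 trmx h; rewrite trmx_mul mT trmx1 => h'.
have /(congr1 (fun X : 'M[laurent R]_n => X a b)) :
    \matrix_(a, b) inj (im a b) u = (\matrix_(a, b) inj (im a b) u)^T.
  by rewrite -[LHS]mulmx1 -h' mulmxA h mul1mx.
by rewrite !mxE.
Qed.

Lemma mk_imetV a c : \sum_b im a b * m b c = (a == c)%:R.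
Proof.
apply: injP => u Uu; rewrite injD injN//.
have /(congr1 (fun X : 'M[laurent R]_n => X a c)) := imV Uu.
rewrite !mxE => <-; apply: eq_bigr => b _.
by rewrite injM !mxE.
Qed.

Definition mk_metric : metric B := Metric mC mk_imetC mk_imetV.
End MakeMetric.

Lemma ginvE n (B : diffRing n) (inj : B -> 'rV[R]_3 -> laurent R) (gm : metric B)
    (g : 'rV[R]_3 -> 'M[laurent R]_n) u :
  (forall I (r : seq I) (F : I -> B),
    inj (\sum_(i <- r) F i) u = \sum_(i <- r) inj (F i) u) ->
  (forall f g, inj (f * g) u = inj f u * inj g u) ->
  (forall k, inj k%:R u = k%:R) ->
  (forall a b, g u a b = inj (gm a b) u) ->
  forall a b, ginv g a b u = inj (imet gm a b) u.
Proof.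
move=> injD injM injN gE a b.
pose N : 'M[laurent R]_n := \matrix_(a, b) inj (imet gm a b) u.
have NV : N *m g u = 1%:M.
  apply/matrixP => i j; rewrite !mxE -injN -(imetV gm) injD; apply: eq_bigr => k _.
  by rewrite injM !mxE gE.
have gU : g u \in unitmx by have [] := mulmx1_unit NV.
rewrite /ginv (_ : invmx (g u) = N); first by rewrite mxE.
by rewrite -[LHS]mul1mx -NV mulmxK.
Qed.

(** The two instances of the representation relation: Laurent series agreeing on
    U, and real functions seen as functions independent of x. *)
Definition rel_collar (F : 'rV[R]_3 -> laurent R) (f : A) : Prop :=
  forall u, U u -> F u = (f : cfun Ud) u.

Definition rel_const (F : 'rV[R]_3 -> R) (f : tang A) : Prop :=
  forall u, U u -> (f : cfun Ud) u = lmonom (F u) 0.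

Lemma rel_collarD (F G : 'rV[R]_3 -> laurent R) (f g : A) :
  rel_collar F f -> rel_collar G g ->
  rel_collar (fun p => F p + G p) (f + g).
Proof. by move=> Ff Gg u Uu; rewrite Ff// Gg. Qed.

Lemma rel_collarN (F : 'rV[R]_3 -> laurent R) (f : A) :
  rel_collar F f -> rel_collar (fun p => - F p) (- f).
Proof. by move=> Ff u Uu; rewrite Ff. Qed.

Lemma rel_collarM (F G : 'rV[R]_3 -> laurent R) (f g : A) :
  rel_collar F f -> rel_collar G g ->
  rel_collar (fun p => F p * G p) (f * g).
Proof. by move=> Ff Gg u Uu; rewrite Ff// Gg. Qed.

Lemma rel_collar1 : rel_collar (fun=> 1) 1.
Proof. by move=> u Uu; rewrite -[RHS]/((1 : cfun Ud) u) coneE. Qed.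

Lemma rel_collar_cst a : rel_collar (fun=> a) (ccst Ud a).
Proof. by move=> u Uu; rewrite ccstE. Qed.

Lemma rel_collar_der a (F : 'rV[R]_3 -> laurent R) (f : A) : rel_collar F f ->
  rel_collar (collar_partial a F) (der A a f).
Proof.
have Uo : open U := @dom_open _ Ud.
move=> Ff u Uu; rewrite /collar_partial -[RHS]/(cder a f u) /cder.
case: fintype.split => i; first by rewrite Ff.
rewrite /cdert/= /cdert_fun asboolT//; congr laurent_of; apply/funext => k.
by apply: (eq_partial Uo) => // v Uv; rewrite Ff.
Qed.

Lemma lmonomD (x y : R) : lmonom x 0 + lmonom y 0 = lmonom (x + y) 0.
Proof. by apply: laurentP => k; rewrite ldE !lmonomE mulrnDl. Qed.

Lemma lmonomN (x : R) : - lmonom x 0 = lmonom (- x) 0.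
Proof. by apply: laurentP => k; rewrite -[LHS]/(- lmonom x 0 k) !lmonomE mulNrn. Qed.

Lemma rel_constD (F G : 'rV[R]_3 -> R) (f g : tang A) :
  rel_const F f -> rel_const G g ->
  rel_const (fun p => F p + G p) (f + g).
Proof.
by move=> Ff Gg u Uu; rewrite -lmonomD -(Ff u Uu) -(Gg u Uu).
Qed.

Lemma rel_constN (F : 'rV[R]_3 -> R) (f : tang A) :
  rel_const F f -> rel_const (fun p => - F p) (- f).
Proof. by move=> Ff u Uu; rewrite -lmonomN -(Ff u Uu). Qed.

Lemma rel_constM (F G : 'rV[R]_3 -> R) (f g : tang A) :
  rel_const F f -> rel_const G g ->
  rel_const (fun p => F p * G p) (f * g).
Proof.
move=> Ff Gg u Uu; rewrite -[in RHS](addr0 0) -lmonomM -(Ff u Uu) -(Gg u Uu).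
by [].
Qed.

Lemma rel_const1 : rel_const (fun=> 1) 1.
Proof. by move=> u Uu; rewrite lmonom1 -[LHS]/((1 : cfun Ud) u) coneE. Qed.

Lemma rel_const_inv n : rel_const (fun=> n.+1%:R^-1) (ccst Ud n.+1%:R^-1).
Proof. by move=> u Uu; rewrite ccstE// linv_nat. Qed.

Lemma rel_const_der i (F : 'rV[R]_3 -> R) (f : tang A) : rel_const F f ->
  rel_const (partial i F) (der (tang A) i f).
Proof.
have Uo : open U := @dom_open _ Ud.
move=> Ff u Uu; apply: laurentP => k; rewrite -[LHS]/(cder (rshift 1 i) f u k) cder_t.
rewrite cdertE// lmonomE.
rewrite (@eq_partial _ _ _ Uo _ (fun v => F v *+ (k == 0))) => [|v Uv|//]; last first.
  by rewrite Ff// lmonomE.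
by case: (k == 0) => //; exact: partial_cst.
Qed.

Lemma rel_const_clift f (sf : smooth_on U f) : rel_const f (clift sf).
Proof. by move=> u Uu; rewrite cliftE. Qed.

Lemma rel_const_eq (F : 'rV[R]_3 -> R) (f g : tang A) :
  rel_const F f -> rel_const F g -> f = g.
Proof. by move=> Ff Fg; apply: cfunP => u Uu; rewrite (Ff u Uu) (Fg u Uu). Qed.

End Lifts.

(** * The equivalence in one chart *)

Section Chart.
Variables (R : realType) (M : smooth_manifold R 3) (h0 Psi : sym2 M) (h : nat -> sym2 M).
Hypothesis h0_riem : riemannian h0.
Variable c : chart M.
Hypothesis h_0 : forall u, chart_img c u -> h 0%N c u = h0 c u.

Definition chart_open : openDom R := OpenDom (@chart_img_open R 3 M c).
Local Notation Ud := chart_open.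
Local Notation U := (dom Ud).
Local Notation A := (ccollar Ud).
Implicit Types (i j k l : 'I_3).

Let Uo : open U. Proof. exact: (@dom_open _ Ud). Qed.

(** A vector in the kernel of a positive definite matrix is zero. *)
Lemma riem_unit u : U u -> h0 c u \in unitmx.
Proof.
move=> Uu; rewrite -row_free_unit -kermx_eq0; apply: contraT => /rowV0Pn[v].
move=> /sub_kermxP vh v0; have := h0_riem Uu v0.
by rewrite vh mul0mx mxE ltxx.
Qed.

Definition hcoef (m : nat) u : 'M[R]_3 := \matrix_(i, j) (h m c u i j / m`!%:R).

Lemma hcoef_smooth m i j : smooth_on U (fun u => hcoef m u i j).
Proof.
have sh : smooth_on U (fun u => h m c u i j) := @sym2_smooth _ _ _ (h m) c i j.
apply: (eq_smooth Uo) (smoothM Uo sh (smooth_cst Uo m`!%:R^-1)).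
by move=> u _; rewrite mxE.
Qed.

Lemma hcoef0 u : U u -> hcoef 0 u = h0 c u.
Proof. by move=> Uu; apply/matrixP => i j; rewrite mxE invr1 mulr1 h_0. Qed.

Lemma hcoef_unit u : U u -> hcoef 0 u \in unitmx.
Proof. by move=> Uu; rewrite hcoef0//; exact: riem_unit. Qed.

Definition hseries i j : cfun Ud := slift (fun m => hcoef_smooth m i j).
(** Only the constant coefficient, which is the matrix of h0, has to be
    inverted. *)
Definition ihseries i j : cfun Ud :=
  slift (fun m => smooth_mxinv Uo m i j hcoef_unit hcoef_smooth).

Lemma hseriesC i j : hseries i j = hseries j i.
Proof.
apply: cfunP => u Uu; apply: laurentP => -[m|m]; rewrite !slift_coef// !mxE.
by rewrite -[in LHS](sym2_sym (h m) Uu) mxE.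
Qed.

Lemma hseries_formal i j u : U u -> hseries i j u = formal_series (fun m => h m c u i j).
Proof.
move=> Uu; apply: laurentP => k; rewrite /hseries slift_coef// /formal_series.
by rewrite (@laurent_ofE _ _ 0) => [|[]//]; case: k => [m|m] //; rewrite /hcoef mxE.
Qed.

Lemma ihseriesV u : U u -> (\matrix_(i, j) ihseries i j u) *m (\matrix_(i, j) hseries i j u) = 1%:M.
Proof.
move=> Uu; apply/matrixP => i j; rewrite !mxE; apply: laurentP => k.
have n0 (f : cfun Ud) : ord 0 (f : A) -> forall m : int, m < 0 -> f u m = 0.
  by move=> f0 m; exact: f0.
have i0 k l := n0 _ (ord_slift (fun m => smooth_mxinv Uo m k l hcoef_unit hcoef_smooth)).
have s0 k l := n0 _ (ord_slift (fun m => hcoef_smooth m k l)).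
rewrite lsumE lnatE; under eq_bigr do rewrite !mxE lME.
have [k0|/int_geP[n kE]] := ltP k 0.
  rewrite (lt_eqF k0).
  by rewrite big1// => l _; rewrite (conv_lt (i0 i l) (s0 l j)).
have -> : k = 0 + 0 + n%:Z by lia.
under eq_bigr do rewrite (conv_shift (i0 _ _) (s0 _ _)).
rewrite exchange_big.
have /(congr1 (fun X : 'M[R]_3 => X i j)) := mxinvP (H := fun m => hcoef m u) n (hcoef_unit Uu).
rewrite summxE mxE => E.
have -> : ((i == j)%:R *+ (0 + 0 + n%:Z == 0) : R) = (n == 0%N)%:R *+ (i == j).
  by rewrite !add0r eqz_nat; case: (i == j); case: (n == 0%N).
rewrite -E; apply: eq_bigr => m _; rewrite mxE; apply: eq_bigr => l _.
by rewrite !add0r !slift_coef.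
Qed.

Let inj (f : tang A) : 'rV[R]_3 -> laurent R := (f : cfun Ud).

Definition hmet : metric (tang A) := @mk_metric _ Ud 3 (tang A) inj
  (@cfunP _ Ud) (@csumE _ Ud) (@cmulE _ Ud) (@cnatE _ Ud) hseries ihseries hseriesC ihseriesV.

Lemma h0_smooth i j : smooth_on U (fun u => h0 c u i j).
Proof. exact: (@sym2_smooth _ _ _ h0 c i j). Qed.

Definition h0s i j : cfun Ud := clift (Ud := Ud) (h0_smooth i j).
Definition ih0s i j : cfun Ud :=
  clift (Ud := Ud) (smooth_invmx Uo i j riem_unit h0_smooth).

Lemma h0sC i j : h0s i j = h0s j i.
Proof.
apply: cfunP => u Uu; rewrite !cliftE//.
by rewrite -[in LHS](sym2_sym h0 Uu) mxE.
Qed.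

Lemma lmonom_sum (I : finType) (F : I -> R) :
  \sum_i lmonom (F i) 0 = lmonom (\sum_i F i) 0.
Proof.
elim: (index_enum I) => [|i r IH]; last by rewrite !big_cons IH lmonomD.
by rewrite !big_nil; apply: laurentP => k; rewrite lmonomE l0E mul0rn.
Qed.

Lemma ih0sV u : U u -> (\matrix_(i, j) ih0s i j u) *m (\matrix_(i, j) h0s i j u) = 1%:M.
Proof.
move=> Uu; apply/matrixP => i j; rewrite !mxE.
transitivity (lmonom ((invmx (h0 c u) *m h0 c u) i j) 0).
  rewrite [in RHS]mxE -lmonom_sum; apply: eq_bigr => k _.
  by rewrite !mxE !cliftE// lmonomM.
rewrite mulVmx ?riem_unit// mxE; case: (i == j); first exact: lmonom1.
by apply: laurentP => k; rewrite lmonomE mul0rn.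
Qed.

Definition h0met : metric (tang A) := @mk_metric _ Ud 3 (tang A) inj
  (@cfunP _ Ud) (@csumE _ Ud) (@cmulE _ Ud) (@cnatE _ Ud) h0s ih0s h0sC ih0sV.

Let ordh i j : ord 0 (hmet i j : A). Proof. exact: ord_slift. Qed.
Let ordih i j : ord 0 (imet hmet i j : A). Proof. exact: ord_slift. Qed.
Let ordh0 i j : ord 0 (h0met i j : A). Proof. exact: ord_clift. Qed.
Let ordih0 i j : ord 0 (imet h0met i j : A). Proof. exact: ord_clift. Qed.

Definition gm : ahMetric A := collar_metric ordh ordih.
Local Notation g := (hyp gm).

Lemma normal_formE a b u : U u -> normal_form h c u a b = (g a b : cfun Ud) u.
Proof.
move=> Uu; rewrite /normal_form mxE.
have -> : (g a b : cfun Ud) u = lmonom 1 (-1) * (lmonom 1 (-1) * (gm a b : cfun Ud) u).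
  rewrite -[met g a b]/((xi : A) ^+ 2 * gm a b) expr2 -mulrA.
  rewrite -[LHS]/(ccst Ud (lmonom 1 (-1)) u *
    (ccst Ud (lmonom 1 (-1)) u * (gm a b : cfun Ud) u)).
  by rewrite ccstE.
rewrite mulrA lmonomM mulr1 -[-1 - 1]/(-2 : int); congr (_ * _).
rewrite -[met gm a b]/(blk hmet a b) /blk.
have [i ->|i ->] := fintype.split_ordP a; have [j ->|j ->] := fintype.split_ordP b.
- by rewrite block_mxEul mxE (ord1 i) (ord1 j) -[RHS]/((1 : cfun Ud) u) coneE.
- by rewrite block_mxEur mxE.
- by rewrite block_mxEdl mxE.
by rewrite block_mxEdr mxE -hseries_formal.
Qed.

Local Notation NF := (normal_form h c).
Local Notation relc := (@rel_collar R Ud).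

Let rD := @rel_collarD R Ud.
Let rN := @rel_collarN R Ud.
Let rM := @rel_collarM R Ud.
Let r1 := @rel_collar1 R Ud.
Let rder := @rel_collar_der R Ud.

Lemma rel_g a b : relc (fun u => NF u a b) (g a b).
Proof. by move=> u Uu; rewrite normal_formE. Qed.

Lemma rel_gi a b : relc (ginv NF a b) (imet g a b).
Proof.
move=> u Uu.
apply: (@ginvE R _ A (fun f : A => (f : cfun Ud) : 'rV[R]_3 -> laurent R) g NF u) => //.
- by move=> *; exact: csumE.
- by move=> k; exact: cnatE.
by move=> *; exact: normal_formE.
Qed.

Lemma rel_half : relc (fun=> 2^-1) half. Proof. exact: rel_collar_cst. Qed.
Lemma rel_third : relc (fun=> 3^-1) third. Proof. exact: rel_collar_cst. Qed.

Let D4 := @collar_partial R.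
Let rbach := rel_bach rD rN rM r1 rder rel_half rel_third rel_g rel_gi.
Let rQ := rel_qcurv4 rD rN rM r1 rder rel_half rel_third rel_g rel_gi.
Let rein := rel_ein rD rN rM r1 rder rel_half rel_g rel_gi.

Lemma chart_einstein_bach :
  (forall u, U u -> forall a b, ricci D4 NF a b u + 3 * NF u a b = 0) ->
  (forall u, U u -> forall a b, bach D4 NF a b u = 0) /\
  (forall u, U u -> qcurv4 D4 NF u = lmonom 6 0).
Proof.
move=> e0; have E0 a b : ein g a b = 0.
  by apply: cfunP => u Uu; rewrite -(rein a b Uu) e0.
split=> u Uu.
  by move=> a b; rewrite (rbach a b Uu) (einstein_bach4 E0).
rewrite (rQ Uu) (einstein_Q4 E0) -[LHS]/((6%:R : cfun Ud) u) cnatE//.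
by apply: laurentP => k; rewrite lnatE lmonomE.
Qed.

Hypothesis Psi_tr : forall u, chart_img c u ->
  tr2 (h0 c) (fun i j v => Psi c v i j) u = 0.
Hypothesis Psi_div : forall u, chart_img c u -> forall k,
  div2 (@partial R 3) (h0 c) (fun i j v => Psi c v i j) k u = 0.
Hypothesis h_1 : forall u, chart_img c u -> h 1%N c u = 0.
Hypothesis h_2 : forall u, chart_img c u -> forall i j,
  h 2%N c u i j = - 2 * schouten (@partial R 3) (h0 c) i j u.
Hypothesis h_3 : forall u, chart_img c u -> h 3%N c u = Psi c u.
Hypothesis h_4 : forall u, chart_img c u ->
  (3`!%:R)^-1 * tr2 (h0 c) (fun i j v => h 4%N c v i j) u =
  normsq2 (h0 c) (schouten (@partial R 3) (h0 c)) u.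

Lemma comp_smooth (T : sym2 M) i j : smooth_on U (fun u => T c u i j).
Proof. exact: (@sym2_smooth _ _ _ T c i j). Qed.

Let lc (T : sym2 M) i j : A := clift (Ud := Ud) (comp_smooth T i j).

Let hp i j : A := - (half * lc (h 2) i j).
Let hq i j : A := half * third * lc Psi i j.
Let hr i j : A := half * half * half * third * lc (h 4) i j.

Let cD := @rel_constD R Ud.
Let cN := @rel_constN R Ud.
Let cM := @rel_constM R Ud.
Let c1 := @rel_const1 R Ud.
Let cder' := @rel_const_der R Ud.
Local Notation relr := (@rel_const R Ud).

Lemma rel_const_h0 i j : relr (fun u => h0 c u i j) (h0met i j).
Proof. exact: rel_const_clift. Qed.

Lemma rel_const_ih0 i j : relr (ginv (h0 c) i j) (imet h0met i j).
Proof. exact: rel_const_clift. Qed.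

Lemma rel_const_half : relr (fun=> 2^-1) half.
Proof. exact: (rel_const_inv 1). Qed.

Lemma rel_const_third : relr (fun=> 3^-1) third.
Proof. exact: (rel_const_inv 2). Qed.

Lemma rel_const_sch i j :
  relr (schouten (@partial R 3) (h0 c) i j) (sch h0met 1 (half * half) i j).
Proof.
apply: (rel_schouten cD cN cM c1 cder' rel_const_half rel_const_h0 rel_const_ih0).
  by rewrite (_ : (3%:R - 2)^-1 = 1 :> R) // (_ : _ - _ = 1) ?invr1//; ring.
rewrite (_ : (2 * (3%:R - 1))^-1 = 2^-1 * 2^-1 :> R).
  by apply: cM; exact: rel_const_half.
by rewrite -invfM; congr (_^-1); ring.
Qed.

Lemma hpE i j : hp i j = sch h0met 1 (half * half) i j.
Proof.
have r := rel_const_sch i j.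
suff r' : relr (schouten (@partial R 3) (h0 c) i j) (hp i j) by exact: rel_const_eq r' r.
have r2 : relr (fun u => - (2^-1 * h 2%N c u i j)) (hp i j).
  by apply: cN; apply: cM; [exact: rel_const_half|exact: rel_const_clift].
move=> u Uu; rewrite (r2 u Uu) h_2//; congr lmonom.
by rewrite mulrA mulrN mulVf ?mulN1r ?opprK// pnatr_eq0.
Qed.

Lemma hq_tr : con h0met hq = 0 :> A.
Proof.
have rP i j : relr (fun u => Psi c u i j) (lc Psi i j) by exact: rel_const_clift.
have rt := rel_tr2 cD cN cM c1 rel_const_ih0 rP.
have t0 : con h0met (lc Psi) = 0 :> A.
  apply: cfunP => u Uu; rewrite (rt u Uu) Psi_tr//.
  by apply: laurentP => k; rewrite lmonomE mul0rn.
by rewrite /hq conZ t0 mulr0.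
Qed.

Lemma hq_div i : con h0met (fun k l => nab2 h0met hq k l i) = 0 :> A.
Proof.
have rP k l : relr (fun u => Psi c u k l) (lc Psi k l) by exact: rel_const_clift.
have rt := rel_div2 cD cN cM c1 cder' rel_const_half rel_const_h0 rel_const_ih0 i rP.
have t0 : con h0met (fun k l => nab2 h0met (lc Psi) k l i) = 0 :> A.
  apply: cfunP => u Uu; rewrite (rt u Uu) Psi_div//.
  by apply: laurentP => k; rewrite lmonomE mul0rn.
have E k l m : nab2 h0met hq k l m = half * third * nab2 h0met (lc Psi) k l m.
  rewrite /nab2 /hq derM !actZ derM (der_half (tang A)) (der_third (tang A)).
  by rewrite /=; ring.
by rewrite (@eq_con _ (tang A) h0met _ _ (fun k l => E k l i)) conZ t0 mulr0.
Qed.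

Lemma hr_tr : 4 * con h0met hr = normsq h0met hp :> A.
Proof.
have r4 k l : relr (fun u => h 4%N c u k l) (lc (h 4%N) k l) by exact: rel_const_clift.
have rt := rel_tr2 cD cN cM c1 rel_const_ih0 r4.
have rp k l : relr (schouten (@partial R 3) (h0 c) k l) (hp k l).
  by rewrite hpE; exact: rel_const_sch.
have rn := rel_normsq2 cD cN cM c1 rel_const_ih0 rp.
have r6 : relr (fun=> (3`!%:R)^-1) (half * third).
  rewrite (_ : (3`!%:R)^-1 = 2^-1 * 3^-1 :> R).
    by apply: cM; [exact: rel_const_half|exact: rel_const_third].
  by rewrite -invfM -natrM.
have rl := cM r6 rt.
have E : half * third * con h0met (lc (h 4%N)) = normsq h0met hp :> A.
  by apply: cfunP => u Uu; rewrite (rl u Uu) (rn u Uu) h_4.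
rewrite -E /hr conZ.
transitivity ((half * 2) * (half * 2) * (half * third * con h0met (lc (h 4%N))) : A).
  by ring.
by rewrite half2; ring.
Qed.

Lemma xxXE n u : U u -> ((xx ^+ n : A) : cfun Ud) u = lmonom 1 n%:Z.
Proof.
move=> Uu; elim: n => [|n IH]; first by rewrite lmonom1 -[LHS]/((1 : cfun Ud) u) coneE.
rewrite exprS -[LHS]/(ccst Ud (lmonom 1 1) u * ((xx ^+ n : A) : cfun Ud) u).
by rewrite IH ccstE// lmonomM mulr1 -intS.
Qed.

Lemma xxM_E n F (f : A) u (k : int) : relr F f -> U u ->
  ((xx ^+ n * f : A) : cfun Ud) u k = F u *+ (k == n%:Z).
Proof.
move=> rF Uu; rewrite -[LHS]/((((xx ^+ n : A) : cfun Ud) u * (f : cfun Ud) u) k).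
rewrite xxXE// (rF u Uu) lmonomM mul1r addr0.
exact: lmonomE.
Qed.

(** Both sides have the same five first coefficients: h' = 0, h'' = - 2 P, and
    the factorials 2, 6 and 24 are those of p, q and r. *)
Lemma h_expansion i j : cong 5 (hmet i j : A)
  (h0met i j - xx ^+ 2 * hp i j + xx ^+ 3 * hq i j + xx ^+ 4 * hr i j).
Proof.
have rh := rel_const_half; have rt := rel_const_third.
have rp : relr (fun u => - (2^-1 * h 2%N c u i j)) (hp i j).
  by apply: cN; apply: cM => //; exact: rel_const_clift.
have rq : relr (fun u => 2^-1 * 3^-1 * Psi c u i j) (hq i j).
  by do ![apply: cM => //]; exact: rel_const_clift.
have rr : relr (fun u => 2^-1 * 2^-1 * 2^-1 * 3^-1 * h 4%N c u i j) (hr i j).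
  by do ![apply: cM => //]; exact: rel_const_clift.
move=> u k k5; have [Uu|Uu] := pselect (U u); last by rewrite cfun_off.
rewrite -[LHS]/((hseries i j : cfun Ud) u k - ((clift (h0_smooth i j) : cfun Ud) u k
  - ((xx ^+ 2 * hp i j : A) : cfun Ud) u k + ((xx ^+ 3 * hq i j : A) : cfun Ud) u k
  + ((xx ^+ 4 * hr i j : A) : cfun Ud) u k)).
rewrite (xxM_E 2 k rp Uu) (xxM_E 3 k rq Uu) (xxM_E 4 k rr Uu) cliftE// lmonomE.
rewrite /hseries slift_coef//.
case: k k5 => [m|m] k5; last by rewrite !mulr0n; ring.
have : (m < 5)%N by [].
case: m k5 => [|[|[|[|[|//]]]]] _ _; rewrite mxE /= ?mulr1n ?mulr0n.
- by rewrite h_0// invr1; ring.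
- by rewrite h_1// mxE mul0r; ring.
- by rewrite mulrC; ring.
- by rewrite h_3// -invfM -[3`!]/(2 * 3)%N natrM; ring.
by rewrite -!invfM -[4`!]/(2 * 2 * 2 * 3)%N !natrM; ring.
Qed.

Lemma chart_bach_einstein :
  (forall u, U u -> forall a b, bach D4 NF a b u = 0) ->
  (forall u, U u -> qcurv4 D4 NF u = lmonom 6 0) ->
  forall u, U u -> forall a b, ricci D4 NF a b u + 3 * NF u a b = 0.
Proof.
move=> B0 Q6 u Uu a b; rewrite (rein a b Uu).
have oc (T : sym2 M) k l : ord 0 (lc T k l) by exact: ord_clift.
have oh : ord 0 (half : A) := ord_half A; have ot : ord 0 (third : A) := ord_third A.
have op k l : ord 0 (hp k l) by apply: ordN; exact: ordZ.
have oq k l : ord 0 (hq k l) by do ![apply: ordZ => //].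
have orr k l : ord 0 (hr k l) by do ![apply: ordZ => //].
have d0 (T : sym2 M) k l : der A 0 (lc T k l) = 0 by exact: der0_clift.
have dp k l : der A 0 (hp k l) = 0 by rewrite raddfN derM der_half d0 mul0r mulr0 addr0 oppr0.
have dh : der A 0 half = 0 := der_half A 0; have dt : der A 0 third = 0 := der_third A 0.
have dq k l : der A 0 (hq k l) = 0 by rewrite !derM dh dt d0; ring.
have dr k l : der A 0 (hr k l) = 0 by rewrite !derM dh dt d0; ring.
have dh0 k l : der A 0 (h0met k l) = 0 by exact: der0_clift.
have dih0 k l : der A 0 (imet h0met k l) = 0 by exact: der0_clift.
have E1 := ord1_ein ordh ordih ordh0 ordih0 dh0 dih0 oq orr dq dr hpE op dp
  h_expansion hq_tr hq_div hr_tr.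
have E3 := ord3_ein0 ordh ordih ordh0 ordih0 dh0 dih0 oq orr dq dr hpE op dp
  h_expansion hq_tr hq_div hr_tr.
have bach0 a' b' : bach4 g a' b' = 0.
  by apply: cfunP => v Uv; rewrite -(rbach a' b' Uv) B0.
have Q0 : Q4 g = 6.
  apply: cfunP => v Uv; rewrite -(rQ Uv) Q6// -[RHS]/((6%:R : cfun Ud) v) cnatE//.
  by apply: laurentP => k; rewrite lnatE lmonomE.
apply: laurentP => k; rewrite l0E.
by apply: (einstein_ord bach0 Q0 E1 E3 (k + 1)); rewrite ltrDl.
Qed.

End Chart.

Theorem corollary1p3 (R : realType) (M : smooth_manifold R 3)
  (h0 Psi : sym2 M) (h : nat -> sym2 M)
  (h0_riem : riemannian h0)
  (Psi_tr : forall (c : chart M) u, chart_img c u ->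
    tr2 (h0 c) (fun i j v => Psi c v i j) u = 0)
  (Psi_div : forall (c : chart M) u, chart_img c u -> forall k,
    div2 (@partial R 3) (h0 c) (fun i j v => Psi c v i j) k u = 0)
  (h_0 : forall (c : chart M) u, chart_img c u -> h 0%N c u = h0 c u)
  (h_1 : forall (c : chart M) u, chart_img c u -> h 1%N c u = 0)
  (h_2 : forall (c : chart M) u, chart_img c u -> forall i j,
    h 2%N c u i j = - 2 * schouten (@partial R 3) (h0 c) i j u)
  (h_3 : forall (c : chart M) u, chart_img c u -> h 3%N c u = Psi c u)
  (h_4 : forall (c : chart M) u, chart_img c u ->
    (3`!%:R)^-1 * tr2 (h0 c) (fun i j v => h 4%N c v i j) u =
    normsq2 (h0 c) (schouten (@partial R 3) (h0 c)) u) :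
  (formal_bach_flat h /\ formal_Q_eq 6 h) <-> formal_einstein h.
Proof.
split=> [[B0 Q6] c u Uu a b|E0].
  exact: (chart_bach_einstein h0_riem (h_0 c) (Psi_tr c) (Psi_div c) (h_1 c) (h_2 c)
    (h_3 c) (h_4 c) (B0 c) (Q6 c) Uu).
by split=> c; have [] := chart_einstein_bach h0_riem (h_0 c) (E0 c).
Qed.
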